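(* Let $c\in\mathbb R$ be fixed with $|c|<1$, and let $\psi\in H^2_{\rm loc}(\mathbb R)$ with $\psi-\bar\theta\in H^2(\mathbb R)$ be a solution of $$c^2\psi''-\nu c\,\psi'+\nabla\mathcal E(\psi)=H\cos\psi,\qquad \psi(-\infty)=-\pi/2,\quad \psi(\infty)=\pi/2.$$ Then: (a) There exist two positive constants $C_1=C_1(\bar\theta)$ and $C_2=C_2(\bar\theta)$, depending on $\bar\theta$, such that $$\|\sin\psi-\sin\bar\theta\|_{H^1}\le C_1(\bar\theta)\,\|\psi-\bar\theta\|_{H^1},\qquad \|\cos\psi-\cos\bar\theta\|_{H^1}\le C_2(\bar\theta)\,\|\psi-\bar\theta\|_{H^1}.$$ (b) $\psi$ is a smooth function with $\psi'\in H^k(\mathbb R)$ for any $k>0$.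
   Context: Here $\nu>0$ and $H\in\mathbb R$ are constants and $\psi$ is real valued. $(-\Delta)^{1/2}$ is the Fourier multiplier $|\xi|$ and $\mathcal T:=1+(-\Delta)^{1/2}$. The energy is $\mathcal E(\theta)=\frac12\big(\|\theta'\|_{L^2}^2+\|\cos\theta\|_{\dot H^{1/2}}^2+\|\cos\theta\|_{L^2}^2\big)$ with $\|u\|_{\dot H^{1/2}}=\||\xi|^{1/2}\widehat u\|_{L^2}$, and $\nabla\mathcal E(\theta)=-\theta''-\sin\theta\,\mathcal T(\cos\theta)$ is its $L^2$-gradient. The static Néel wall phase $\bar\theta$ is the unique odd, monotone increasing, smooth solution of $\nabla\mathcal E(\bar\theta)=0$ on $\mathbb R$ with $\bar\theta(\pm\infty)=\pm\pi/2$ (the minimizer of $\mathcal E$ under these limits); it satisfies $\bar\theta'\in H^k$ for all integers $k\ge0$. Both $\bar\theta$ and $\psi$ are regarded as functions of the same variable $z\in\mathbb R$. *)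

(* Defs.v *)
From HB Require Import structures.
From mathcomp Require Import all_boot all_order all_algebra.
From mathcomp Require Import all_classical all_reals all_analysis.

Set Implicit Arguments.
Unset Strict Implicit.
Unset Printing Implicit Defensive.
Import Order.TTheory GRing.Theory Num.Theory.
Import numFieldNormedType.Exports.

Local Open Scope classical_set_scope.
Local Open Scope ring_scope.

Definition smooth (R : realType) (f : R -> R) : Prop :=
  forall (n : nat) (x : R), derivable (derive1n n f) x 1.

Definition test_function (R : realType) (phi : R -> R) : Prop :=
  smooth phi /\ compact (closure [set x | phi x != 0]).

Definition L2 (R : realType) (u : R -> R) : Prop :=
  u \in Lfun (@lebesgue_measure R) 2%:E.

Definition L2_loc (R : realType) (u : R -> R) : Prop :=
  measurable_fun [set: R] u /\
  forall K : set R, compact K ->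
    (\int[@lebesgue_measure R]_(x in K) ((u x) ^+ 2)%:E < +oo)%E.

(* [v] is the [n]-th distributional derivative of [u]; it is determined by [u]
   up to a null set. *)
Definition weak_derivative (R : realType) (n : nat) (u v : R -> R) : Prop :=
  [/\ locally_integrable [set: R] u,
      locally_integrable [set: R] v
    & forall phi : R -> R, test_function phi ->
        \int[@lebesgue_measure R]_x (u x * derive1n n phi x) =
        (-1) ^+ n * \int[@lebesgue_measure R]_x (v x * phi x)].

Definition sobolev (R : realType) (k : nat) (u : R -> R) : Prop :=
  forall j : nat, (j <= k)%N -> exists2 v, weak_derivative j u v & L2 v.

Definition sobolev_loc (R : realType) (k : nat) (u : R -> R) : Prop :=
  forall j : nat, (j <= k)%N -> exists2 v, weak_derivative j u v & L2_loc v.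

(* The H^k norm, as an extended real.  All choices of weak derivatives [D j]
   give the same value, so the infimum is over at most one number, and it is
   [+oo] exactly when [u] is not in H^k. *)
Definition sobolev_norm (R : realType) (k : nat) (u : R -> R) : \bar R :=
  ereal_inf [set N | exists2 D : nat -> R -> R,
    forall j : nat, (j <= k)%N -> weak_derivative j u (D j) &
    N = sqrte (\sum_(j < k.+1)
                 \int[@lebesgue_measure R]_x ((D j x) ^+ 2)%:E)%E].

(* Real and imaginary parts of
   (2 pi)^(-1/2) * \int_(-N)^N u(x) exp(- i x xi) dx. *)
Definition trunc_fourier_re (R : realType) (u : R -> R) (N : nat) (xi : R) : R :=
  (Num.sqrt (2 * pi))^-1 *
  \int[@lebesgue_measure R]_(x in `[- N%:R, N%:R]) (u x * cos (x * xi)).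

Definition trunc_fourier_im (R : realType) (u : R -> R) (N : nat) (xi : R) : R :=
  - ((Num.sqrt (2 * pi))^-1 *
     \int[@lebesgue_measure R]_(x in `[- N%:R, N%:R]) (u x * sin (x * xi))).

(* [a + i b] is the Fourier-Plancherel transform of the real valued [u] in L^2,
   that is, the L^2 limit of the transforms of the truncations of [u] to
   [-N, N]. *)
Definition is_fourier (R : realType) (u a b : R -> R) : Prop :=
  [/\ L2 u, L2 a, L2 b,
      Lnorm (@lebesgue_measure R) 2%:E
        (fun xi => (trunc_fourier_re u N xi - a xi)%:E) @[N --> \oo] --> 0%E
    & Lnorm (@lebesgue_measure R) 2%:E
        (fun xi => (trunc_fourier_im u N xi - b xi)%:E) @[N --> \oo] --> 0%E].

(* [w] is (-Delta)^(1/2) u: its transform is |xi| times that of [u]. *)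
Definition is_half_laplacian (R : realType) (u w : R -> R) : Prop :=
  exists a b : R -> R, is_fourier u a b /\
    is_fourier w (fun xi => `|xi| * a xi) (fun xi => `|xi| * b xi).

Definition is_T (R : realType) (u t : R -> R) : Prop :=
  exists2 w : R -> R, is_half_laplacian u w & t = u \+ w.

(* [g] = - theta'' - sin theta T(cos theta), the L^2-gradient at [theta] of
   the energy (|theta'|_2^2 + | |xi|^(1/2) (cos theta)^ |_2^2
   + |cos theta|_2^2) / 2. *)
Definition is_gradE (R : realType) (theta g : R -> R) : Prop :=
  exists theta2 t : R -> R,
    [/\ weak_derivative 2 theta theta2,
        is_T (cos \o theta) t
      & {ae @lebesgue_measure R, forall z,
          g z = - theta2 z - sin (theta z) * t z}].

Record static_neel_wall (R : realType) (theta : R -> R) : Prop := {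
  neel_odd : forall x, theta (- x) = - theta x ;
  neel_increasing : {homo theta : x y / x <= y} ;
  neel_smooth : smooth theta ;
  neel_critical : is_gradE theta (cst 0) ;
  neel_ninfty : theta x @[x --> -oo] --> - (pi / 2) ;
  neel_pinfty : theta x @[x --> +oo] --> pi / 2 ;
  neel_derivative : forall k : nat, sobolev k (derive1 theta)
}.

(* Elements of H^2_loc are identified with their continuous representative,
   which gives a meaning to the limits at infinity. *)
Record travelling_wave (R : realType) (nu H c : R) (thetab psi : R -> R) :
    Prop := {
  wave_continuous : continuous psi ;
  wave_H2_loc : sobolev_loc 2 psi ;
  wave_H2 : sobolev 2 (psi \- thetab) ;
  wave_equation : exists psi1 psi2 g : R -> R,
    [/\ weak_derivative 1 psi psi1,
        weak_derivative 2 psi psi2,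
        is_gradE psi g
      & {ae @lebesgue_measure R, forall z,
          c ^+ 2 * psi2 z - nu * c * psi1 z + g z = H * cos (psi z)}] ;
  wave_ninfty : psi z @[z --> -oo] --> - (pi / 2) ;
  wave_pinfty : psi z @[z --> +oo] --> pi / 2
}.

(* Main.v *)
Require Import Defs.
From mathcomp Require Import all_boot all_order all_algebra.
From mathcomp Require Import all_classical all_reals all_analysis.
From mathcomp Require Import measurable_realfun.
From mathcomp Require Import ring lra.
Import Order.TTheory GRing.Theory Num.Theory.
Import numFieldNormedType.Exports.
Local Open Scope classical_set_scope.
Local Open Scope ring_scope.

Set Implicit Arguments.
Unset Strict Implicit.
Unset Printing Implicit Defensive.

(** Part (b) is a bootstrap.  Since c^2 <> 1, the equation expresses psi''
    through psi' and sin psi (T cos psi), and the half Laplacian in T costs one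
    derivative of cos psi, so psi'' is as regular as psi' ([wave_bootstrap]).
    Starting from psi - thetab in H^2 and from thetab' in every H^k, this puts
    psi' into every H^k, and a function all of whose derivatives are in L2 is
    smooth ([Sob_smooth]).

    Two function classes carry the argument.  [Sob k] consists of the H^k
    functions that are absolutely continuous representatives of themselves; the
    relation [AC f g] says that g is an almost everywhere derivative of f.  The
    lemma of du Bois-Reymond ([ae_cst_of_test]) gives the passage from weak
    derivatives to such representatives ([sobolev_ae]).  The function sin psi
    is not in L2, but multiplication by it preserves [Sob k]; this is the class
    [Mult k], with the product rule [Mult_Sob].

    What remains is that the half Laplacian maps order k + 1 to order k
    ([half_laplacian_Sob]), where it is given by |xi| on the side of the
    Fourier-Plancherel transform, a limit of transforms of truncations.  The
    link between xi and the derivative is the symmetric difference quotient,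
    whose multiplier i sin(h xi) / h is bounded by |xi| and tends to i xi.  If
    u' is in L2, the quotients of u are bounded in L2, and Fatou's lemma puts
    xi times the transform into L2 ([fourier_derivative_L2]).  Conversely, if
    this product is in L2, the quotients of u are Cauchy and converge to the
    weak derivative ([fourier_weak_derivative]).

    The first direction uses that the transform is bounded on L2 and the second
    that its inverse is; constants do not matter.  For these bounds the
    transform is weighted by exp(- e |xi|), which corresponds to convolution
    with the Poisson kernel ([abel_parseval]).  Positivity of the kernel gives
    the upper bound ([plancherel_le]); convergence of Poisson integrals gives the lower
    one for truncated continuous functions, and density extends it
    ([plancherel_ge]).

    Part (a) is the chain rule with 1-Lipschitz functions
    ([sobolev_norm1_comp]); thetab' is bounded because it is in H^1. *)

(** * Square integrable and integrable functions on the line *)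

Section SquareIntegrable.
Context {R : realType}.
Notation mu := (@lebesgue_measure R).
Implicit Types (f g h u v : R -> R) (a : R).

(** The square of the L2 norm, as an extended real.  Used
    instead of the norm, it turns the triangle inequality into the pointwise
    (x + y)^2 <= 2 x^2 + 2 y^2, at the price of constants in Plancherel's
    theorem. *)
Definition sqn f : \bar R := (\int[mu]_x ((f x) ^+ 2)%:E)%E.
Definition intg f : Prop := mu.-integrable [set: R] (EFin \o f).

Lemma eq_le_of (d : Order.disp_t) (T : porderType d) (x y : T) : x = y -> (x <= y)%O.
Proof. by move->. Qed.

Lemma measurable_sqr f : measurable_fun [set: R] f ->
  measurable_fun [set: R] (fun x => ((f x) ^+ 2)%:E).
Proof. by move=> mf; apply/measurable_EFinP; exact: measurable_funX. Qed.

Lemma sqn_ge0 f : (0 <= sqn f)%E.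
Proof. by apply: integral_ge0 => x _; rewrite lee_fin sqr_ge0. Qed.

Lemma Lnorm2E f : Lnorm mu 2%:E (EFin \o f) = (sqn f `^ 2^-1)%E.
Proof.
rewrite unlock /Lnorm /sqn; congr (_ `^ _)%E; apply: eq_integral => x _ /=.
by rewrite powR_mulrn// real_normK// num_real.
Qed.

Lemma L2P f : L2 f <-> measurable_fun [set: R] f /\ (sqn f < +oo)%E.
Proof.
rewrite /L2; split.
- move=> fL; split; first by move: fL; rewrite inE => /andP[/set_mem].
  have /integrableP[_] := Lfun2_integrable_sqr fL.
  apply: le_lt_trans; apply: eq_le_of.
  by apply: eq_integral => x _ /=; rewrite ger0_norm// sqr_ge0.
- move=> [mf fy]; rewrite inE; apply/andP; split; rewrite inE//=.
  by rewrite /finite_norm Lnorm2E poweR_lty.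
Qed.

Lemma L2_meas f : L2 f -> measurable_fun [set: R] f.
Proof. by move/L2P => []. Qed.

Lemma L2_lty f : L2 f -> (sqn f < +oo)%E.
Proof. by move/L2P => []. Qed.

Lemma sqn_le f g : measurable_fun [set: R] f -> measurable_fun [set: R] g ->
  (forall x, `|f x| <= `|g x|) -> (sqn f <= sqn g)%E.
Proof.
move=> mf mg fg; apply: ge0_le_integral => //=.
- by move=> x _; rewrite lee_fin sqr_ge0.
- exact: measurable_sqr.
- exact: measurable_sqr.
- move=> x _; rewrite lee_fin -(real_normK (num_real (f x))).
  by rewrite -(real_normK (num_real (g x))) lerXn2r ?nnegrE.
Qed.

Lemma sqnZ a f : measurable_fun [set: R] f ->
  sqn (fun x => a * f x) = ((a ^+ 2)%:E * sqn f)%E.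
Proof.
move=> mf; rewrite /sqn -ge0_integralZl//; last 2 first.
- by move=> x _; rewrite lee_fin sqr_ge0.
- by rewrite lee_fin sqr_ge0.
- by apply: eq_integral => x _; rewrite exprMn EFinM.
- exact: measurable_sqr.
Qed.

Lemma sqnD f g : measurable_fun [set: R] f -> measurable_fun [set: R] g ->
  (sqn (fun x => f x + g x)%R <= 2%:E * sqn f + 2%:E * sqn g)%E.
Proof.
move=> mf mg; rewrite /sqn -!ge0_integralZl//; do ?exact: measurable_sqr;
  do ?by move=> x _; rewrite lee_fin sqr_ge0.
rewrite -ge0_integralD//; last 4 first.
- by move=> x _; rewrite mule_ge0// lee_fin sqr_ge0.
- by apply: measurable_funeM; exact: measurable_sqr.
- by move=> x _; rewrite mule_ge0// lee_fin sqr_ge0.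
- by apply: measurable_funeM; exact: measurable_sqr.
apply: ge0_le_integral => //=.
- by move=> x _; rewrite lee_fin sqr_ge0.
- by apply: measurable_sqr; exact: measurable_funD.
- by apply: emeasurable_funD; apply: measurable_funeM; exact: measurable_sqr.
- move=> x _; rewrite -!EFinM -EFinD lee_fin.
  have : 0 <= (f x - g x) ^+ 2 by exact: sqr_ge0.
  nra.
Qed.

Lemma L2_le f g : measurable_fun [set: R] f -> L2 g ->
  (forall x, `|f x| <= `|g x|) -> L2 f.
Proof.
move=> mf /L2P[mg gy] fg; apply/L2P; split => //.
by apply: le_lt_trans gy; exact: sqn_le.
Qed.

Lemma L2D f g : L2 f -> L2 g -> L2 (fun x => f x + g x).
Proof.
move=> /L2P[mf fy] /L2P[mg gy]; apply/L2P; split; first exact: measurable_funD.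
apply: le_lt_trans (sqnD mf mg) _.
by rewrite lte_add_pinfty// lte_mul_pinfty.
Qed.

Lemma L2Z a f : L2 f -> L2 (fun x => a * f x).
Proof.
move=> /L2P[mf fy]; apply/L2P; split; first exact: measurable_funM.
by rewrite sqnZ// lte_mul_pinfty ?lee_fin ?sqr_ge0.
Qed.

Lemma L2N f : L2 f -> L2 (fun x => - f x).
Proof.
move=> Lf; have := L2Z (-1) Lf.
by rewrite (_ : (fun x => -1 * f x) = (fun x => - f x))//; apply/funext => x; rewrite mulN1r.
Qed.

Lemma sqnN f : sqn (fun x => - f x) = sqn f.
Proof. by apply: eq_integral => x _; rewrite sqrrN. Qed.

Lemma L2B f g : L2 f -> L2 g -> L2 (fun x => f x - g x).
Proof. by move=> Lf Lg; apply: L2D => //; exact: L2N. Qed.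

Lemma sqnB f g : measurable_fun [set: R] f -> measurable_fun [set: R] g ->
  (sqn (fun x => f x - g x)%R <= 2%:E * sqn f + 2%:E * sqn g)%E.
Proof.
move=> mf mg; rewrite -(sqnN g); apply: sqnD => //.
exact: measurableT_comp.
Qed.

Lemma sqn_dist f g h : measurable_fun [set: R] f -> measurable_fun [set: R] g ->
  measurable_fun [set: R] h ->
  (sqn (fun x => f x - h x)%R <=
    2%:E * sqn (fun x => f x - g x)%R + 2%:E * sqn (fun x => g x - h x)%R)%E.
Proof.
move=> mf mg mh; apply: le_trans (sqnD _ _).
- by apply: eq_le_of; apply: eq_integral => x _; rewrite addrA subrK.
- exact: measurable_funB.
- exact: measurable_funB.
Qed.

Lemma sqnC f g : sqn (fun x => f x - g x) = sqn (fun x => g x - f x).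
Proof. by apply: eq_integral => x _; rewrite -sqrrN opprB. Qed.

Lemma L2Mb f g M : measurable_fun [set: R] f -> (forall x, `|f x| <= M) -> L2 g ->
  L2 (fun x => f x * g x).
Proof.
move=> mf fM Lg; apply: (L2_le _ (L2Z M Lg)).
  by apply: measurable_funM => //; exact: L2_meas.
move=> x; rewrite !normrM ler_wpM2r//.
by rewrite (le_trans (fM x))// ler_norm.
Qed.

Lemma L2M_intg f g : L2 f -> L2 g -> intg (fun x => f x * g x).
Proof. by move=> Lf Lg; have /Lfun1_integrable := Lfun2_mul_Lfun1 Lf Lg. Qed.

Lemma L2_sqr_intg f : L2 f -> intg (fun x => f x ^+ 2).
Proof. exact: Lfun2_integrable_sqr. Qed.

Lemma intg_meas f : intg f -> measurable_fun [set: R] f.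
Proof. by move=> /integrableP[/measurable_EFinP]. Qed.

Lemma intg_le f g : measurable_fun [set: R] f -> intg g ->
  (forall x, `|f x| <= `|g x|) -> intg f.
Proof.
move=> mf ig fg; apply: le_integrable ig => //; first exact/measurable_EFinP.
by move=> x _; rewrite lee_fin.
Qed.

Lemma intgD f g : intg f -> intg g -> intg (fun x => f x + g x).
Proof. by move=> fi gi; have := integrableD measurableT fi gi; apply. Qed.

Lemma intgZ a f : intg f -> intg (fun x => a * f x).
Proof.
move=> fi; have := integrableZl measurableT a fi.
by rewrite /intg; congr (_.-integrable _ _).
Qed.

Lemma intgN f : intg f -> intg (fun x => - f x).
Proof. by move=> /(intgZ (-1)); congr intg; apply/funext => x; rewrite mulN1r. Qed.

Lemma intgB f g : intg f -> intg g -> intg (fun x => f x - g x).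
Proof. by move=> fi gi; apply: intgD => //; exact: intgN. Qed.

Lemma intgMb f g M : measurable_fun [set: R] f -> (forall x, `|f x| <= M) -> intg g ->
  intg (fun x => f x * g x).
Proof.
move=> mf fM ig; apply: (intg_le _ (intgZ M ig)).
  by apply: measurable_funM => //; exact: intg_meas.
by move=> x; rewrite !normrM ler_wpM2r// (le_trans (fM x))// ler_norm.
Qed.

Lemma RintZ a f : intg f -> \int[mu]_x (a * f x) = a * \int[mu]_x f x.
Proof. exact: RintegralZl. Qed.

Lemma RintD f g : intg f -> intg g ->
  \int[mu]_x (f x + g x) = \int[mu]_x f x + \int[mu]_x g x.
Proof. exact: RintegralD. Qed.

Lemma RintB f g : intg f -> intg g ->
  \int[mu]_x (f x - g x) = \int[mu]_x f x - \int[mu]_x g x.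
Proof. exact: RintegralB. Qed.

Lemma eq_Rint f g : f =1 g -> \int[mu]_x f x = \int[mu]_x g x.
Proof. by move=> fg; apply: eq_Rintegral => x _. Qed.

Lemma Rint_fin f : intg f -> (\int[mu]_x (f x)%:E)%E = (\int[mu]_x f x)%:E.
Proof. by move=> fi; rewrite fineK//; exact: integrable_fin_num. Qed.

Lemma sqn_fin f : L2 f -> sqn f = (\int[mu]_x (f x ^+ 2))%:E.
Proof. by move=> /L2_sqr_intg/Rint_fin. Qed.

End SquareIntegrable.

(** * Translation invariance *)

Section Translation.
Context {R : realType}.
Notation mu := (@lebesgue_measure R).
Implicit Types (f g : R -> R) (h : R).

Lemma measurable_shift h : measurable_fun [set: R] (fun x : R => x + h).
Proof. by apply: measurable_funD. Qed.

(** Lebesgue measure is determined by its values on half-open intervals, whose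
    lengths a translation preserves. *)
Lemma lebesgue_measure_shift h (A : set R) : measurable A ->
  pushforward mu ((fun x => x + h) : _ -> measurableTypeR R) A = mu A.
Proof.
move=> mA; apply/esym/lebesgue_measure_unique => //=.
  exact: measurable_shift.
move=> mh _ [[a b]] _ <-.
rewrite /pushforward.
rewrite (_ : _ @^-1` _ = `]a - h, b - h]%classic); last first.
  by apply/seteqP; split => x /=; rewrite !in_itv/= lerBrDr ltrBlDr.
rewrite !lebesgue_measure_itv/= !lte_fin ltrD2r.
by case: ifP => // _; rewrite -!EFinB opprB addrA subrK.
Qed.

Lemma ge0_integral_shift h (f : R -> \bar R) : measurable_fun [set: R] f ->
  (forall x, 0 <= f x)%E -> (\int[mu]_x f (x + h)%R = \int[mu]_x f x)%E.
Proof.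
move=> mf f0; have mh := @measurable_shift h.
pose phi : R -> measurableTypeR R := fun x => (x + h)%R.
transitivity (\int[mu]_(x in phi @^-1` setT) (f \o phi) x)%E.
  by rewrite preimage_setT.
rewrite -ge0_integral_pushforward//=.
by apply: eq_measure_integral => //= A mA _; exact: lebesgue_measure_shift.
Qed.

Lemma integral_shift h (f : R -> \bar R) : measurable_fun [set: R] f ->
  (\int[mu]_x f (x + h)%R = \int[mu]_x f x)%E.
Proof.
move=> mf; rewrite [LHS]integralE [RHS]integralE; congr (_ - _)%E.
- by rewrite -(ge0_integral_shift h (measurable_funepos mf))//; apply: eq_integral => x _; rewrite !funeposE.
- by rewrite -(ge0_integral_shift h (measurable_funeneg mf))//; apply: eq_integral => x _; rewrite !funenegE.
Qed.

Lemma measurable_fun_shift h d (T : measurableType d) (f : R -> T) :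
  measurable_fun [set: R] f -> measurable_fun [set: R] (fun x => f (x + h)).
Proof. by move=> mf; apply: (measurableT_comp mf); exact: measurable_shift. Qed.

Lemma Rint_shift h f : measurable_fun [set: R] f ->
  \int[mu]_x f (x + h) = \int[mu]_x f x.
Proof.
move=> mf; rewrite /Rintegral; congr fine.
by rewrite (integral_shift h (f := EFin \o f))//; exact/measurable_EFinP.
Qed.

Lemma sqn_shift h f : measurable_fun [set: R] f ->
  sqn (fun x => f (x + h)) = sqn f.
Proof.
move=> mf; rewrite /sqn (integral_shift h (f := fun x => ((f x) ^+ 2)%:E))//.
exact: measurable_sqr.
Qed.

Lemma L2_shift h f : L2 f -> L2 (fun x => f (x + h)).
Proof.
move=> /L2P[mf fy]; apply/L2P; split; first exact: measurable_fun_shift.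
by rewrite sqn_shift.
Qed.

Lemma intg_shift h f : intg f -> intg (fun x => f (x + h)).
Proof.
move=> fi; have mf := intg_meas fi.
case/integrableP : fi => _ fy; apply/integrableP; split.
  by apply/measurable_EFinP; exact: measurable_fun_shift.
rewrite (integral_shift h (f := fun x => `|f x|%:E))//.
by apply/measurable_EFinP; exact: measurableT_comp.
Qed.

End Translation.

(** * Double integrals with a bounded kernel *)

Section Kernels.
Context {R : realType}.
Notation mu := (@lebesgue_measure R).
Implicit Types (f g : R -> R) (k : R * R -> R).

Lemma intg_prod f g k M : intg f -> intg g -> measurable_fun [set: R * R] k ->
  (forall z, `|k z| <= M) ->
  (mu \x mu)%E.-integrable setT (EFin \o (fun z : R * R => f z.1 * (g z.2 * k z))).
Proof.
move=> fi gi mk kM.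
have mf := intg_meas fi; have mg := intg_meas gi.
have mfg : measurable_fun [set: R * R] (fun z : R * R => f z.1 * g z.2).
  by apply: measurable_funM; apply: measurableT_comp.
have : (mu \x mu)%E.-integrable setT (EFin \o (fun z : R * R => f z.1 * g z.2)).
  apply/integrable12ltyP; first exact/measurable_EFinP.
  case/integrableP : (fi) => _ fy; case/integrableP : (gi) => _ gy.
  under eq_integral => x _.
    under eq_integral => y _ do rewrite /= normrM EFinM.
    rewrite ge0_integralZl//; last first.
      by apply/measurable_EFinP; exact: measurableT_comp.
    over.
  rewrite /= ge0_integralZr//.
  - by rewrite lte_mul_pinfty//; [exact: integral_ge0|exact: integrable_fin_num (integrable_norm fi)].
  - by apply/measurable_EFinP; exact: measurableT_comp.
  - exact: integral_ge0.
move=> /(integrableZl measurableT M); apply: le_integrable => //.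
  apply/measurable_EFinP; apply: measurable_funM; first exact: measurableT_comp.
  by apply: measurable_funM => //; exact: measurableT_comp.
move=> [x y] _ /=; rewrite lee_fin !normrM mulrA mulrC.
by rewrite ler_wpM2r// ?mulr_ge0// (le_trans (kM _))// ler_norm.
Qed.

(** A bounded kernel does not spoil the integrability of f(x) g(y) on the plane,
    so Fubini's theorem applies.  The kernels used are the indicator of a
    triangle, in the product rule, and the kernels of the Fourier transform. *)
Lemma Fubini_kernel f g k M : intg f -> intg g -> measurable_fun [set: R * R] k ->
  (forall z, `|k z| <= M) ->
  \int[mu]_x (f x * \int[mu]_y (g y * k (x, y))) =
  \int[mu]_y (g y * \int[mu]_x (f x * k (x, y))).
Proof.
move=> fi gi mk kM.
have I := intg_prod fi gi mk kM.
have := Fubini I; rewrite /= => F.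
have gk x : intg (fun y => g y * k (x, y)).
  rewrite (_ : (fun y => _) = (fun y => k (x, y) * g y)); last by apply/funext => y; rewrite mulrC.
  apply: (@intgMb _ _ _ M) => //.
  by apply: measurableT_comp => //; exact: measurable_pair1.
have fk y : intg (fun x => f x * k (x, y)).
  rewrite (_ : (fun x => _) = (fun x => k (x, y) * f x)); last by apply/funext => x; rewrite mulrC.
  apply: (@intgMb _ _ _ M) => //.
  by apply: measurableT_comp => //; exact: measurable_pair2.
rewrite /Rintegral; apply: (congr1 fine).
transitivity (\int[mu]_x \int[mu]_y (f x * (g y * k (x, y)))%:E)%E.
  apply: eq_integral => x _; rewrite -RintZ//.
  rewrite Rint_fin//; exact: intgZ.
rewrite F; apply: eq_integral => y _.
rewrite -RintZ// -Rint_fin; last exact: intgZ.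
by apply: eq_integral => x _; congr EFin; ring.
Qed.

Lemma intg_kernel f g k M : intg f -> intg g -> measurable_fun [set: R * R] k ->
  (forall z, `|k z| <= M) -> intg (fun x => f x * \int[mu]_y (g y * k (x, y))).
Proof.
move=> fi gi mk kM; have I := intg_prod fi gi mk kM.
have := integrable_fubini_F I; rewrite /fubini_F /=.
have gk x : intg (fun y => g y * k (x, y)).
  rewrite (_ : (fun y => _) = (fun y => k (x, y) * g y)); last by apply/funext => y; rewrite mulrC.
  apply: (@intgMb _ _ _ M) => //.
  by apply: measurableT_comp => //; exact: measurable_pair1.
rewrite /intg; congr (_.-integrable _ _); apply/funext => x /=.
by rewrite -RintZ// Rint_fin//; exact: intgZ.
Qed.

End Kernels.

(** * Absolutely continuous functions *)

Section AbsolutelyContinuous.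
Context {R : realType}.
Notation mu := (@lebesgue_measure R).
Implicit Types (f g : R -> R) (a b : R).

Definition locint f : Prop := locally_integrable [set: R] f.

Lemma locint_meas f : locint f -> measurable_fun [set: R] f.
Proof. by case. Qed.

Lemma locint_itv f a b : locint f -> mu.-integrable `[a, b] (EFin \o f).
Proof.
move=> [mf _ fK]; apply/integrableP; split.
  by apply/measurable_EFinP; exact: measurable_funS mf.
exact: (fK _ _ (@segment_compact _ a b)).
Qed.

Lemma locintP f : measurable_fun [set: R] f ->
  (forall a b, mu.-integrable `[a, b] (EFin \o f)) -> locint f.
Proof.
move=> mf fi; split => //; first exact: openT.
move=> K _ cK; have /ex_strict_bound_gt0[M M0 KM] := compact_bounded cK.
have /integrableP[_] := fi (- M) M; apply: le_lt_trans.
apply: ge0_subset_integral => //=.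
- exact: compact_measurable.
- by apply/measurable_EFinP/measurableT_comp => //; exact: measurable_funS mf.
- by move=> x /KM /ltW; rewrite /= in_itv/= ler_norml.
Qed.

(** Turns integrals over intervals into integrals over the whole line, where
    translations and Fubini's theorem are stated. *)
Definition ind a b : R -> R := \1_(`[a, b]%classic).

Lemma indE a b x : ind a b x = ((a <= x <= b)%R : bool)%:R.
Proof.
rewrite /ind indicE (_ : (x \in _) = (a <= x <= b))//.
by apply/idP/idP; rewrite inE/= in_itv.
Qed.

Lemma measurable_ind a b : measurable_fun [set: R] (ind a b).
Proof. exact: measurable_indic. Qed.

Lemma ind_bound a b x : `|ind a b x| <= 1.
Proof. by rewrite indE; case: (_ <= _ <= _); rewrite ?normr1// normr0. Qed.

Lemma ind_ge0 a b x : 0 <= ind a b x.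
Proof. by rewrite indE ler0n. Qed.

Lemma Rint_itvE f a b :
  \int[mu]_(x in `[a, b]) f x = \int[mu]_x (ind a b x * f x).
Proof.
rewrite Rintegral_mkcond; apply: eq_Rint => x; rewrite patchE /ind indicE.
by case: ifP => xab; rewrite ?mul1r ?mul0r.
Qed.

Lemma intg_itvE f a b :
  intg (fun x => ind a b x * f x) <-> mu.-integrable `[a, b] (EFin \o f).
Proof.
rewrite /intg (_ : EFin \o _ = (EFin \o f) \_ `[a, b]).
  by split => [h|h]; [rewrite integrable_mkcond|rewrite -integrable_mkcond].
apply/funext => x /=; rewrite patchE /ind indicE.
by case: ifP => xab; rewrite ?mul1r ?mul0r.
Qed.

Lemma locint_ind f a b : locint f -> intg (fun x => ind a b x * f x).
Proof. by move=> lf; apply/intg_itvE; exact: locint_itv. Qed.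

Lemma intg_ind a b : intg (ind a b).
Proof.
suff : intg (fun x => ind a b x * cst 1 x).
  by congr intg; apply/funext => x; rewrite mulr1.
apply/intg_itvE; apply: continuous_compact_integrable.
  exact: segment_compact.
by apply: continuous_subspaceT => x; exact: cvg_cst.
Qed.

Lemma L2_ind a b : L2 (ind a b).
Proof.
apply/L2P; split; first exact: measurable_ind.
have /integrableP[_] := intg_ind a b.
apply: le_lt_trans; apply: eq_le_of.
by apply: eq_integral => x _ /=; rewrite indE; case: (_ <= _ <= _); rewrite ?expr1n ?normr1// expr0n normr0.
Qed.

Lemma L2_locint f : L2 f -> locint f.
Proof.
move=> Lf; apply: locintP => [|a b]; first exact: L2_meas.
by apply/intg_itvE; apply: L2M_intg => //; exact: L2_ind.
Qed.

Lemma continuous_measurable f : continuous f -> measurable_fun [set: R] f.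
Proof. exact: continuous_measurable_fun. Qed.

Lemma continuous_locint f : continuous f -> locint f.
Proof.
move=> cf; apply: locintP => [|a b]; first exact: continuous_measurable.
apply: continuous_compact_integrable; first exact: segment_compact.
exact: continuous_subspaceT.
Qed.

Lemma locintD f g : locint f -> locint g -> locint (fun x => f x + g x).
Proof. exact: locally_integrableD. Qed.

Lemma locintB f g : locint f -> locint g -> locint (fun x => f x - g x).
Proof. exact: locally_integrableB. Qed.

Lemma continuous_bounded_itv f a b : continuous f ->
  exists2 M : R, 0 < M & forall x, a <= x <= b -> `|f x| <= M.
Proof.
move=> cf.
have := @continuous_compact _ _ f `[a, b]%classic (continuous_subspaceT cf) (@segment_compact _ a b).
move=> /compact_bounded/ex_strict_bound_gt0[M M0 fM]; exists M => // x xab.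
by apply/ltW/fM; exists x => //=; rewrite in_itv.
Qed.

Lemma locintM f g : locint f -> continuous g -> locint (fun x => f x * g x).
Proof.
move=> lf cg; apply: locintP => [|a b].
  by apply: measurable_funM; [exact: locint_meas|exact: continuous_measurable].
have [M M0 gM] := continuous_bounded_itv a b cg.
have mg := continuous_measurable cg.
apply/intg_itvE; rewrite (_ : (fun x => _) = (fun x => (ind a b x * g x) * (ind a b x * f x))); last first.
  by apply/funext => x; rewrite indE; case: (_ <= _ <= _); rewrite ?mul1r ?mul0r// mulrC.
apply: (@intgMb _ _ _ M) => //; last exact: locint_ind.
  by apply: measurable_funM => //; exact: measurable_ind.
move=> x; rewrite indE; case: (boolP (a <= x <= b)) => xab /=; rewrite ?mul1r ?mul0r ?normr0 ?(ltW M0)//.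
exact: gM.
Qed.

(** Absolute continuity on bounded intervals.  The almost everywhere derivative
    is part of the data, so that no representative has to be chosen. *)
Definition AC f g : Prop := locint g /\
  forall a b, a <= b -> f b - f a = \int[mu]_(x in `[a, b]) g x.

Lemma Rint_itv_split f a b c : locint f -> a <= b -> b <= c ->
  \int[mu]_(x in `[a, c]) f x = \int[mu]_(x in `[a, b]) f x + \int[mu]_(x in `[b, c]) f x.
Proof.
move=> lf ab bc.
have := @Rintegral_itvB _ f (BLeft a) (BRight c) b (locint_itv a c lf).
rewrite !bnd_simp => /(_ ab bc) E.
rewrite -(@Rintegral_itv_obnd_cbnd _ b (BRight c) f); last first.
  by apply: integrableS (locint_itv b c lf) => //; exact: subset_itv_oc_cc.
by rewrite -E addrC subrK.
Qed.

(** The integral from 0 to x; the sign accounts for the orientation, which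
    integrals over sets do not have. *)
Definition prim g (x : R) : R :=
  if 0 <= x then \int[mu]_(t in `[0, x]) g t else - \int[mu]_(t in `[x, 0]) g t.

Lemma AC_prim g : locint g -> AC (prim g) g.
Proof.
move=> lg; split => // a b ab; rewrite /prim.
have [a0|a0] := leP 0 a.
  by rewrite (le_trans a0 ab) (Rint_itv_split lg a0 ab) addrAC subrr add0r.
have [b0|b0] := leP 0 b.
  by rewrite opprK addrC (Rint_itv_split lg (ltW a0) b0).
by rewrite opprK addrC (Rint_itv_split lg ab (ltW b0)) addrK.
Qed.

Lemma AC_continuous f g : AC f g -> continuous f.
Proof.
move=> [lg fg] x.
have x11 : x - 1 < x + 1 by lra.
have fE y : y \in `[x - 1, x + 1]%classic ->
    f y = f (x - 1) + \int[mu]_(t in `[x - 1, y]) g t.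
  by rewrite inE/= in_itv/= => /andP[xy _]; rewrite -fg// addrC subrK.
have /(continuous_within_itvP _ x11)[h _ _] :=
  parameterized_integral_continuous (ltW x11) (locint_itv _ _ lg).
have xI : x \in `]x - 1, x + 1[ by rewrite in_itv/=; lra.
have hx := h x xI.
have H : (f (x - 1) + parameterized_integral mu (x - 1) y g @[y --> x] -->
    f (x - 1) + parameterized_integral mu (x - 1) x g).
  by apply: cvgD; [exact: cvg_cst|exact: hx].
rewrite /continuous_at fE; last by rewrite inE/= in_itv/=; lra.
apply: (@cvg_trans _ ((fun y => f (x - 1) + parameterized_integral mu (x - 1) y g) @ x)).
  apply: near_eq_cvg; near=> y; apply/esym/fE; near: y.
  apply: filterS (near_in_itvoo xI) => y; rewrite inE/= !in_itv/= => /andP[? ?].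
  by apply/andP; split; exact: ltW.
exact: H.
Unshelve. all: by end_near. Qed.

Lemma AC_locint f g : AC f g -> locint f.
Proof. by move=> /AC_continuous; exact: continuous_locint. Qed.

Lemma ACD f f' g g' : AC f f' -> AC g g' ->
  AC (fun x => f x + g x) (fun x => f' x + g' x).
Proof.
move=> [lf hf] [lg hg]; split; first exact: locintD.
move=> a b ab; rewrite RintegralD//; do ?exact: locint_itv.
by rewrite -hf// -hg//; ring.
Qed.

Lemma ACZ c f f' : AC f f' -> AC (fun x => c * f x) (fun x => c * f' x).
Proof.
move=> [lf hf]; split.
  rewrite (_ : (fun x => _) = fun x => f' x * cst c x); last by apply/funext => x; rewrite mulrC.
  by apply: locintM => // x; exact: cvg_cst.
move=> a b ab; rewrite RintegralZl//; last exact: locint_itv.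
by rewrite -hf//; ring.
Qed.

Lemma AC_cst c : AC (cst c) (cst 0).
Proof.
split; first by apply: continuous_locint => x; exact: cvg_cst.
by move=> a b ab; rewrite /Rintegral integral0 subrr.
Qed.

End AbsolutelyContinuous.

(** * The product rule and the fundamental theorem of calculus *)

Section ProductRule.
Context {R : realType}.
Notation mu := (@lebesgue_measure R).
Implicit Types (f g : R -> R) (a b : R).

(** Integration by parts needs no regularity beyond integrability of the
    derivatives: it is Fubini's theorem on the triangle [y <= x] of the square
    [[a, b]^2], for the function f'(x) g'(y). *)
Lemma ACM f f' g g' : AC f f' -> AC g g' ->
  AC (fun x => f x * g x) (fun x => f' x * g x + f x * g' x).
Proof.
move=> fA gA; have [lf hf] := fA; have [lg hg] := gA.
have cf := AC_continuous fA; have cg := AC_continuous gA.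
have lfg : locint (fun x => f' x * g x) by exact: locintM.
have lgf : locint (fun x => f x * g' x).
  rewrite (_ : (fun x => _) = (fun x => g' x * f x)); last by apply/funext => x; rewrite mulrC.
  exact: locintM.
split; first exact: locintD.
move=> a b ab.
pose F x := ind a b x * f' x; pose G x := ind a b x * g' x.
pose k (z : R * R) : R := ((z.2 <= z.1)%R : bool)%:R.
have mk : measurable_fun [set: R * R] k.
  rewrite (_ : k = \1_[set z : R * R | z.2 <= z.1]); last first.
    apply/funext => z; rewrite /k indicE; congr (nat_of_bool _)%:R.
    by apply/idP/idP; rewrite inE.
  apply: measurable_indic; rewrite -[X in measurable X]setTI.
  exact: (measurable_fun_ler _ _ measurableT).
have k1 z : `|k z| <= 1 by rewrite /k; case: (z.2 <= z.1)%R; rewrite ?normr1// normr0.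
have Fi : intg F by exact: locint_ind.
have Gi : intg G by exact: locint_ind.
have := Fubini_kernel Fi Gi mk k1.
have -> : \int[mu]_x (F x * \int[mu]_y (G y * k (x, y))) =
    \int[mu]_x (ind a b x * (f' x * g x) - g a * F x).
  apply: eq_Rint => x; rewrite /F indE; case: (boolP (a <= x <= b)) => xab /=; last by rewrite !mul0r mulr0 subrr.
  have /andP[ax xb] := xab.
  have -> : \int[mu]_y (G y * k (x, y)) = g x - g a.
    rewrite hg// Rint_itvE; apply: eq_Rint => y.
    rewrite /G /k /= !indE; have [yx|yx] := leP y x; rewrite ?mulr1 ?mulr0 ?andbT.
      by rewrite (le_trans yx xb) andbT.
    by rewrite andbF mul0r.
  ring.
have -> : \int[mu]_y (G y * \int[mu]_x (F x * k (x, y))) =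
    \int[mu]_y (f b * G y - ind a b y * (f y * g' y)).
  apply: eq_Rint => y; rewrite /G indE; case: (boolP (a <= y <= b)) => yab /=; last by rewrite !mul0r mulr0 subrr.
  have /andP[ay yb] := yab.
  have -> : \int[mu]_x (F x * k (x, y)) = f b - f y.
    rewrite hf// Rint_itvE; apply: eq_Rint => x.
    rewrite /F /k /= !indE; have [yx|yx] := leP y x; rewrite ?mulr1 ?mulr0 ?andbT.
      by rewrite (le_trans ay yx).
    by rewrite mul0r.
  ring.
rewrite !RintB ?RintZ//; do ?exact: intgZ; do ?exact: locint_ind.
rewrite -!Rint_itvE -hf// -hg// RintegralD//; do ?exact: locint_itv.
lra.
Qed.

Lemma AC_C1 f g : (forall x : R, is_derive x (1 : R) f (g x)) -> continuous g -> AC f g.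
Proof.
move=> fg cg; split; first exact: continuous_locint.
move=> a b; rewrite le_eqVlt => /predU1P[<-|ab].
  by rewrite subrr set_itv1 Rintegral_set1.
have cf : continuous f.
  by move=> x; apply: differentiable_continuous; apply/derivable1_diffP; case: (fg x).
rewrite /Rintegral (continuous_FTC2 (F := f) ab)//.
- exact: continuous_subspaceT.
- split.
  + by move=> x _; case: (fg x).
  + by apply: cvg_at_right_filter; exact: cf.
  + by apply: cvg_at_left_filter; exact: cf.
- by move=> x _; rewrite derive1E; case: (fg x) => _ ->.
Qed.

Lemma AC_derive f g : AC f g -> continuous g -> forall x : R, is_derive x (1 : R) f (g x).
Proof.
move=> [lg fg] cg x.
have x1 : x - 1 < x by lra. have x2 : x < x + 1 by lra.
pose F y := \int[mu]_(t in `[x - 1, y]) g t.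
have [dF F'] := continuous_FTC1_closed x2 (locint_itv _ _ lg) x1 (cg x).
have fF : \forall y \near x, f y = f (x - 1) + F y.
  have xI : x \in `]x - 1, x + 1[ by rewrite in_itv/=; lra.
  apply: filterS (near_in_itvoo xI) => y; rewrite in_itv/= => /andP[/ltW xy _].
  by rewrite /F -fg// addrC subrK.
have dFx : is_derive x (1 : R) F (g x).
  by split; [exact: dF|rewrite -derive1E; exact: F'].
have := is_deriveD (is_derive_cst (f (x - 1)) x 1) dFx.
rewrite add0r; apply: near_eq_is_derive.
by apply: filterS fF => y ->.
Qed.

End ProductRule.

(** * Limits in L2 *)

Section L2Convergence.
Context {R : realType}.
Notation mu := (@lebesgue_measure R).
Implicit Types (f g h u v : R -> R) (fs gs hs : nat -> R -> R).

Lemma ae_imp (P Q : R -> Prop) : (forall x, P x -> Q x) ->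
  {ae mu, forall x, P x} -> {ae mu, forall x, Q x}.
Proof. by move=> PQ; apply: filterS => //; exact: (ae_filter_ringOfSetsType mu). Qed.

Lemma ae_imp2 (P1 P2 Q : R -> Prop) : (forall x, P1 x -> P2 x -> Q x) ->
  {ae mu, forall x, P1 x} -> {ae mu, forall x, P2 x} -> {ae mu, forall x, Q x}.
Proof. by move=> PQ; apply: filterS2 => //; exact: (ae_filter_ringOfSetsType mu). Qed.

Lemma ae_neq (a : R) : {ae mu, forall x, x != a}.
Proof.
exists [set a]; split; [exact: measurable_set1|exact: lebesgue_measure_set1|].
by move=> x /= /negP; rewrite negbK => /eqP.
Qed.

Definition cvg2 fs f : Prop := sqn (fun x => fs n x - f x) @[n --> \oo] --> 0%E.

Lemma squeeze0 (u v : nat -> \bar R) : (forall n, 0 <= u n)%E ->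
  (forall n, u n <= v n)%E -> v n @[n --> \oo] --> 0%E -> u n @[n --> \oo] --> 0%E.
Proof.
move=> u0 uv v0; apply: (@squeeze_cvge _ _ _ _ (cst 0%E) _ v) => //.
  by apply: nearW => n; rewrite /= u0 uv.
exact: cvg_cst.
Qed.

Lemma cvge0P (u : nat -> \bar R) : (forall n, 0 <= u n)%E ->
  (forall e : R, 0 < e -> exists N, forall n, (N <= n)%N -> (u n <= e%:E)%E) ->
  u n @[n --> \oo] --> 0%E.
Proof.
move=> u0 uN; apply/fine_cvgP; split.
  have [N NP] := uN 1 ltr01; exists N => // n /NP un.
  by rewrite ge0_fin_numE// (le_lt_trans un)// ltry.
apply/cvgrPdist_le => e e0; have [N NP] := uN e e0; exists N => // n Nn.
have un := NP n Nn; rewrite /= sub0r normrN ger0_norm ?fine_ge0//.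
by rewrite -lee_fin fineK// ge0_fin_numE// (le_lt_trans un)// ltry.
Qed.

Lemma cvge0_lt (u : nat -> \bar R) : u n @[n --> \oo] --> 0%E ->
  forall e : R, 0 < e -> exists N, forall n, (N <= n)%N -> (u n < e%:E)%E.
Proof.
move=> /fine_cvgP[[N1 _ N1P] u0] e e0.
have [N2 _ N2P] := cvgr_lt _ u0 _ e0.
exists (maxn N1 N2) => n; rewrite geq_max => /andP[n1 n2].
by rewrite -(fineK (N1P n n1)) lte_fin; exact: N2P.
Qed.

Lemma cvge0D (c : R) (u v : nat -> \bar R) : u n @[n --> \oo] --> 0%E ->
  v n @[n --> \oo] --> 0%E -> (c%:E * u n + c%:E * v n)%E @[n --> \oo] --> 0%E.
Proof.
move=> u0 v0; rewrite -[X in _ --> X](adde0 0%E); apply: cvgeD => //.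
  by rewrite -[X in _ --> X](mule0 c%:E); exact: cvgeZl.
by rewrite -[X in _ --> X](mule0 c%:E); exact: cvgeZl.
Qed.

Lemma cvg2D fs gs f g : (forall n, measurable_fun [set: R] (fs n)) ->
  (forall n, measurable_fun [set: R] (gs n)) ->
  measurable_fun [set: R] f -> measurable_fun [set: R] g ->
  cvg2 fs f -> cvg2 gs g ->
  cvg2 (fun n x => fs n x + gs n x) (fun x => f x + g x).
Proof.
move=> mfn mgn mf mg ff gg; apply: squeeze0 (cvge0D 2 ff gg) => n; first exact: sqn_ge0.
rewrite (_ : (fun x => _) = (fun x => (fs n x - f x) + (gs n x - g x))).
  by apply: sqnD; exact: measurable_funB.
by apply/funext => x; rewrite opprD addrACA.
Qed.

Lemma cvg2Z c fs f : (forall n, measurable_fun [set: R] (fs n)) ->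
  measurable_fun [set: R] f ->
  cvg2 fs f -> cvg2 (fun n x => c * fs n x) (fun x => c * f x).
Proof.
move=> mfn mf ff; rewrite /cvg2.
rewrite (_ : (fun n => _) = (fun n => (c ^+ 2)%:E * sqn (fun x => fs n x - f x)%R)%E).
  by rewrite -[X in _ --> X](mule0 (c ^+ 2)%:E); exact: cvgeZl.
apply/funext => n; rewrite -sqnZ; last exact: measurable_funB.
by congr sqn; apply/funext => x; rewrite mulrBr.
Qed.

Lemma cvg2B fs gs f g : (forall n, measurable_fun [set: R] (fs n)) ->
  (forall n, measurable_fun [set: R] (gs n)) ->
  measurable_fun [set: R] f -> measurable_fun [set: R] g ->
  cvg2 fs f -> cvg2 gs g ->
  cvg2 (fun n x => fs n x - gs n x) (fun x => f x - g x).
Proof.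
move=> mfn mgn mf mg ff gg; apply: squeeze0 (cvge0D 2 ff gg) => n; first exact: sqn_ge0.
rewrite (_ : (fun x => _) = (fun x => (fs n x - f x) - (gs n x - g x))).
  by apply: sqnB; exact: measurable_funB.
by apply/funext => x; ring.
Qed.

(** The upper limit is measurable and agrees with the pointwise limit wherever
    the latter exists. *)
Lemma measurable_fun_ae_lim fs : (forall n, measurable_fun [set: R] (fs n)) ->
  exists2 f : R -> R, measurable_fun [set: R] f &
    forall x (l : R), fs n x @[n --> \oo] --> l -> f x = l.
Proof.
move=> mf; exists (fun x => fine (limn_esup (fun n => (fs n x)%:E))).
  apply: measurableT_comp => //; apply: measurable_fun_limn_esup => n.
  exact/measurable_EFinP.
move=> x l fl.
have /cvg_limn_einf_sup[_ ->] // : (fs n x)%:E @[n --> \oo] --> l%:E.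
by apply: cvg_EFin; [exact: nearW|exact: fl].
Qed.

Lemma sqn_fatou hs h (C : \bar R) : (forall n, measurable_fun [set: R] (hs n)) ->
  measurable_fun [set: R] h ->
  {ae mu, forall x, hs n x @[n --> \oo] --> h x} ->
  (forall n, sqn (hs n) <= C)%E -> (sqn h <= C)%E.
Proof.
move=> mhn mh hh hC; pose F n x := ((hs n x) ^+ 2)%:E.
have mF n : measurable_fun [set: R] (F n) by exact: measurable_sqr.
have F0 n x : [set: R] x -> (0 <= F n x)%E by move=> _; rewrite lee_fin sqr_ge0.
have E : (sqn h = \int[mu]_x limn_einf (F ^~ x))%E.
  apply: ge0_ae_eq_integral => //=.
  - exact: measurable_sqr.
  - rewrite (_ : (fun x => _) = (fun x => - limn_esup (fun n => - F n x))%E).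
      apply: measurableT_comp => //; apply: measurable_fun_limn_esup => n.
      by apply: measurableT_comp => //; exact: mF.
    apply/funext => x; rewrite -[LHS]oppeK; congr (- _)%E.
    by rewrite limn_esupN.
  - by move=> x _; rewrite lee_fin sqr_ge0.
  - move=> x _; rewrite limn_einf_lim; apply: lime_ge; first exact: is_cvg_einfs.
    apply: nearW => n; apply: le_ereal_inf_tmp => _ [m _ <-]; exact: F0.
  - apply: ae_imp hh => x hx _; apply/esym.
    have /cvg_limn_einf_sup[-> _] // : F n x @[n --> \oo] --> ((h x) ^+ 2)%:E.
    apply: cvg_EFin; first exact: nearW.
    exact: (cvgM hx hx).
rewrite E; apply: le_trans; first exact: fatou.
rewrite limn_einf_lim; apply: lime_le; first exact: is_cvg_einfs.
apply: nearW => n; apply: le_trans (hC n).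
by apply: ereal_inf_lbound; exists n => /=.
Qed.

Lemma sqn_dominated hs h g : (forall n, measurable_fun [set: R] (hs n)) ->
  measurable_fun [set: R] h ->
  {ae mu, forall x, hs n x @[n --> \oo] --> h x} ->
  L2 g -> (forall n x, `|hs n x - h x| <= `|g x|) -> cvg2 hs h.
Proof.
move=> mhn mh hh Lg hg.
have := @dominated_convergence _ _ _ mu setT measurableT
  (fun n x => ((hs n x - h x) ^+ 2)%:E) (cst 0%E) (fun x => ((g x) ^+ 2)%:E).
case.
- by move=> n; apply: measurable_sqr; exact: measurable_funB.
- by [].
- apply: ae_imp hh => x hx _.
  apply: cvg_EFin; first exact: nearW.
  rewrite (_ : 0 = (h x - h x) * (h x - h x)); last by rewrite subrr mul0r.
  have hB : hs n x - h x @[n --> \oo] --> h x - h x by apply: cvgB hx _; exact: cvg_cst.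
  exact: (cvgM hB hB).
- exact: L2_sqr_intg.
- apply: aeW => x n _; rewrite lee_fin ger0_norm ?sqr_ge0//.
  rewrite -(real_normK (num_real (hs n x - h x))) -(real_normK (num_real (g x))).
  by rewrite lerXn2r ?nnegrE.
- by move=> _ _; rewrite integral0.
Qed.

Lemma sum_half n : \sum_(0 <= k < n) ((2^-1 : R) ^+ k) <= 2.
Proof.
suff -> : \sum_(0 <= k < n) ((2^-1 : R) ^+ k) = 2 - 2 * 2^-1 ^+ n.
  by rewrite gerBl mulr_ge0// exprn_ge0// invr_ge0.
elim: n => [|n IH]; first by rewrite big_geq// expr0 mulr1 subrr.
rewrite big_nat_recr//= IH exprS; by field.
Qed.

(** By monotone convergence the sum of the squares has integral at most
    1 + 1/2 + 1/4 + ..., so it is finite almost everywhere. *)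
Lemma sqn_nneseries_fin (d_ : nat -> R -> R) :
  (forall k, measurable_fun [set: R] (d_ k)) ->
  (forall k, sqn (d_ k) <= ((2^-1) ^+ k)%:E)%E ->
  {ae mu, forall x, (\sum_(0 <= k <oo) (d_ k x ^+ 2)%:E < +oo)%E}.
Proof.
move=> md dk; pose F k x := ((d_ k x) ^+ 2)%:E.
have mF k : measurable_fun [set: R] (F k) by exact: measurable_sqr.
have F0 k x : [set: R] x -> (0 <= F k x)%E by move=> _; rewrite lee_fin sqr_ge0.
have E := integral_nneseries mu measurableT mF F0.
have S2 : (\int[mu]_x (\sum_(0 <= k <oo) F k x) <= 2%:E)%E.
  rewrite E; apply: lime_le.
    by apply: is_cvg_nneseries => n _ _; apply: integral_ge0 => x Dx; exact: F0.
  apply: nearW => n.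
  apply: (@le_trans _ _ (\sum_(0 <= k < n) ((2^-1 : R) ^+ k)%:E)%E).
    by apply: lee_sum => k _; exact: dk.
  by rewrite sumEFin lee_fin sum_half.
have : mu.-integrable setT (fun x => \sum_(0 <= k <oo) F k x)%E.
  apply/integrableP; split; first by apply: ge0_emeasurable_sum => [k x _ _|k _]; [exact: F0|exact: mF].
  apply: le_lt_trans (ltry 2); apply: le_trans S2.
  apply: eq_le_of; apply: eq_integral => x _.
  by rewrite gee0_abs//; apply: nneseries_ge0 => n _ _; exact: F0.
move/(integrable_ae measurableT); apply: ae_imp => x /(_ Logic.I).
by rewrite fin_numE => /andP[_]; rewrite -ltey.
Qed.

(** Riesz-Fischer: along a subsequence the increments are summable almost
    everywhere, which gives the limit, and Fatou's lemma turns almost everywhere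
    convergence of the subsequence back into convergence of the whole
    sequence. *)
Lemma L2_complete fs : (forall n, L2 (fs n)) ->
  (forall e : R, 0 < e -> exists N : nat, forall n m, (N <= n)%N -> (N <= m)%N ->
    (sqn (fun x => fs n x - fs m x)%R <= e%:E)%E) ->
  exists2 f : R -> R, L2 f & cvg2 fs f.
Proof.
move=> Lf cauchy; have mf n := L2_meas (Lf n).
have e0 k : 0 < ((8^-1 : R) ^+ k) by rewrite exprn_gt0.
have /choice[N_ N_P] : forall k, exists N : nat, forall n m,
    (N <= n)%N -> (N <= m)%N ->
    (sqn (fun x => fs n x - fs m x)%R <= ((8^-1 : R) ^+ k)%:E)%E.
  by move=> k; exact: cauchy.
pose nk k := (\max_(i < k.+1) N_ i)%N.
have nkN k : (N_ k <= nk k)%N by rewrite /nk (leq_bigmax (@ord_max k)).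
have nk_le j k : (j <= k)%N -> (N_ j <= nk k)%N.
  by move=> jk; rewrite -ltnS in jk; rewrite /nk (leq_bigmax (Ordinal jk)).
pose g k := fs (nk k).
have mg k : measurable_fun [set: R] (g k) by exact: mf.
pose d k (x : R) := 2 ^+ k * (g k.+1 x - g k x).
have md k : measurable_fun [set: R] (d k).
  by apply: measurable_funM => //; apply: measurable_funB; exact: mf.
have dk k : (sqn (d k) <= ((2^-1 : R) ^+ k)%:E)%E.
  rewrite sqnZ; last exact: measurable_funB.
  apply: (@le_trans _ _ (((2 ^+ k) ^+ 2)%:E * ((8^-1 : R) ^+ k)%:E)%E).
    apply: lee_wpmul2l; first by rewrite lee_fin sqr_ge0.
    by apply: N_P; [exact: nk_le|exact: nkN].
  rewrite -EFinM lee_fin -exprM mulnC exprM -exprMn.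
  by rewrite (_ : (2 ^+ 2 / 8 : R) = 2^-1)//; field.
have aeS := sqn_nneseries_fin md dk.
have gcvg : {ae mu, forall x, cvgn (g ^~ x)}.
  apply: ae_imp aeS => x Sx.
  have [s s0 ds] : exists2 s : R, 0 <= s & forall k, `|g k.+1 x - g k x| <= geometric s 2^-1 k.
    pose S := (\sum_(0 <= k <oo) (d k x ^+ 2)%:E)%E.
    have S0 : (0 <= S)%E by apply: nneseries_ge0 => k _ _; rewrite lee_fin sqr_ge0.
    have Sfin : S \is a fin_num by rewrite ge0_fin_numE.
    exists (fine S + 1); first by rewrite addr_ge0// fine_ge0.
    move=> k.
    have : (((d k x) ^+ 2)%:E <= S)%E.
      apply: le_trans (nneseries_lim_ge k.+1 _); last first.
        by move=> n _ _; rewrite lee_fin sqr_ge0.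
      rewrite big_nat_recr//= leeDr// sumEFin lee_fin sumr_ge0// => i _.
      exact: sqr_ge0.
    rewrite -(fineK Sfin) lee_fin => dS.
    have sp : 0 <= fine S by rewrite fine_ge0.
    have {}dS : `|d k x| <= fine S + 1.
      rewrite -ler_sqr ?nnegrE ?addr_ge0// real_normK ?num_real//.
      by apply: le_trans dS _; nra.
    rewrite /geometric /= exprVn -ler_pdivrMr ?invr_gt0 ?exprn_gt0//.
    by rewrite invrK mulrC -[X in X * _](@ger0_norm _ (2 ^+ k)) ?exprn_ge0// -normrM.
  have cs : cvgn (series (telescope (g ^~ x))).
    apply: normed_cvg; apply: (@series_le_cvg _ _ (geometric s 2^-1)).
    - by move=> n; exact: normr_ge0.
    - by move=> n; rewrite /geometric /= mulr_ge0// exprn_ge0.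
    - exact: ds.
    - by apply: is_cvg_geometric_series; rewrite ger0_norm// invf_lt1// ltr1n.
  rewrite (_ : g ^~ x = fun n => g 0%N x + series (telescope (g ^~ x)) n).
    by apply: is_cvgD => //; exact: is_cvg_cst.
  by apply/funext => n; rewrite -eq_sum_telescope.
have [f mf' fl] := measurable_fun_ae_lim mg.
have gf : {ae mu, forall x, g n x @[n --> \oo] --> f x}.
  by apply: ae_imp gcvg => x cx; rewrite (fl _ _ cx).
have small n k : (N_ k <= n)%N -> (sqn (fun x => fs n x - f x)%R <= ((8^-1 : R) ^+ k)%:E)%E.
  move=> kn; apply: (@sqn_fatou (fun j x => fs n x - g (k + j)%N x)).
  - by move=> j; exact: measurable_funB.
  - exact: measurable_funB.
  - apply: ae_imp gf => x gx; apply: cvgB; first exact: cvg_cst.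
    by have := gx; rewrite -(cvg_shiftn k); under eq_fun do rewrite addnC.
  - by move=> j; apply: N_P => //; apply: nk_le; exact: leq_addr.
exists f.
  rewrite (_ : f = fun x => fs (N_ 0%N) x - (fs (N_ 0%N) x - f x)).
    apply: L2B => //; apply/L2P; split; first exact: measurable_funB.
    by apply: le_lt_trans (small _ 0%N _) _ => //; rewrite ltry.
  by apply/funext => x; rewrite opprB addrC subrK.
apply: cvge0P => [n|e e_gt0]; first exact: sqn_ge0.
have [K _ KP] := near_infty_natSinv_lt (PosNum e_gt0).
exists (N_ K) => n Kn; apply: le_trans (small _ _ Kn) _; rewrite lee_fin.
apply: le_trans (ltW (KP K (leqnn K))).
rewrite exprVn lef_pV2 ?posrE ?exprn_gt0//.
by rewrite -natrX ler_nat; exact: ltn_expl.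
Qed.

End L2Convergence.

(** * Smooth functions *)

Section Smooth.
Context {R : realType}.
Implicit Types (f g h u v : R -> R) (a b c : R).

Lemma smooth_derivable f x : smooth f -> derivable f x 1.
Proof. by move=> sf; exact: (sf 0%N). Qed.

Lemma smooth_derive1 f : smooth f -> smooth (derive1 f).
Proof. by move=> sf n x; rewrite -derive1Sn; exact: sf. Qed.

Lemma is_derive_derive1 f x : derivable f x 1 -> is_derive x (1 : R) f ((derive1 f) x).
Proof. by move=> df; split => //; rewrite derive1E. Qed.

Lemma derive1_is_derive f f' x : is_derive x (1 : R) f (f' x) -> (derive1 f) x = f' x.
Proof. by rewrite derive1E => -[_]. Qed.

Lemma smooth_is_derive f x : smooth f -> is_derive x (1 : R) f ((derive1 f) x).
Proof. by move=> sf; apply: is_derive_derive1; exact: smooth_derivable. Qed.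

Lemma is_derive_continuous f f' : (forall x : R, is_derive x (1 : R) f (f' x)) -> continuous f.
Proof.
move=> ff x; apply: differentiable_continuous; apply/derivable1_diffP.
by case: (ff x).
Qed.

Lemma smooth_continuous f : smooth f -> continuous f.
Proof. by move=> sf; apply: (@is_derive_continuous _ (derive1 f)) => x; exact: smooth_is_derive. Qed.

(** Coinduction: a class of functions each of which has a derivative in the
    class consists of smooth functions. *)
Lemma smooth_coind (P : (R -> R) -> Prop) :
  (forall f, P f -> exists2 f', P f' & forall x : R, is_derive x (1 : R) f (f' x)) ->
  forall f, P f -> smooth f.
Proof.
move=> PP f Pf n x.
suff : exists2 f', P f' & derive1n n f = f'.
  by move=> [f' /PP[f'' _ d] ->]; case: (d x).
elim: n => [|n [g Pg gE]]; first by exists f.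
have [g' Pg' d] := PP _ Pg; exists g' => //.
by rewrite derive1nS gE; apply/funext => y; exact: derive1_is_derive.
Qed.

Lemma smooth_from_derive f g : (forall x : R, is_derive x (1 : R) f (g x)) ->
  smooth g -> smooth f.
Proof.
move=> fg sg; have E : (derive1 f) = g by apply/funext => x; exact: derive1_is_derive.
by case=> [|n] x; [case: (fg x)|rewrite derive1Sn E; exact: sg].
Qed.

(** Products of two smooth functions do not form a class closed under
    differentiation, but sums of such products do. *)
Inductive prod_span : (R -> R) -> Prop :=
| prod_span_mul f g : smooth f -> smooth g -> prod_span (fun x => f x * g x)
| prod_span_add f g : prod_span f -> prod_span g -> prod_span (fun x => f x + g x).

Lemma smoothM f g : smooth f -> smooth g -> smooth (fun x => f x * g x).
Proof.
move=> sf sg; apply: (smooth_coind (P := prod_span)); last exact: prod_span_mul.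
move=> h; elim=> {f g sf sg h} [f g sf sg|f g _ [f' Pf df] _ [g' Pg dg]].
  exists (fun x => f x * (derive1 g) x + (derive1 f) x * g x).
    apply: prod_span_add; apply: prod_span_mul;
      [exact: sf|exact: (smooth_derive1 sg)|exact: (smooth_derive1 sf)|exact: sg].
  move=> x; have := is_deriveM (smooth_is_derive x sf) (smooth_is_derive x sg).
  by move=> d; apply: is_derive_eq => //; rewrite /GRing.scale/= [g x * _]mulrC.
exists (fun x => f' x + g' x); first exact: prod_span_add.
by move=> x; exact: is_deriveD.
Qed.

Lemma smoothD f g : smooth f -> smooth g -> smooth (fun x => f x + g x).
Proof.
move=> sf sg.
apply: (smooth_coind (P := fun h => exists f g, [/\ smooth f, smooth g & h = (fun x => f x + g x)])); last by exists f, g.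
move=> _ [{sf sg}f [{}g [sf sg ->]]].
exists (fun x => (derive1 f) x + (derive1 g) x).
  exists (derive1 f), (derive1 g).
  by split; [exact: (smooth_derive1 sf)|exact: (smooth_derive1 sg)|].
by move=> x; apply: is_deriveD; exact: smooth_is_derive.
Qed.

Lemma smooth_affine f : smooth f -> forall c d k : R, smooth (fun x => k * f (c * x + d)).
Proof.
move=> sf c d k.
apply: (smooth_coind (P := fun h => exists k f, smooth f /\ h = (fun x => k * f (c * x + d)))); last by exists k, f.
move=> _ [{}k [{sf}f [sf ->]]].
exists (fun x => (k * c) * (derive1 f) (c * x + d)).
  exists (k * c), (derive1 f).
  by split; [exact: (smooth_derive1 sf)|].
move=> x.
have dx : is_derive x (1 : R) (fun y : R => c * y + d) c.
  by apply: is_derive_eq; rewrite addr0 /GRing.scale/= mulr1.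
have := is_deriveZ k (@is_derive1_comp _ f (fun y => c * y + d) x _ _
  (smooth_is_derive (c * x + d) sf) dx).
rewrite (_ : _ *: _ = k * c * derive1 f (c * x + d)); first exact.
by rewrite /GRing.scale/=; ring.
Qed.

Lemma smoothZ c f : smooth f -> smooth (fun x => c * f x).
Proof.
move=> sf; have := @smooth_affine _ sf 1 0 c.
by congr smooth; apply/funext => x; rewrite mul1r addr0.
Qed.

(** A class of functions that contains exp(-1/x), extended by 0, and that is
    stable under differentiation. *)
Definition flat (p : {poly R}) (x : R) : R :=
  if 0 < x then p.[x^-1] * expR (- x^-1) else 0.

Lemma poly_expR_bounded (p : {poly R}) n :
  exists C : R, forall y : R, 0 <= y -> `|y ^+ n * p.[y] * expR (- y)| <= C.
Proof.
elim/poly_ind: p n => [|p c IH] n.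
  by exists 0 => y _; rewrite horner0 mulr0 mul0r normr0.
have [C CP] := IH n.+1.
exists (C + `|c| * (n.+1`!)%:R + `|c| * 1) => y y0; rewrite hornerMXaddC.
rewrite (_ : _ * expR _ = y ^+ n.+1 * p.[y] * expR (- y) + c * (y ^+ n * expR (- y))); last by rewrite exprS; ring.
rewrite -addrA; apply: (le_trans (ler_normD _ _)); apply: lerD; first exact: CP.
rewrite -mulrDr normrM ler_wpM2l// ger0_norm ?mulr_ge0 ?exprn_ge0 ?expR_ge0//.
rewrite expRN ler_pdivrMr ?expR_gt0//.
case: n {IH C CP} => [|n].
  rewrite expr0 mulrDl mul1r -[1 in X in X <= _]add0r.
  apply: lerD; first exact: expR_ge0.
  by apply: le_trans (expR_ge1Dx y); rewrite lerDl.
have := expR_ge1Dxn n y0; set f := (_`!)%:R => h.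
have f0 : 0 < f by rewrite ltr0n fact_gt0.
have : y ^+ n.+1 / f <= expR y by apply: le_trans h; rewrite lerDr.
rewrite ler_pdivrMr// => h2; apply: (le_trans h2).
rewrite mulrC ler_wpM2r ?expR_ge0//.
apply: (@le_trans _ _ (n.+2`!)%:R); first by rewrite ler_nat leq_fact.
by rewrite lerDl.
Qed.

(** At 0 the derivative vanishes because exp(-y) beats every polynomial in
    y = 1/x. *)
Lemma flat_derive p (x : R) :
  is_derive x (1 : R) (flat p) (flat ('X^2 * (p - p^`())) x).
Proof.
have [x0|x0|x0] := ltgtP 0 x.
- have d : is_derive x (1 : R) (fun y : R => p.[y^-1] * expR (- y^-1)) (flat ('X^2 * (p - p^`())) x).
    have dV : is_derive x (1 : R) (fun y : R => y^-1) (- x ^- 2).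
      have := is_deriveV (lt0r_neq0 x0) (is_derive_id x (1 : R)).
      by move=> d; apply: is_derive_eq => //; rewrite /GRing.scale/= mulr1.
    have d1 := is_derive1_comp (is_derive_poly p x^-1) dV.
    have d2 := @is_derive1_comp _ expR (fun y => - y^-1) x _ _
      (is_derive_expR (- x^-1)) (is_deriveN dV).
    have := is_deriveM d1 d2.
    rewrite (_ : _ + _ = flat ('X^2 * (p - p^`())) x); first exact.
    by rewrite /flat x0 /GRing.scale/= hornerM hornerD hornerN hornerXn -exprVn; ring.
  apply: near_eq_is_derive d.
  have : \forall y \near x, 0 < y by exact: lt_nbhsr.
  by apply: filterS => y y0; rewrite /flat y0.
- rewrite /flat ltNge (ltW x0) /=; have := is_derive_cst (0 : R) x (1 : R).
  apply: near_eq_is_derive.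
  have : \forall y \near x, y < 0 by exact: lt_nbhsl.
  by apply: filterS => y y0; rewrite ltNge (ltW y0).
- rewrite -x0 {2}/flat ltxx.
  have [C CP] := poly_expR_bounded p 2.
  have C0 : 0 <= C by apply: le_trans (CP 0 (lexx _)).
  have lim0 : h^-1 *: (flat p (h *: (1 : R) + 0) - flat p 0) @[h --> (0 : R)^'] --> (0 : R).
    apply/cvgrPdist_le => e e0; near=> h.
    have h0 : h != 0 by near: h; exact: nbhs_dnbhs_neq.
    rewrite sub0r normrN {2}/flat ltxx subr0 addr0 /GRing.scale/= mulr1 /flat.
    case: ifPn => hp; last by rewrite mulr0 normr0 ltW.
    have := CP h^-1; rewrite invr_ge0 ltW// => /(_ erefl) hC.
    rewrite (_ : h^-1 * _ = h * (h^-1 ^+ 2 * p.[h^-1] * expR (- h^-1))); last by field.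
    rewrite normrM gtr0_norm//; apply: (@le_trans _ _ (h * (C + 1))).
      by apply: ler_wpM2l; [exact: ltW|apply: (le_trans hC); rewrite lerDl].
    rewrite -ler_pdivlMr ?ltr_wpDl//.
    rewrite -(gtr0_norm hp); near: h; apply: dnbhs0_le.
    by rewrite divr_gt0// ltr_wpDl.
  split; last exact: cvg_lim.
  by apply/cvg_ex; exists 0.
Unshelve. all: by end_near. Qed.

Lemma flat_smooth p : smooth (flat p).
Proof.
apply: (smooth_coind (P := fun f => exists p, f = flat p)); last by exists p.
by move=> _ [q ->]; eexists; last exact: flat_derive; eexists.
Qed.

(** The building block of bumps: it vanishes on the left half line and tends
    to 1 at +oo. *)
Definition flat1 : R -> R := flat 1.

Lemma flat1E x : flat1 x = if 0 < x then expR (- x^-1) else 0.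
Proof. by rewrite /flat1 /flat hornerC mul1r. Qed.

Lemma flat1_ge0 x : 0 <= flat1 x.
Proof. by rewrite flat1E; case: ifP => // _; exact: expR_ge0. Qed.

Lemma flat1_le1 x : flat1 x <= 1.
Proof.
rewrite flat1E; case: ifPn => // x0.
by rewrite -expR0 ler_expR oppr_le0 invr_ge0 ltW.
Qed.

Lemma flat1_cvg (x : R) : 0 < x -> flat1 (n.+1%:R * x) @[n --> \oo] --> (1 : R).
Proof.
move=> x0.
have E n : flat1 (n.+1%:R * x) = expR (- (x^-1 * n.+1%:R^-1)).
  by rewrite flat1E mulr_gt0// invfM mulrC.
under eq_fun do rewrite E.
have c0 : - (x^-1 * n.+1%:R^-1) @[n --> \oo] --> (0 : R).
  rewrite -oppr0 -[X in - X](mulr0 x^-1); apply: cvgN; apply: cvgM; first exact: cvg_cst.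
  exact: cvg_harmonic.
have := cvg_comp _ _ c0 (@continuous_expR R 0).
by rewrite expR0.
Qed.

End Smooth.

(** * Weak derivatives *)

Section WeakDerivatives.
Context {R : realType}.
Notation mu := (@lebesgue_measure R).
Implicit Types (f g h u v phi : R -> R) (a b c : R).

Lemma test_function_support phi : test_function phi ->
  exists2 M : R, 0 < M & forall x, M <= `|x| -> phi x = 0.
Proof.
move=> [_ /compact_bounded/ex_strict_bound_gt0[M M0 cM]]; exists M => // x Mx.
apply: contrapT => /eqP phix; have := cM x (@subset_closure _ [set y | phi y != 0] x phix).
by rewrite /= ltNge Mx.
Qed.

Lemma test_functionI phi (M : R) : smooth phi -> (forall x, M <= `|x| -> phi x = 0) ->
  test_function phi.
Proof.
move=> sphi phi0; split => //.
apply: (@subclosed_compact _ _ `[- M, M]); first exact: closed_closure.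
  exact: segment_compact.
have cM : closed `[- M, M]%classic.
  by apply: compact_closed; [exact: Rhausdorff|exact: segment_compact].
rewrite [X in _ `<=` X](iffLR (closure_id _) cM); apply: closure_subset => x /= /eqP phix.
rewrite /= in_itv/= -ler_norml leNgt; apply: contra_notN phix => /ltW.
exact: phi0.
Qed.

Lemma test_function_derive1 phi : test_function phi -> test_function (derive1 phi).
Proof.
move=> tphi; have [M M0 phi0] := test_function_support tphi.
have sphi := tphi.1.
apply: (test_functionI (M := M + 1)); first exact: (smooth_derive1 sphi).
move=> x Mx; apply: (@derive1_is_derive _ _ (cst 0)).
have := is_derive_cst (0 : R) x (1 : R); apply: near_eq_is_derive.
have : \forall y \near x, `|x - y| < 1 by exact: nbhsx_ballx.
apply: filterS => y xy; apply/esym/phi0.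
have := ler_normD (x - y) y; rewrite subrK; lra.
Qed.

Lemma test_function_derive1n n phi : test_function phi -> test_function (derive1n n phi).
Proof.
move=> tphi; elim: n => [|n IH]; first exact: tphi.
by rewrite derive1nS; exact: (test_function_derive1 IH).
Qed.

Lemma test_function_continuous phi : test_function phi -> continuous phi.
Proof. by move=> [sphi _]; exact: (smooth_continuous sphi). Qed.

Lemma intg_test u phi : locint u -> test_function phi -> intg (fun x => u x * phi x).
Proof.
move=> lu tphi; have [M M0 phi0] := test_function_support tphi.
have luphi := locintM lu (test_function_continuous tphi).
rewrite (_ : (fun x => _) = fun x => ind (- M) M x * (u x * phi x)).
  exact: locint_ind.
apply/funext => x; rewrite indE -ler_norml.
by have [xM|xM] := leP `|x| M; rewrite ?mul1r// phi0 ?mulr0// ltW.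
Qed.

Lemma Rint_test_ibp f g phi : AC f g -> test_function phi ->
  \int[mu]_x (f x * derive1 phi x) = - \int[mu]_x (g x * phi x).
Proof.
move=> fg tphi; have [M M0 phi0] := test_function_support tphi.
have tphi' := test_function_derive1 tphi.
have lf := AC_locint fg; have lg := fg.1.
have phiA : AC phi (derive1 phi).
  apply: AC_C1; last exact: test_function_continuous.
  by move=> x; apply: smooth_is_derive; exact: tphi.1.
have [lfphi hfphi] := ACM fg phiA.
have MM : - M <= M by lra.
have := hfphi _ _ MM; rewrite !phi0 ?normrN ?ger0_norm ?(ltW M0)// !mulr0 subrr.
rewrite Rint_itvE (_ : \int[mu]_x _ = \int[mu]_x (g x * phi x + f x * derive1 phi x)).
  rewrite RintD; [|exact: intg_test..].
  by move=> /esym/eqP; rewrite addrC addr_eq0 => /eqP.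
apply: eq_Rint => x; rewrite indE -ler_norml.
have [xM|xM] := leP `|x| M; rewrite ?mul1r// mul0r.
rewrite phi0 ?ltW// mulr0 add0r.
suff -> : derive1 phi x = 0 by rewrite mulr0.
apply: (@derive1_is_derive _ _ (cst 0)).
have := is_derive_cst (0 : R) x (1 : R); apply: near_eq_is_derive.
have xM0 : 0 < `|x| - M by rewrite subr_gt0.
have : \forall y \near x, `|x - y| < `|x| - M by exact: (nbhsx_ballx x _ xM0).
apply: filterS => y xy; apply/esym/phi0.
have := ler_normD (x - y) y; rewrite subrK; lra.
Qed.

Lemma weak_derivative0 v : locint v -> weak_derivative 0 v v.
Proof. by move=> lv; split => // phi _; rewrite expr0 mul1r derive1n0. Qed.

Lemma weak_derivativeS n f g v : AC f g -> weak_derivative n g v ->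
  weak_derivative n.+1 f v.
Proof.
move=> fg [_ lv gv]; split => //; first exact: (AC_locint fg).
move=> phi tphi; rewrite derive1nS (Rint_test_ibp fg); last exact: test_function_derive1n.
by rewrite gv// exprS mulN1r mulNr.
Qed.

Lemma AC_weak f g : AC f g -> weak_derivative 1 f g.
Proof. by move=> fg; exact: (weak_derivativeS fg (weak_derivative0 fg.1)). Qed.

Lemma locint_cst c : locint (cst c).
Proof. by apply: continuous_locint => x; exact: cvg_cst. Qed.

Lemma Rint0 : \int[mu]_x (cst 0 x) = 0 :> R.
Proof. by rewrite /Rintegral integral0. Qed.

Lemma Rint_ae_eq f g : measurable_fun [set: R] f -> measurable_fun [set: R] g ->
  {ae mu, forall x, f x = g x} -> \int[mu]_x f x = \int[mu]_x g x.
Proof.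
move=> mf mg fg; rewrite /Rintegral; apply: (congr1 fine).
apply: ae_eq_integral => //; [exact/measurable_EFinP|exact/measurable_EFinP|].
by apply: ae_imp fg => x -> _.
Qed.

(** Lebesgue's differentiation theorem: at a Lebesgue point, u is the
    derivative of its integral, which is constant here. *)
Lemma ae0_of_itv u : locint u ->
  (forall a b, a < b -> \int[mu]_(x in `[a, b]) u x = 0) -> {ae mu, forall x, u x = 0}.
Proof.
move=> lu u0; apply: ae_imp (lebesgue_differentiation lu) => x lx.
have x1 : x - 1 < x by lra. have x2 : x < x + 1 by lra.
have := @FTC1_lebesgue_pt _ u (BLeft (x - 1)) x _ x2 (locint_itv _ _ lu).
rewrite lte_fin => /(_ x1 lx)[_ <-].
apply: (@derive1_is_derive _ _ (cst 0)).
have := is_derive_cst (0 : R) x (1 : R); apply: near_eq_is_derive.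
have xI : x \in `]x - 1, x + 1[ by rewrite in_itv/=; lra.
apply: filterS (near_in_itvoo xI) => y; rewrite in_itv/= => /andP[xy _].
by rewrite u0.
Qed.

(** Test functions that increase to the indicator of ]a, b[: at an interior
    point the arguments of both factors tend to +oo with n. *)
Definition bump a b (n : nat) (x : R) : R :=
  flat1 (n.+1%:R * (x - a)) * flat1 (n.+1%:R * (b - x)).

Lemma flat1_neg (x : R) : x <= 0 -> flat1 x = 0.
Proof. by move=> x0; rewrite flat1E ltNge x0. Qed.

Lemma bump_out a b n x : ~~ (a < x < b) -> bump a b n x = 0.
Proof.
rewrite negb_and -!leNgt /bump => /orP[xa|bx].
  by rewrite flat1_neg ?mul0r// pmulr_rle0// subr_le0.
by rewrite [flat1 (_ * (b - x))]flat1_neg ?mulr0// pmulr_rle0// subr_le0.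
Qed.

Lemma bump_ge0 a b n x : 0 <= bump a b n x.
Proof. by rewrite /bump mulr_ge0// flat1_ge0. Qed.

Lemma bump_ind a b n x : bump a b n x <= ind a b x.
Proof.
have [/andP[ax xb]|xab] := boolP (a < x < b); last by rewrite bump_out// ind_ge0.
apply: (@le_trans _ _ (1 * 1)); last by rewrite mulr1 indE (ltW ax) (ltW xb).
by apply: ler_pM; rewrite ?flat1_ge0 ?flat1_le1.
Qed.

Lemma test_function_bump a b n : test_function (bump a b n).
Proof.
apply: (test_functionI (M := `|a| + `|b|)).
  have sflat : smooth (@flat1 R) by exact: flat_smooth.
  have s1 := @smooth_affine _ _ sflat n.+1%:R (- (n.+1%:R * a)) 1.
  have s2 := @smooth_affine _ _ sflat (- n.+1%:R) (n.+1%:R * b) 1.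
  have := smoothM s1 s2; congr smooth; apply/funext => x; rewrite /bump !mul1r.
  by congr (flat1 _ * flat1 _); ring.
move=> x abx; apply: bump_out; apply/negP => /andP[ax xb].
have := ler_norm b; have := ler_norm (- a); rewrite normrN => ? ?.
have := normr_ge0 a; have := normr_ge0 b => ? ?.
by have [x0|x0] := leP 0 x; move: abx; [rewrite (ger0_norm x0)|rewrite (ltr0_norm x0)]; lra.
Qed.

Lemma bump_cvg a b x : a < x -> x < b -> bump a b n x @[n --> \oo] --> (1 : R).
Proof.
move=> ax xb; rewrite -[X in _ --> X]mulr1.
by apply: cvgM; apply: flat1_cvg; rewrite subr_gt0.
Qed.

Lemma Rint_bump_cvg u a b : locint u ->
  \int[mu]_x (u x * bump a b n x) @[n --> \oo] --> \int[mu]_(x in `[a, b]) u x.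
Proof.
move=> lu; have iu := locint_ind a b lu.
have mb n : measurable_fun [set: R] (bump a b n).
  by apply: continuous_measurable; apply: test_function_continuous; exact: test_function_bump.
have mu' := locint_meas lu.
rewrite Rint_itvE /Rintegral; apply: fine_cvg.
rewrite -/(Rintegral _ _ _) -Rint_fin//.
have := @dominated_convergence _ _ _ mu setT measurableT
  (fun n x => (u x * bump a b n x)%:E) (fun x => (ind a b x * u x)%:E)
  (fun x => `|ind a b x * u x|%:E).
case.
- by move=> n; apply/measurable_EFinP; exact: (measurable_funM mu' (mb n)).
- by apply/measurable_EFinP; apply: measurable_funM => //; exact: measurable_ind.
- apply: ae_imp2 (ae_neq a) (ae_neq b) => x xa xb _; apply: cvg_EFin; first exact: nearW.
  have [xab|xab] := boolP (a < x < b).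
    have /andP[ax bx] := xab; rewrite indE (ltW ax) (ltW bx) mul1r -[X in _ --> X]mulr1.
    by apply: cvgM; [exact: cvg_cst|exact: bump_cvg].
  rewrite (_ : ind a b x = 0); last first.
    by rewrite indE; case: andP => // -[]; rewrite le_eqVlt eq_sym (negPf xa) => /= ax; rewrite le_eqVlt (negPf xb) => /= bx; rewrite ax bx in xab.
  rewrite mul0r (_ : _ \o _ = cst 0); first exact: cvg_cst.
  by apply/funext => n /=; rewrite bump_out// mulr0.
- exact: integrable_norm.
- apply: aeW => x n _; rewrite lee_fin normrM (normrM (ind a b x)) mulrC ler_wpM2r//.
  by rewrite !ger0_norm ?ind_ge0 ?bump_ge0// bump_ind.
- by move=> _ _; exact.
Qed.

(** The fundamental lemma of the calculus of variations: bumps turn test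
    functions into indicators of intervals. *)
Lemma ae0_of_test u : locint u ->
  (forall phi, test_function phi -> \int[mu]_x (u x * phi x) = 0) ->
  {ae mu, forall x, u x = 0}.
Proof.
move=> lu u0; apply: ae0_of_itv => // a b ab.
have := @Rint_bump_cvg u a b lu.
rewrite (_ : (fun n => _) = cst 0); last first.
  by apply/funext => n; rewrite u0//; exact: test_function_bump.
by move/cvg_lim => <- //; rewrite lim_cst.
Qed.

Lemma weak_derivative_uniq n u v w : weak_derivative n u v -> weak_derivative n u w ->
  {ae mu, forall x, v x = w x}.
Proof.
move=> [_ lv uv] [_ lw uw].
suff : {ae mu, forall x, v x - w x = 0} by apply: ae_imp => x /eqP; rewrite subr_eq0 => /eqP.
apply: ae0_of_test => [|phi tphi]; first exact: locintB.
under eq_Rint do rewrite mulrBl.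
rewrite RintB; [|exact: intg_test..].
have := uv _ tphi; rewrite (uw _ tphi) => /(congr1 (fun z => (-1) ^+ n * z)).
by rewrite !mulrA -!exprMn mulrNN mulr1 expr1n !mul1r => ->; rewrite subrr.
Qed.

Lemma AC_uniq f g h : AC f g -> AC f h -> {ae mu, forall x, g x = h x}.
Proof. by move=> fg fh; apply: weak_derivative_uniq (AC_weak fg) (AC_weak fh). Qed.

Lemma AC_ae f g h : AC f g -> locint h -> {ae mu, forall x, g x = h x} -> AC f h.
Proof.
move=> [lg fg] lh gh; split => // a b ab; rewrite fg// !Rint_itvE.
apply: Rint_ae_eq.
- by apply: measurable_funM; [exact: measurable_ind|exact: locint_meas].
- by apply: measurable_funM; [exact: measurable_ind|exact: locint_meas].
- by apply: ae_imp gh => x ->.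
Qed.

(** The difference has integral 0 over every interval, so it is the continuous
    derivative of a constant. *)
Lemma continuous_ae_eq f g : continuous f -> continuous g ->
  {ae mu, forall x, f x = g x} -> f = g.
Proof.
move=> cf cg fg; have c0 a b : \int[mu]_(x in `[a, b]) (f x - g x) = 0.
  rewrite Rint_itvE -Rint0.
  apply: Rint_ae_eq => //; last by apply: ae_imp fg => x ->; rewrite subrr mulr0.
  apply: measurable_funM; first exact: measurable_ind.
  by apply: measurable_funB; exact: continuous_measurable.
have cB : continuous (fun x => f x - g x) by move=> x; apply: cvgB; [exact: cf|exact: cg].
have A0 : AC (cst (0 : R)) (fun x => f x - g x).
  by split; [exact: continuous_locint|move=> a b _; rewrite c0 subrr].
apply/funext => x; apply/eqP; rewrite -subr_eq0; apply/eqP.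
by rewrite -(derive1_is_derive (AC_derive A0 cB x)) derive1_cst.
Qed.

(** The lemma of du Bois-Reymond: phi - (int phi) chi is the derivative of a
    test function as soon as int chi = 1. *)
Lemma ae_cst_of_test u : locint u ->
  (forall phi, test_function phi -> \int[mu]_x (u x * derive1 phi x) = 0) ->
  exists c, {ae mu, forall x, u x = c}.
Proof.
move=> lu u0.
pose chi0 := bump 0 1 0.
have tchi0 : test_function chi0 by exact: test_function_bump.
pose I := \int[mu]_x chi0 x.
have l1 := locint_cst (1 : R).
have int_test phi : test_function phi -> intg phi.
  by move=> tphi; have := intg_test l1 tphi; congr intg; apply/funext => x; rewrite mul1r.
have I0 : I != 0.
  apply/eqP => I0.
  have cchi := test_function_continuous tchi0.
  have e0 : {ae mu, forall x, chi0 x = 0}.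
    have ie : (\int[mu]_x (chi0 x)%:E)%E = 0%E by rewrite Rint_fin; [exact: (congr1 EFin I0)|exact: int_test].
    have mchi : measurable_fun [set: R] (EFin \o chi0).
      by apply/measurable_EFinP; exact: continuous_measurable.
    have [+ _] := ae_eq_integral_abs mu measurableT mchi.
    have -> : (\int[mu]_x `|(EFin \o chi0) x| = 0)%E.
      by rewrite -ie; apply: eq_integral => x _; rewrite /= ger0_norm// bump_ge0.
    by move=> /(_ erefl); apply: ae_imp => x /(_ Logic.I)[].
  have c0 : continuous (cst (0 : R) : R -> R) by move=> x; exact: cvg_cst.
  have chi00 := continuous_ae_eq cchi c0 e0.
  have : chi0 2^-1 = 0 by rewrite chi00.
  have h1 : 0 < 2^-1 :> R by lra.
  have h2 : 0 < 1 - 2^-1 :> R by lra.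
  rewrite /chi0 /bump !mul1r !flat1E subr0 h1 h2.
  by move/eqP; rewrite mulf_eq0 !gt_eqF ?expR_gt0.
pose c := I^-1 * \int[mu]_x (u x * chi0 x).
exists c.
suff : {ae mu, forall x, u x - c = 0} by apply: ae_imp => x /eqP; rewrite subr_eq0 => /eqP.
apply: ae0_of_test => [|phi tphi].
  by apply: locintB => //; exact: locint_cst.
pose k := I^-1 * \int[mu]_x phi x.
(* psi has integral 0, so its primitive eta has compact support. *)
pose psi x := phi x - k * chi0 x.
have spsi : smooth psi.
  have := smoothD tphi.1 (@smoothZ _ (- k) _ tchi0.1).
  by congr smooth; apply/funext => x; rewrite /psi mulNr.
have [M1 M10 P1] := test_function_support tphi.
have [M2 M20 P2] := test_function_support tchi0.
pose M := M1 + M2.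
have psi0 x : M <= `|x| -> psi x = 0.
  by move=> Mx; rewrite /psi P1 ?P2 ?mulr0 ?subrr//; move: Mx; rewrite /M; lra.
have ipsi : \int[mu]_x psi x = 0.
  rewrite /psi RintB ?RintZ -/I; [|exact: int_test..|by apply: intgZ; exact: int_test].
  by rewrite /k mulrAC mulVf// mul1r subrr.
have cpsi := smooth_continuous spsi.
have M0 : 0 < M by rewrite /M addr_gt0.
pose eta x := prim psi x - prim psi (- M).
have etaA : AC eta psi.
  have := ACD (AC_prim (continuous_locint cpsi)) (AC_cst (- prim psi (- M))).
  by congr AC; apply/funext => x; rewrite ?addr0.
have deta : forall x : R, is_derive x (1 : R) eta (psi x) by exact: AC_derive.
have etaM : eta (- M) = 0 by rewrite /eta subrr.
have psiMM : \int[mu]_(x in `[- M, M]) psi x = 0.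
  rewrite Rint_itvE -ipsi; apply: eq_Rint => x; rewrite indE -ler_norml.
  by have [xM|xM] := leP `|x| M; rewrite ?mul1r// psi0 ?mulr0// ltW.
have psi_int0 a b : (forall x, a <= x -> x <= b -> psi x = 0) ->
    \int[mu]_(x in `[a, b]) psi x = 0.
  move=> h; rewrite Rint_itvE -Rint0.
  apply: eq_Rint => x; rewrite indE; case: (boolP (a <= x <= b)) => xab /=; last by rewrite mul0r.
  by have /andP[ax xb] := xab; rewrite h ?mulr0.
have MM : - M <= M by lra.
have eta0 x : M <= `|x| -> eta x = 0.
  have [x0|x0] := leP 0 x; [rewrite (ger0_norm x0) => Mx|rewrite (ltr0_norm x0) => Mx].
    apply/eqP; rewrite -(subrK (eta M) (eta x)) etaA.2// psi_int0; last first.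
      by move=> y My _; apply: psi0; rewrite ger0_norm//; lra.
    by rewrite add0r -(subrK (eta (- M)) (eta M)) etaA.2// psiMM etaM addr0.
  have xM : x <= - M by lra.
  have := etaA.2 _ _ xM; rewrite etaM psi_int0; first by move/eqP; rewrite sub0r oppr_eq0 => /eqP.
  by move=> y _ yM; apply: psi0; rewrite ler0_norm; lra.
have teta : test_function eta by apply: (test_functionI (smooth_from_derive deta spsi) eta0).
have dE : derive1 eta = psi by apply/funext => x; exact: derive1_is_derive.
have := u0 _ teta; rewrite dE /psi.
under eq_Rint do rewrite mulrBr mulrCA.
rewrite RintB ?RintZ; do ?[exact: intg_test|by apply: intgZ; exact: intg_test].
move=> H; under eq_Rint do rewrite mulrBl.
rewrite RintB ?RintZ; do ?[exact: intg_test|exact: int_test|by apply: intgZ; exact: int_test].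
by rewrite -[RHS]H /k /c; ring.
Qed.

(** By du Bois-Reymond's lemma, u differs from a primitive of its weak
    derivative by a constant. *)
Lemma weak_derivative_AC u g : weak_derivative 1 u g ->
  exists2 f : R -> R, AC f g & {ae mu, forall x, u x = f x}.
Proof.
move=> [lu lg ug]; have pA := AC_prim lg.
have [c uc] : exists c, {ae mu, forall x, u x - prim g x = c}.
  apply: ae_cst_of_test => [|phi tphi].
    by apply: locintB => //; exact: (AC_locint pA).
  have td := test_function_derive1 tphi.
  under eq_Rint do rewrite mulrBl.
  rewrite RintB; [|exact: intg_test|by apply: intg_test => //; exact: (AC_locint pA)].
  have := ug _ tphi; rewrite derive1n1 expr1 mulN1r => ->.
  by rewrite (Rint_test_ibp pA tphi) subrr.
exists (fun x => prim g x + c).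
  by have := ACD pA (AC_cst c); congr AC; apply/funext => x; rewrite addr0.
by apply: ae_imp uc => x <-; rewrite addrC subrK.
Qed.

End WeakDerivatives.

(** * Differentiation rules *)

Section DerivativeRules.
Context {R : realType}.
Implicit Types (f g : R -> R) (x k l m : R).

Lemma derive_eq f x l m : is_derive x (1 : R) f l -> l = m -> is_derive x (1 : R) f m.
Proof. by move=> ? <-. Qed.

Lemma deriveMr f g x l m : is_derive x (1 : R) f l -> is_derive x (1 : R) g m ->
  is_derive x (1 : R) (fun y => f y * g y) (l * g x + f x * m).
Proof.
move=> fl gm; apply: derive_eq (is_deriveM fl gm) _.
by rewrite /GRing.scale/=; ring.
Qed.

Lemma deriveDr f g x l m : is_derive x (1 : R) f l -> is_derive x (1 : R) g m ->
  is_derive x (1 : R) (fun y => f y + g y) (l + m).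
Proof. by move=> fl gm; exact: is_deriveD. Qed.

Lemma deriveZr k f x l : is_derive x (1 : R) f l ->
  is_derive x (1 : R) (fun y => k * f y) (k * l).
Proof. by move=> fl; exact: is_deriveZ. Qed.

Lemma derive_comp f g x l m : is_derive (g x) (1 : R) f l -> is_derive x (1 : R) g m ->
  is_derive x (1 : R) (fun y => f (g y)) (l * m).
Proof. by move=> fl gm; exact: (is_derive1_comp fl gm). Qed.

Lemma derive_lin k x : is_derive x (1 : R) (fun y => k * y) k.
Proof. by apply: derive_eq (deriveZr k (is_derive_id x (1 : R))) _; rewrite mulr1. Qed.

End DerivativeRules.

(** * Integrals over growing intervals *)

Section IntegralsOverTheLine.
Context {R : realType}.
Notation mu := (@lebesgue_measure R).
Implicit Types (f g : R -> R).

Lemma ind_cvg1 (x : R) : ind (- n%:R) n%:R x @[n --> \oo] --> (1 : R).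
Proof.
have [N _ NP] := nbhs_infty_ger `|x|.
apply: (@cvg_trans _ ((fun=> 1 : R) @ \oo)); last exact: cvg_cst.
apply: near_eq_cvg; exists N => // n /NP /= xn.
by rewrite indE -ler_norml xn.
Qed.

Lemma Rint_itv_cvg f : intg f ->
  \int[mu]_(x in `[- n%:R, n%:R]) f x @[n --> \oo] --> \int[mu]_x f x.
Proof.
move=> fi; have mf := intg_meas fi.
under eq_fun do rewrite Rint_itvE.
rewrite /Rintegral; apply: fine_cvg; rewrite -/(Rintegral _ _ _) -Rint_fin//.
have := @dominated_convergence _ _ _ mu setT measurableT
  (fun n x => (ind (- n%:R) n%:R x * f x)%:E) (fun x => (f x)%:E)
  (fun x => `|f x|%:E).
case.
- move=> n; apply/measurable_EFinP; exact: (measurable_funM (measurable_ind _ _) mf).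
- exact/measurable_EFinP.
- apply: aeW => x _; apply: cvg_EFin; first exact: nearW.
  by rewrite -[X in _ --> X]mul1r; apply: cvgM; [exact: ind_cvg1|exact: cvg_cst].
- exact: integrable_norm.
- apply: aeW => x n _; rewrite lee_fin normrM -[leRHS]mul1r ler_wpM2r//.
  exact: ind_bound.
- by move=> _ _; exact.
Qed.

(** Fatou's lemma along the intervals [-n, n]. *)
Lemma intg_of_itv f (C : R) : measurable_fun [set: R] f -> (forall x, 0 <= f x) ->
  (forall a b, mu.-integrable `[a, b] (EFin \o f)) ->
  (forall n : nat, \int[mu]_(x in `[- n%:R, n%:R]) f x <= C) -> intg f.
Proof.
move=> mf f0 fi fC; apply/integrableP; split; first exact/measurable_EFinP.
pose F (n : nat) (x : R) := (ind (- n%:R) n%:R x * f x)%:E.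
have mF n : measurable_fun [set: R] (F n).
  by apply/measurable_EFinP; exact: (measurable_funM (measurable_ind _ _) mf).
have F0 n x : [set: R] x -> (0 <= F n x)%E.
  by move=> _; rewrite lee_fin mulr_ge0// ind_ge0.
apply: (@le_lt_trans _ _ C%:E); last exact: ltry.
apply: (@le_trans _ _ (\int[mu]_x limn_einf (F ^~ x))%E).
  apply: eq_le_of; apply: eq_integral => x _.
  rewrite /= ger0_norm//.
  have /cvg_limn_einf_sup[-> _] // : F n x @[n --> \oo] --> (f x)%:E.
  apply: cvg_EFin; first exact: nearW.
  by rewrite -[X in _ --> X]mul1r; apply: cvgM; [exact: ind_cvg1|exact: cvg_cst].
apply: le_trans; first exact: fatou.
rewrite limn_einf_lim; apply: lime_le; first exact: is_cvg_einfs.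
apply: nearW => n; apply: (@le_trans _ _ (\int[mu]_x F n x)%E).
  by apply: ereal_inf_lbound; exists n => /=.
rewrite /F Rint_fin -?Rint_itvE ?lee_fin//.
exact/intg_itvE.
Qed.

End IntegralsOverTheLine.

(** * The Poisson kernel *)

Section PoissonKernel.
Context {R : realType}.
Notation mu := (@lebesgue_measure R).
Implicit Types (e x y z xi : R).

(** Abel's summability factor.  It makes the Fourier integral of a bounded
    function converge, and its own transform is the Poisson kernel. *)
Definition abel e xi : R := expR (- (e * `|xi|)).

Lemma abel_ge0 e xi : 0 <= abel e xi. Proof. exact: expR_ge0. Qed.

Lemma abel_gt0 e xi : 0 < abel e xi. Proof. exact: expR_gt0. Qed.

Lemma abel_le1 e xi : 0 <= e -> abel e xi <= 1.
Proof. by move=> e0; rewrite -expR0 ler_expR oppr_le0 mulr_ge0. Qed.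

Lemma continuous_abel e : continuous (abel e).
Proof.
move=> x; apply: continuous_comp; last exact: continuous_expR.
apply: cvgN; apply: cvgM; first exact: cvg_cst.
exact: norm_continuous.
Qed.

Lemma continuous_cosM z : continuous (fun x : R => cos (z * x)).
Proof.
by apply: (@is_derive_continuous _ _ (fun x => - sin (z * x) * z)) => x; apply: derive_comp (derive_lin z x).
Qed.

Lemma continuous_sinM z : continuous (fun x : R => sin (z * x)).
Proof.
by apply: (@is_derive_continuous _ _ (fun x => cos (z * x) * z)) => x; apply: derive_comp (derive_lin z x).
Qed.

(** The primitive of exp(- e xi) cos(z xi) that two integrations by parts
    give. *)
Definition abel_prim e z xi : R :=
  expR (- (e * xi)) * (z * sin (z * xi) - e * cos (z * xi)) / (e ^+ 2 + z ^+ 2).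

Lemma abel_denom e z : 0 < e -> 0 < e ^+ 2 + z ^+ 2.
Proof. by move=> e0; rewrite ltr_wpDr ?sqr_ge0// exprn_gt0. Qed.

Lemma derive_expRM e x : is_derive x (1 : R) (fun y => expR (- (e * y))) (- e * expR (- (e * x))).
Proof.
apply: derive_eq (derive_comp (f := expR) (is_derive_expR _) (is_deriveN (derive_lin e x))) _.
by rewrite mulrC.
Qed.

Lemma abel_primP e z : 0 < e -> forall xi : R,
  is_derive xi (1 : R) (abel_prim e z) (expR (- (e * xi)) * cos (z * xi)).
Proof.
move=> e0 xi; have d0 := abel_denom z e0.
have ds : is_derive xi (1 : R) (fun y => sin (z * y)) (cos (z * xi) * z).
  exact: derive_comp (derive_lin z xi).
have dc : is_derive xi (1 : R) (fun y => cos (z * y)) (- sin (z * xi) * z).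
  exact: derive_comp (derive_lin z xi).
have h := deriveDr (deriveZr z ds) (deriveZr (- e) dc).
have {}h := deriveZr (e ^+ 2 + z ^+ 2)^-1 (deriveMr (derive_expRM e xi) h).
apply: (@derive_eq _ _ _ ((e ^+ 2 + z ^+ 2)^-1 *
  (- e * expR (- (e * xi)) * (z * sin (z * xi) + - e * cos (z * xi)) +
   expR (- (e * xi)) * (z * (cos (z * xi) * z) + - e * (- sin (z * xi) * z))))).
  rewrite (_ : abel_prim e z = (fun y => (e ^+ 2 + z ^+ 2)^-1 *
    (expR (- (e * y)) * (z * sin (z * y) + - e * cos (z * y)))))//.
  by apply/funext => y; rewrite /abel_prim mulrC mulNr.
by field; rewrite gt_eqF.
Qed.

Lemma Rint_abel_itv e z (n : nat) : 0 < e ->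
  \int[mu]_(xi in `[- n%:R, n%:R]) (abel e xi * cos (z * xi)) =
  2 * e / (e ^+ 2 + z ^+ 2) + 2 * abel_prim e z n%:R.
Proof.
move=> e0; have d0 := abel_denom z e0.
have lf : locint (fun xi => abel e xi * cos (z * xi)).
  by apply: locintM (continuous_locint (@continuous_abel e)) _; exact: continuous_cosM.
have n0 : (0 : R) <= n%:R by [].
have n0' : - n%:R <= (0 : R) by rewrite oppr_le0.
rewrite (Rint_itv_split lf n0' n0).
have cE x : x \in `[(0 : R), n%:R]%classic -> abel e x * cos (z * x) = expR (- (e * x)) * cos (z * x).
  by rewrite inE/= in_itv/= => /andP[x0 _]; rewrite /abel ger0_norm.
have cE' x : x \in `[- n%:R, (0 : R)]%classic -> abel e x * cos (z * x) = expR (- (e * - x)) * cos (z * - x).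
  by rewrite inE/= in_itv/= => /andP[_ x0]; rewrite /abel ler0_norm// (mulrN z) cosN.
have cf : continuous (fun x : R => expR (- (e * x)) * cos (z * x)).
  move=> x; apply: cvgM; last exact: continuous_cosM.
  by have /(_ x) := is_derive_continuous (derive_expRM e).
have A1 := (AC_C1 (abel_primP z e0) cf).2 _ _ n0.
have A2 : AC (fun x => - abel_prim e z (- x)) (fun x => expR (- (e * - x)) * cos (z * - x)).
  apply: AC_C1; last by move=> x; exact: (cvg_comp _ _ (cvgN (@cvg_id _ (nbhs x))) (cf (- x))).
  move=> x; have dN : is_derive x (1 : R) (fun y : R => - y) (- 1) by exact: is_deriveN (is_derive_id x (1 : R)).
  apply: derive_eq (is_deriveN (derive_comp (abel_primP z e0 (- x)) dN)) _.
  by rewrite mulrN1 opprK.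
have := A2.2 _ _ n0'; rewrite -(eq_Rintegral mu cE') => <-.
move: A1; rewrite -(eq_Rintegral mu cE) => <-.
rewrite oppr0 !opprK /abel_prim !mulr0 sin0 cos0 oppr0 expR0; field.
by rewrite gt_eqF.
Qed.

Lemma abel_prim_cvg0 e z : 0 < e -> abel_prim e z n%:R @[n --> \oo] --> (0 : R).
Proof.
move=> e0; have d0 := abel_denom z e0.
pose C := (`|z| + e) / (e ^+ 2 + z ^+ 2).
have Le : expR (- (e * n%:R)) @[n --> \oo] --> (0 : R).
  have E0 : expR (- x) @[x --> +oo] --> (0 : R) by exact: cvgr_expR.
  have en : e * n%:R @[n --> \oo] --> +oo.
    apply/cvgryPge => A; near=> n; rewrite mulrC -ler_pdivrMr//.
    by near: n; exact: nbhs_infty_ger.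
  exact: (cvg_comp _ _ en E0).
have hC (n : nat) : `|abel_prim e z n%:R| <= C * expR (- (e * n%:R)).
  rewrite /abel_prim -mulrA normrM mulrC (ger0_norm (expR_ge0 _)).
  rewrite ler_wpM2r ?expR_ge0// normrM [`|_^-1|]ger0_norm ?invr_ge0 ?(ltW d0)//.
  rewrite /C ler_wpM2r ?invr_ge0 ?(ltW d0)//.
  apply: (le_trans (ler_normB _ _)); rewrite !normrM (gtr0_norm e0); apply: lerD.
    by rewrite -[leRHS]mulr1 ler_wpM2l// ler_norml sin_geN1 sin_le1.
  by rewrite -[leRHS]mulr1 ler_wpM2l ?(ltW e0)// ler_norml cos_geN1 cos_le1.
have CL : C * expR (- (e * n%:R)) @[n --> \oo] --> (0 : R).
  by rewrite -(mulr0 C); apply: cvgM => //; exact: cvg_cst.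
apply: (@squeeze_cvgr _ _ _ _ (fun n => - (C * expR (- (e * n%:R))))
  (fun n => C * expR (- (e * n%:R)))) => //.
  by apply: nearW => n; rewrite -ler_norml hC.
by rewrite -[X in _ --> X]oppr0; exact: cvgN.
Unshelve. all: by end_near. Qed.

Lemma intg_abel e : 0 < e -> intg (abel e).
Proof.
move=> e0; apply: (@intg_of_itv _ _ (2 * e / e ^+ 2)).
- by apply: continuous_measurable; exact: continuous_abel.
- exact: abel_ge0.
- by move=> a b; apply: locint_itv; apply: continuous_locint; exact: continuous_abel.
- move=> n; have := Rint_abel_itv 0 n e0.
  under eq_Rintegral do rewrite mul0r cos0 mulr1.
  move=> ->; rewrite expr0n addr0 gerDl /abel_prim !mul0r cos0 mulr1 sub0r.
  rewrite mulrN mulNr mulrN oppr_le0 mulr_ge0// mulr_ge0 ?invr_ge0 ?addr_ge0 ?sqr_ge0//.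
  by rewrite mulr_ge0 ?expR_ge0// ltW.
Qed.

Lemma Rint_abel e z : 0 < e ->
  \int[mu]_xi (abel e xi * cos (z * xi)) = 2 * e / (e ^+ 2 + z ^+ 2).
Proof.
move=> e0.
have ia : intg (fun xi => abel e xi * cos (z * xi)).
  rewrite (_ : (fun xi => _) = fun xi => cos (z * xi) * abel e xi); last by apply/funext => xi; rewrite mulrC.
  apply: (@intgMb _ _ _ 1) (intg_abel e0).
    by apply: continuous_measurable; exact: continuous_cosM.
  by move=> xi; rewrite ler_norml cos_geN1 cos_le1.
have := Rint_itv_cvg ia; under eq_fun do rewrite Rint_abel_itv//.
have : 2 * e / (e ^+ 2 + z ^+ 2) + 2 * abel_prim e z n%:R @[n --> \oo] -->
    2 * e / (e ^+ 2 + z ^+ 2).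
  rewrite -[X in _ --> X]addr0; apply: cvgD; first exact: cvg_cst.
  by rewrite -(mulr0 2); apply: cvgM; [exact: cvg_cst|exact: abel_prim_cvg0].
by move=> /[swap] /cvg_unique h /h ->.
Qed.

(** The Poisson kernel of the half plane at height e, an approximation of the
    identity as e tends to 0. *)
Definition poisson e z : R := pi^-1 * (e / (e ^+ 2 + z ^+ 2)).

Lemma poisson_ge0 e z : 0 < e -> 0 <= poisson e z.
Proof.
move=> e0; rewrite /poisson mulr_ge0 ?invr_ge0 ?pi_ge0// divr_ge0 ?ltW//.
exact: abel_denom.
Qed.

Lemma poissonN e z : poisson e (- z) = poisson e z.
Proof. by rewrite /poisson sqrrN. Qed.

Lemma poisson_le e z : 0 < e -> poisson e z <= pi^-1 * e^-1.
Proof.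
move=> e0; rewrite /poisson ler_wpM2l ?invr_ge0 ?pi_ge0//.
rewrite ler_pdivrMr ?abel_denom// mulrDr expr2 mulKf ?gt_eqF// lerDl.
by rewrite mulr_ge0 ?sqr_ge0// invr_ge0 ltW.
Qed.

Lemma poisson_derive e z : 0 < e ->
  is_derive z (1 : R) (fun y => pi^-1 * atan (e^-1 * y)) (poisson e z).
Proof.
move=> e0; have d0 := abel_denom z e0.
apply: derive_eq (deriveZr pi^-1 (derive_comp (is_derive1_atan _) (derive_lin e^-1 z))) _.
rewrite /poisson; congr (_ * _).
have ee : e != 0 by rewrite gt_eqF.
have h1 : 1 + (e^-1 * z) ^+ 2 = (e ^+ 2 + z ^+ 2) / e ^+ 2 by field.
by rewrite h1; field; rewrite ee gt_eqF.
Qed.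

Lemma continuous_poisson e : 0 < e -> continuous (poisson e).
Proof.
move=> e0 x; apply: cvgM; first exact: cvg_cst.
apply: cvgM; first exact: cvg_cst.
apply: cvgV; first by rewrite gt_eqF// abel_denom.
apply: cvgD; first exact: cvg_cst.
exact: exprn_continuous.
Qed.

Lemma Rint_poisson_itv e (a : R) : 0 < e -> 0 <= a ->
  \int[mu]_(z in `[- a, a]) poisson e z = 2 / pi * atan (e^-1 * a).
Proof.
move=> e0 a0; have aa : - a <= a by lra.
have A := AC_C1 (fun z => poisson_derive z e0) (continuous_poisson e0).
rewrite -(A.2 _ _ aa) mulrN atanN; ring.
Qed.

Lemma intg_poisson e : 0 < e -> intg (poisson e).
Proof.
move=> e0; apply: (@intg_of_itv _ _ 1).
- by apply: continuous_measurable; exact: continuous_poisson.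
- by move=> z; exact: poisson_ge0.
- by move=> a b; apply: locint_itv; apply: continuous_locint; exact: continuous_poisson.
- move=> n; rewrite Rint_poisson_itv//.
  have := atan_ltpi2 (e^-1 * n%:R) => /ltW h.
  apply: (@le_trans _ _ (2 / pi * (pi / 2))).
    by rewrite ler_wpM2l// divr_ge0 ?pi_ge0.
  by rewrite mulf_div [pi * _]mulrC divff// mulf_neq0// gt_eqF ?pi_gt0.
Qed.

Lemma Rint_poisson e : 0 < e -> \int[mu]_z poisson e z = 1.
Proof.
move=> e0; have := Rint_itv_cvg (intg_poisson e0).
under eq_fun do rewrite Rint_poisson_itv//.
have : 2 / pi * atan (e^-1 * n%:R) @[n --> \oo] --> (2 / pi * (pi / 2) : R).
  apply: cvgM; first exact: cvg_cst.
  have en : e^-1 * n%:R @[n --> \oo] --> +oo.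
    apply/cvgryPge => A; near=> n; rewrite mulrC ler_pdivlMr//.
    by near: n; exact: nbhs_infty_ger.
  exact: (cvg_comp _ _ en (@cvgy_atan R)).
rewrite mulf_div [pi * _]mulrC divff; last by rewrite mulf_neq0// gt_eqF ?pi_gt0.
by move=> /[swap] /cvg_unique h /h ->.
Unshelve. all: by end_near. Qed.

End PoissonKernel.

(** * Fourier transforms of integrable functions *)

Section FourierIntegral.
Context {R : realType}.
Notation mu := (@lebesgue_measure R).
Implicit Types (f g h : R -> R) (e x y xi : R).

Definition fscale : R := (Num.sqrt (2 * pi))^-1.
(** The real and the imaginary part of the transform of f are kept as two real
    functions [fourc f] and [fours f]. *)
Definition fourc f xi : R := fscale * \int[mu]_x (f x * cos (x * xi)).
Definition fours f xi : R := - (fscale * \int[mu]_x (f x * sin (x * xi))).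

Lemma fscale_ge0 : 0 <= fscale.
Proof. by rewrite invr_ge0 sqrtr_ge0. Qed.

Lemma fscale_sqr : fscale ^+ 2 = (2 * pi)^-1.
Proof. by rewrite /fscale exprVn sqr_sqrtr// mulr_ge0 ?pi_ge0. Qed.

Lemma measurable_flip : measurable_fun [set: R * R] (fun z : R * R => (z.2, z.1)).
Proof. exact: measurable_fun_pair measurable_snd measurable_fst. Qed.

Lemma measurable_cosM2 : measurable_fun [set: R * R] (fun z : R * R => cos (z.1 * z.2)).
Proof.
apply: (measurableT_comp (continuous_measurable (@continuous_cos R))).
exact: measurable_funM measurable_fst measurable_snd.
Qed.

Lemma measurable_sinM2 : measurable_fun [set: R * R] (fun z : R * R => sin (z.1 * z.2)).
Proof.
apply: (measurableT_comp (continuous_measurable (@continuous_sin R))).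
exact: measurable_funM measurable_fst measurable_snd.
Qed.

Lemma cos_bound x : `|cos x| <= 1.
Proof. by rewrite ler_norml cos_geN1 cos_le1. Qed.

Lemma sin_bound x : `|sin x| <= 1.
Proof. by rewrite ler_norml sin_geN1 sin_le1. Qed.

Lemma intg_cosM f xi : intg f -> intg (fun x => f x * cos (x * xi)).
Proof.
move=> fi; rewrite (_ : (fun x => _) = (fun x => cos (xi * x) * f x)).
  apply: (@intgMb _ _ _ 1) => //; last by move=> x; exact: cos_bound.
  by apply: continuous_measurable; exact: continuous_cosM.
by apply/funext => x; rewrite mulrC (mulrC x).
Qed.

Lemma intg_sinM f xi : intg f -> intg (fun x => f x * sin (x * xi)).
Proof.
move=> fi; rewrite (_ : (fun x => _) = (fun x => sin (xi * x) * f x)).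
  apply: (@intgMb _ _ _ 1) => //; last by move=> x; exact: sin_bound.
  by apply: continuous_measurable; exact: continuous_sinM.
by apply/funext => x; rewrite mulrC (mulrC x).
Qed.

Lemma Rint_kernel_bound f (k : R -> R) : intg f -> measurable_fun [set: R] k ->
  (forall x, `|k x| <= 1) -> `|\int[mu]_x (f x * k x)| <= \int[mu]_x `|f x|.
Proof.
move=> fi mk k1.
have fki : intg (fun x => f x * k x).
  rewrite (_ : (fun x => _) = (fun x => k x * f x)); last by apply/funext => x; rewrite mulrC.
  exact: (@intgMb _ _ _ 1).
apply: le_trans; first exact: le_normr_Rintegral.
apply: le_Rintegral => //; [exact: integrable_norm|exact: integrable_norm|].
by move=> x _; rewrite normrM -[leRHS]mulr1 ler_wpM2l.
Qed.

Lemma fourc_bound f xi : intg f -> `|fourc f xi| <= fscale * \int[mu]_x `|f x|.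
Proof.
move=> fi; rewrite /fourc normrM ger0_norm ?fscale_ge0// ler_wpM2l ?fscale_ge0//.
apply: Rint_kernel_bound => //; last by move=> x; exact: cos_bound.
rewrite (_ : (fun x => _) = (fun x => cos (xi * x))); last by apply/funext => x; rewrite mulrC.
by apply: continuous_measurable; exact: continuous_cosM.
Qed.

Lemma fours_bound f xi : intg f -> `|fours f xi| <= fscale * \int[mu]_x `|f x|.
Proof.
move=> fi; rewrite /fours normrN normrM ger0_norm ?fscale_ge0// ler_wpM2l ?fscale_ge0//.
apply: Rint_kernel_bound => //; last by move=> x; exact: sin_bound.
rewrite (_ : (fun x => _) = (fun x => sin (xi * x))); last by apply/funext => x; rewrite mulrC.
by apply: continuous_measurable; exact: continuous_sinM.
Qed.

Lemma measurable_kernel_integral f (k : R * R -> R) : intg f ->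
  measurable_fun [set: R * R] k -> (forall z, `|k z| <= 1) ->
  measurable_fun [set: R] (fun xi => \int[mu]_x (f x * k (x, xi))).
Proof.
move=> fi mk k1.
have mk' : measurable_fun [set: R * R] (fun z : R * R => k (z.2, z.1)).
  exact: (measurableT_comp mk measurable_flip).
have /intg_meas m := intg_kernel (intg_abel (@ltr01 R)) fi mk' (fun z => k1 _).
rewrite (_ : (fun xi => _) = fun xi => (abel 1 xi)^-1 * (abel 1 xi * \int[mu]_x (f x * k (x, xi)))).
  apply: measurable_funM m; rewrite (_ : (fun xi => _) = (fun xi => abel (-1) xi)).
    by apply: continuous_measurable; exact: continuous_abel.
  by apply/funext => xi; rewrite /abel -expRN opprK mulN1r opprK mul1r.
by apply/funext => xi; rewrite mulKf// gt_eqF ?abel_gt0.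
Qed.

Lemma measurable_fourc f : intg f -> measurable_fun [set: R] (fourc f).
Proof.
move=> fi; apply: measurable_funM => //.
by apply: (measurable_kernel_integral fi measurable_cosM2) => z; exact: cos_bound.
Qed.

Lemma measurable_fours f : intg f -> measurable_fun [set: R] (fours f).
Proof.
move=> fi; apply: measurableT_comp => //; apply: measurable_funM => //.
by apply: (measurable_kernel_integral fi measurable_sinM2) => z; exact: sin_bound.
Qed.

Lemma intg_abel_fourc e f : 0 < e -> intg f -> intg (fun xi => abel e xi * fourc f xi).
Proof.
move=> e0 fi; rewrite (_ : (fun xi => _) = fun xi => fourc f xi * abel e xi).
  apply: intgMb (intg_abel e0); first exact: measurable_fourc.
  by move=> xi; exact: fourc_bound.
by apply/funext => xi; rewrite mulrC.
Qed.

Lemma intg_abel_fours e f : 0 < e -> intg f -> intg (fun xi => abel e xi * fours f xi).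
Proof.
move=> e0 fi; rewrite (_ : (fun xi => _) = fun xi => fours f xi * abel e xi).
  apply: intgMb (intg_abel e0); first exact: measurable_fours.
  by move=> xi; exact: fours_bound.
by apply/funext => xi; rewrite mulrC.
Qed.

Definition poisson_int e f x : R := \int[mu]_y (f y * poisson e (x - y)).

Lemma poissonE e z : 0 < e ->
  poisson e z = fscale ^+ 2 * \int[mu]_xi (abel e xi * cos (z * xi)).
Proof.
move=> e0; rewrite Rint_abel// fscale_sqr /poisson invfM.
have p0 : pi != 0 :> R by rewrite gt_eqF ?pi_gt0.
have d0 : e ^+ 2 + z ^+ 2 != 0 by rewrite gt_eqF ?abel_denom.
move: (e ^+ 2 + z ^+ 2) (pi : R) d0 p0 => d p d0 p0.
by field; rewrite d0.
Qed.

(** Fourier inversion, regularized by Abel's factor: the factor makes the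
    double integral absolutely convergent, and integrating in xi first
    produces the Poisson kernel. *)
Lemma abel_inversion e f x : 0 < e -> intg f ->
  poisson_int e f x = fscale * \int[mu]_xi (abel e xi * fourc f xi * cos (x * xi)) -
    fscale * \int[mu]_xi (abel e xi * fours f xi * sin (x * xi)).
Proof.
move=> e0 fi; have ia := intg_abel e0.
have mk : measurable_fun [set: R * R] (fun z : R * R => cos ((x - z.1) * z.2)).
  apply: (measurableT_comp (continuous_measurable (@continuous_cos R))).
  apply: measurable_funM measurable_snd.
  by apply: measurable_funB => //; exact: measurable_fst.
have k1 (z : R * R) : `|cos ((x - z.1) * z.2)| <= 1 by exact: cos_bound.
have F := Fubini_kernel fi ia mk k1; rewrite /= in F.
have icos y : intg (fun xi => abel e xi * cos ((x - y) * xi)).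
  by have := intg_cosM (x - y) ia; congr intg; apply/funext => xi; rewrite (mulrC xi).
have -> : poisson_int e f x =
    fscale ^+ 2 * \int[mu]_y (f y * \int[mu]_xi (abel e xi * cos ((x - y) * xi))).
  rewrite -RintZ; last exact: (intg_kernel fi ia mk k1).
  by apply: eq_Rint => y; rewrite poissonE//; ring.
have icc : intg (fun xi => abel e xi * fourc f xi * cos (x * xi)).
  by have := intg_cosM x (intg_abel_fourc e0 fi); congr intg; apply/funext => xi; rewrite (mulrC xi).
have iss : intg (fun xi => abel e xi * fours f xi * sin (x * xi)).
  by have := intg_sinM x (intg_abel_fours e0 fi); congr intg; apply/funext => xi; rewrite (mulrC xi).
rewrite F -mulrBr -(RintB icc iss) expr2 -mulrA; congr (_ * _).
have ik : intg (fun xi => abel e xi * \int[mu]_y (f y * cos ((x - y) * xi))).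
  have mk' : measurable_fun [set: R * R] (fun z : R * R => cos ((x - z.2) * z.1)).
    exact: (measurableT_comp mk measurable_flip).
  exact: (intg_kernel ia fi mk' (fun z => cos_bound _)).
rewrite -RintZ//; apply: eq_Rint => xi.
rewrite (_ : \int[mu]_y _ = cos (x * xi) * \int[mu]_y (f y * cos (y * xi)) +
    sin (x * xi) * \int[mu]_y (f y * sin (y * xi))).
  by rewrite /fourc /fours; ring.
transitivity (\int[mu]_y (cos (x * xi) * (f y * cos (y * xi)) +
    sin (x * xi) * (f y * sin (y * xi)))).
  by apply: eq_Rint => y; rewrite mulrBl cosB; ring.
have fc := intg_cosM xi fi; have fs := intg_sinM xi fi.
by rewrite (RintD (intgZ _ fc) (intgZ _ fs)) (RintZ _ fc) (RintZ _ fs).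
Qed.

(** Integrating [abel_inversion] against f and exchanging the integrals once
    more.  Both Plancherel inequalities are read off from this identity, one by
    bounding the left-hand side and one by computing its limit. *)
Lemma abel_parseval e f : 0 < e -> intg f ->
  \int[mu]_x (f x * poisson_int e f x) =
  \int[mu]_xi (abel e xi * (fourc f xi ^+ 2 + fours f xi ^+ 2)).
Proof.
move=> e0 fi; have ic := intg_abel_fourc e0 fi; have is' := intg_abel_fours e0 fi.
have cb (z : R * R) : `|cos (z.1 * z.2)| <= 1 by exact: cos_bound.
have sb (z : R * R) : `|sin (z.1 * z.2)| <= 1 by exact: sin_bound.
have Fc := Fubini_kernel fi ic measurable_cosM2 cb.
have Fs := Fubini_kernel fi is' measurable_sinM2 sb.
have I1 := intg_kernel fi ic measurable_cosM2 cb.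
have I2 := intg_kernel fi is' measurable_sinM2 sb.
rewrite /= in Fc Fs I1 I2.
transitivity (fscale * \int[mu]_x (f x * \int[mu]_xi (abel e xi * fourc f xi * cos (x * xi))) -
    fscale * \int[mu]_x (f x * \int[mu]_xi (abel e xi * fours f xi * sin (x * xi)))).
  rewrite -(RintZ fscale I1) -(RintZ fscale I2) -RintB; [|exact: intgZ..].
  by apply: eq_Rint => x; rewrite abel_inversion//; ring.
rewrite Fc Fs.
have icc : intg (fun xi => abel e xi * fourc f xi * \int[mu]_x (f x * cos (x * xi))).
  exact: (intg_kernel ic fi (measurableT_comp measurable_cosM2 measurable_flip) (fun z => cos_bound _)).
have iss : intg (fun xi => abel e xi * fours f xi * \int[mu]_x (f x * sin (x * xi))).
  exact: (intg_kernel is' fi (measurableT_comp measurable_sinM2 measurable_flip) (fun z => sin_bound _)).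
rewrite -(RintZ fscale icc) -(RintZ fscale iss) -RintB; [|exact: intgZ..].
by apply: eq_Rint => xi; rewrite /fourc /fours; ring.
Qed.

Lemma Rint_poisson_sub e x : 0 < e -> \int[mu]_y poisson e (x - y) = 1.
Proof.
move=> e0; rewrite -(Rint_poisson e0).
rewrite -(@Rint_shift _ (- x) (poisson e)); last by apply: continuous_measurable; exact: continuous_poisson.
by apply: eq_Rint => y; rewrite -poissonN opprB.
Qed.

Lemma intg_poisson_sub e x : 0 < e -> intg (fun y => poisson e (x - y)).
Proof.
move=> e0; have := intg_shift (- x) (intg_poisson e0).
by congr intg; apply/funext => y; rewrite -poissonN opprB.
Qed.

Lemma intg_mul_poisson e f x : 0 < e -> intg f -> intg (fun y => f y * poisson e (x - y)).
Proof.
move=> e0 fi; rewrite (_ : (fun y => _) = fun y => poisson e (x - y) * f y); last by apply/funext => y; rewrite mulrC.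
apply: (@intgMb _ _ _ (pi^-1 * e^-1)) => //; first exact: intg_meas (intg_poisson_sub x e0).
by move=> y; rewrite ger0_norm ?poisson_ge0// poisson_le.
Qed.

(** Tonelli's theorem, then translation invariance of the inner integral.  The
    kernels of interest are the Poisson kernel and the indicator of [-h, h]. *)
Lemma conv_mass (K : R -> R) (B : R) h : intg K -> (forall z, 0 <= K z) ->
  (forall z, K z <= B) -> intg h -> (forall x, 0 <= h x) ->
  intg (fun x => \int[mu]_y (h y * K (x - y))) /\
  \int[mu]_x \int[mu]_y (h y * K (x - y)) = \int[mu]_x h x * \int[mu]_z K z.
Proof.
move=> Ki K0 KB hi h0; have mh := intg_meas hi; have mK := intg_meas Ki.
pose F (z : R * R) := (h z.2 * K (z.1 - z.2))%:E.
have mKB : measurable_fun [set: R * R] (fun z : R * R => K (z.1 - z.2)).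
  exact: (measurableT_comp mK (measurable_funB measurable_fst measurable_snd)).
have mF : measurable_fun [set: R * R] F.
  apply/measurable_EFinP; apply: measurable_funM => //.
  exact: measurableT_comp mh measurable_snd.
have F0 z : (0 <= F z)%E by rewrite lee_fin mulr_ge0.
have T := @fubini_tonelli _ _ _ _ _ mu mu F mF F0.
have mP := measurable_fun_fubini_tonelli_F (m2 := mu) F mF F0.
have ihK x : intg (fun y => h y * K (x - y)).
  have : intg (fun y => K (x - y) * h y).
    apply: (@intgMb _ _ _ B) hi; first exact: (measurableT_comp mKB (measurable_pair1 x)).
    by move=> y; rewrite ger0_norm.
  by congr intg; apply/funext => y; rewrite mulrC.
pose P x := \int[mu]_y (h y * K (x - y)).
have PE x : (\int[mu]_y F (x, y) = (P x)%:E)%E by rewrite -(Rint_fin (ihK x)).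
have E : (\int[mu]_x (P x)%:E = \int[mu]_y (h y * \int[mu]_z K z)%:E)%E.
  transitivity (\int[mu]_x \int[mu]_y F (x, y))%E; first by apply: eq_integral => x _.
  rewrite T; apply: eq_integral => y _.
  have iK := intg_shift (- y) Ki.
  have E1 := Rint_fin (intgZ (h y) iK); rewrite /F /= E1.
  by rewrite (RintZ (h y) iK) (Rint_shift (- y) mK).
have hKi : intg (fun y => h y * \int[mu]_z K z).
  by have := intgZ (\int[mu]_z K z) hi; congr intg; apply/funext => y; rewrite mulrC.
have P0 x : 0 <= P x by apply: Rintegral_ge0 => y _; exact: mulr_ge0 (h0 y) (K0 _).
have Pi : intg P.
  apply/integrableP; split.
    by move: mP; rewrite /fubini_F; congr measurable_fun; apply/funext => x; rewrite PE.
  rewrite (_ : (\int[mu]_x _ = \int[mu]_x (P x)%:E)%E).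
    by rewrite E (Rint_fin hKi) ltry.
  by apply: eq_integral => x _; rewrite /= ger0_norm.
split; first exact: Pi.
transitivity (\int[mu]_y (h y * \int[mu]_z K z)); first exact: (congr1 fine E).
by rewrite [RHS]mulrC -(RintZ _ hi); apply: eq_Rint => y; rewrite mulrC.
Qed.

Lemma poisson_int_mass e h : 0 < e -> intg h -> (forall x, 0 <= h x) ->
  intg (poisson_int e h) /\ \int[mu]_x poisson_int e h x = \int[mu]_x h x.
Proof.
move=> e0 hi h0.
have [Pi PE] := conv_mass (intg_poisson e0) (fun z => poisson_ge0 z e0)
  (fun z => poisson_le z e0) hi h0.
by split; [exact: Pi|rewrite PE Rint_poisson// mulr1].
Qed.

End FourierIntegral.

(** * The upper Plancherel bound *)

Section Plancherel.
Context {R : realType}.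
Notation mu := (@lebesgue_measure R).
Implicit Types (f g h : R -> R) (e x y xi : R).

Lemma fourcD f g xi : intg f -> intg g ->
  fourc (fun x => f x + g x) xi = fourc f xi + fourc g xi.
Proof.
move=> fi gi; rewrite /fourc -mulrDr; congr (_ * _).
rewrite -(RintD (intg_cosM xi fi) (intg_cosM xi gi)).
by apply: eq_Rint => x; rewrite mulrDl.
Qed.

Lemma foursD f g xi : intg f -> intg g ->
  fours (fun x => f x + g x) xi = fours f xi + fours g xi.
Proof.
move=> fi gi; rewrite /fours -opprD -mulrDr; congr (- (_ * _)).
rewrite -(RintD (intg_sinM xi fi) (intg_sinM xi gi)).
by apply: eq_Rint => x; rewrite mulrDl.
Qed.

Lemma fourcZ c f xi : intg f -> fourc (fun x => c * f x) xi = c * fourc f xi.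
Proof.
move=> fi; rewrite /fourc mulrCA; congr (_ * _).
rewrite -(RintZ c (intg_cosM xi fi)).
by apply: eq_Rint => x; rewrite mulrA.
Qed.

Lemma foursZ c f xi : intg f -> fours (fun x => c * f x) xi = c * fours f xi.
Proof.
move=> fi; rewrite /fours mulrN mulrCA; congr (- (_ * _)).
rewrite -(RintZ c (intg_sinM xi fi)).
by apply: eq_Rint => x; rewrite mulrA.
Qed.

(** The Schur bound for a positive kernel of mass 1, from
    f(x) f(y) <= (f(x)^2 + f(y)^2) / 2. *)
Lemma abel_energy_le e f : 0 < e -> intg f -> L2 f ->
  \int[mu]_x (f x * poisson_int e f x) <= \int[mu]_x (f x ^+ 2).
Proof.
move=> e0 fi fL; have f2 := L2_sqr_intg fL.
have f2_ge0 x : 0 <= f x ^+ 2 by exact: sqr_ge0.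
have [Pi PE] := poisson_int_mass e0 f2 f2_ge0.
have mf := intg_meas fi.
have k1 (z : R * R) : `|poisson e (z.1 - z.2)| <= pi^-1 * e^-1.
  by rewrite ger0_norm; [exact: poisson_le|exact: poisson_ge0].
have mk : measurable_fun [set: R * R] (fun z : R * R => poisson e (z.1 - z.2)).
  apply: (measurableT_comp (continuous_measurable (continuous_poisson e0))).
  exact: measurable_funB measurable_fst measurable_snd.
have I := intg_kernel fi fi mk k1.
have If := intgZ 2^-1 f2; have IP := intgZ 2^-1 Pi.
apply: (@le_trans _ _ (\int[mu]_x (2^-1 * f x ^+ 2 + 2^-1 * poisson_int e (fun y => f y ^+ 2) x))).
  apply: le_Rintegral => //; first exact: (intgD If IP).
  move=> x _; rewrite /poisson_int.
  have i1 := intg_mul_poisson x e0 fi.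
  have i2 := intg_mul_poisson x e0 f2.
  have i3 := intgZ (f x ^+ 2) (intg_poisson_sub x e0).
  rewrite -(RintZ (f x) i1).
  have -> : 2^-1 * f x ^+ 2 + 2^-1 * \int[mu]_y (f y ^+ 2 * poisson e (x - y)) =
      \int[mu]_y (2^-1 * (f x ^+ 2 * poisson e (x - y) + f y ^+ 2 * poisson e (x - y))).
    rewrite (RintZ 2^-1 (intgD i3 i2)) (RintD i3 i2) mulrDr.
    by rewrite (RintZ _ (intg_poisson_sub x e0)) Rint_poisson_sub// mulr1.
  apply: le_Rintegral => //.
  - exact: (intgZ (f x) i1).
  - exact: (intgZ 2^-1 (intgD i3 i2)).
  - move=> y _; have := poisson_ge0 (x - y) e0; set p := poisson _ _ => p0.
    have : 0 <= (f x - f y) ^+ 2 * p by rewrite mulr_ge0 ?sqr_ge0.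
    by rewrite sqrrB; lra.
by rewrite (RintD If IP) (RintZ _ f2) (RintZ _ Pi) PE; lra.
Qed.

Lemma abel_cvg1 xi : abel n.+1%:R^-1 xi @[n --> \oo] --> (1 : R).
Proof.
have c0 : - (n.+1%:R^-1 * `|xi|) @[n --> \oo] --> (0 : R).
  rewrite -oppr0 -[X in - X](mul0r `|xi|); apply: cvgN; apply: cvgM; last exact: cvg_cst.
  exact: cvg_harmonic.
by have := cvg_comp _ _ c0 (@continuous_expR R 0); rewrite expR0.
Qed.

Lemma abel_sqrt e xi : abel e xi = (abel (e / 2) xi) ^+ 2.
Proof. by rewrite /abel expr2 -expRD; congr expR; field. Qed.

Lemma sqn_sum2 f g : L2 f -> L2 g ->
  (sqn f + sqn g = (\int[mu]_x (f x ^+ 2 + g x ^+ 2))%:E)%E.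
Proof.
move=> Lf Lg; rewrite !sqn_fin// (RintD (L2_sqr_intg Lf) (L2_sqr_intg Lg)).
by rewrite EFinD.
Qed.

Lemma L2_abel_bounded e (u : R -> R) (C : R) : 0 < e -> measurable_fun [set: R] u ->
  (forall x, `|u x| <= C) -> L2 (fun x => abel e x * u x).
Proof.
move=> e0 mu' uC; apply/L2P; split.
  apply: measurable_funM => //; apply: continuous_measurable; exact: continuous_abel.
have e2 : 0 < e * 2 by rewrite mulr_gt0.
have i : intg (fun x => abel e x ^+ 2 * u x ^+ 2).
  rewrite (_ : (fun x => _) = fun x => u x ^+ 2 * abel (e * 2) x).
    apply: (@intgMb _ _ _ (C ^+ 2)) (intg_abel e2); first exact: measurable_funX.
    by move=> x; rewrite normrX lerXn2r ?nnegrE// (le_trans _ (uC x)).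
  by apply/funext => x; rewrite (abel_sqrt (e * 2)) mulfK// mulrC.
have := Rint_fin i; rewrite /sqn => h.
rewrite (_ : (\int[mu]_x _ = \int[mu]_x (abel e x ^+ 2 * u x ^+ 2)%:E)%E).
  by rewrite h ltry.
by apply: eq_integral => x _; rewrite exprMn.
Qed.

(** By [abel_parseval] and [abel_energy_le] the damped transform has at most the
    energy of f, and Fatou's lemma removes the damping. *)
Lemma plancherel_le f : intg f -> L2 f ->
  (sqn (fourc f) <= sqn f)%E /\ (sqn (fours f) <= sqn f)%E.
Proof.
move=> fi fL; have mc := measurable_fourc fi; have ms := measurable_fours fi.
have key (n : nat) : (sqn (fun xi => abel (n.+1%:R^-1 / 2) xi * fourc f xi)%R +
    sqn (fun xi => abel (n.+1%:R^-1 / 2) xi * fours f xi)%R <= sqn f)%E.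
  have e0 : 0 < n.+1%:R^-1 :> R by rewrite invr_gt0.
  have e2 : 0 < n.+1%:R^-1 / 2 :> R by rewrite divr_gt0.
  have Lc := L2_abel_bounded e2 mc (fun xi => fourc_bound xi fi).
  have Ls := L2_abel_bounded e2 ms (fun xi => fours_bound xi fi).
  rewrite (sqn_sum2 Lc Ls) (sqn_fin fL) lee_fin.
  apply: le_trans (abel_energy_le e0 fi fL); rewrite abel_parseval//.
  apply: eq_le_of; apply: eq_Rint => xi.
  by rewrite !exprMn -mulrDr -abel_sqrt.
have lim (u : R -> R) : {ae mu, forall xi, abel (n.+1%:R^-1 / 2) xi * u xi @[n --> \oo] --> u xi}.
  apply: aeW => xi; rewrite -[X in _ --> X]mul1r; apply: cvgM; last exact: cvg_cst.
  have h (n : nat) : abel (n.+1%:R^-1 / 2) xi = abel n.+1%:R^-1 (xi / 2).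
    by rewrite /abel normrM [`|2^-1|]ger0_norm//; congr expR; ring.
  by under eq_fun do rewrite h; exact: abel_cvg1.
have mab (n : nat) (u : R -> R) : measurable_fun [set: R] u ->
    measurable_fun [set: R] (fun xi => abel (n.+1%:R^-1 / 2) xi * u xi).
  move=> mu'; apply: measurable_funM => //; apply: continuous_measurable; exact: continuous_abel.
split.
- apply: (sqn_fatou (fun n => mab n _ mc) mc (lim _)) => n.
  by apply: le_trans (key n); rewrite leeDl// sqn_ge0.
- apply: (sqn_fatou (fun n => mab n _ ms) ms (lim _)) => n.
  by apply: le_trans (key n); rewrite leeDr// sqn_ge0.
Qed.

Lemma L2_fourc f : intg f -> L2 f -> L2 (fourc f).
Proof.
move=> fi fL; apply/L2P; split; first exact: measurable_fourc.
exact: le_lt_trans (plancherel_le fi fL).1 (L2_lty fL).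
Qed.

Lemma L2_fours f : intg f -> L2 f -> L2 (fours f).
Proof.
move=> fi fL; apply/L2P; split; first exact: measurable_fours.
exact: le_lt_trans (plancherel_le fi fL).2 (L2_lty fL).
Qed.

(** The kernel concentrates at 0: within distance d / 2 of x continuity is
    used, and beyond it only the mass 1 - (2 / pi) atan((n + 1) d / 2) is
    left. *)
Lemma poisson_int_cvg g (B : R) x : intg g -> (forall y, `|g y| <= B) ->
  {for x, continuous g} -> poisson_int n.+1%:R^-1 g x @[n --> \oo] --> g x.
Proof.
move=> gi gB cg; have B0 : 0 <= B by apply: le_trans (gB 0).
apply/cvgrPdist_le => eta eta0.
have /cvgrPdist_le /(_ (eta / 2)) := cg; rewrite divr_gt0// => /(_ erefl) [d /= d0 dP].
have d2 : 0 < d / 2 by rewrite divr_gt0.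
pose T (n : nat) : R := 1 - 2 / pi * atan (n.+1%:R * (d / 2)).
have T0 : T n @[n --> \oo] --> (0 : R).
  have -> : (0 : R) = 1 - 2 / pi * (pi / 2).
    by rewrite mulf_div [pi * _]mulrC divff ?subrr// mulf_neq0// gt_eqF ?pi_gt0.
  apply: cvgB; first exact: cvg_cst.
  apply: cvgM; first exact: cvg_cst.
  have en : n.+1%:R * (d / 2) @[n --> \oo] --> +oo.
    apply/cvgryPge => A; near=> n; rewrite -ler_pdivrMr//.
    apply: (@le_trans _ _ n%:R); last by rewrite ler_nat.
    by near: n; exact: nbhs_infty_ger.
  exact: (cvg_comp _ _ en (@cvgy_atan R)).
have T0' : 2 * B * T n @[n --> \oo] --> (0 : R).
  by rewrite -(mulr0 (2 * B)); apply: cvgM => //; exact: cvg_cst.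
have /cvgrPdist_le /(_ (eta / 2)) := T0'; rewrite divr_gt0// => /(_ erefl) [N _ NP].
exists N => // n Nn; have := NP n Nn; rewrite /= sub0r normrN => Tn.
have e0 : 0 < n.+1%:R^-1 :> R by rewrite invr_gt0.
set e := n.+1%:R^-1.
have ip := intg_poisson_sub x e0.
have ig := intg_mul_poisson x e0 gi.
have ii : intg (fun y => ind (x - d / 2) (x + d / 2) y * poisson e (x - y)).
  by apply: intgMb ip; [exact: measurable_ind|exact: ind_bound].
have -> : g x - poisson_int e g x = \int[mu]_y (g x * poisson e (x - y) - g y * poisson e (x - y)).
  by rewrite (RintB (intgZ (g x) ip) ig) (RintZ _ ip) Rint_poisson_sub// mulr1.
pose U y := eta / 2 * poisson e (x - y) + 2 * B * (poisson e (x - y) - ind (x - d / 2) (x + d / 2) y * poisson e (x - y)).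
have iU : intg U by apply: intgD; [exact: intgZ|apply: intgZ; exact: intgB].
apply: (@le_trans _ _ (\int[mu]_y U y)).
  apply: le_trans; first by apply: le_normr_Rintegral => //; exact: (intgB (intgZ (g x) ip) ig).
  apply: le_Rintegral => //; first by apply: integrable_norm; exact: (intgB (intgZ (g x) ip) ig).
  move=> y _; rewrite -mulrBl normrM (ger0_norm (poisson_ge0 _ e0)) /U.
  have := poisson_ge0 (x - y) e0; set p := poisson _ _ => p0.
  rewrite indE; case: (boolP (x - d / 2 <= y <= x + d / 2)) => xy /=.
    rewrite mul1r subrr mulr0 addr0 ler_wpM2r//; apply: dP => /=.
    by rewrite ltr_norml; move/andP: xy => [? ?]; lra.
  rewrite mul0r subr0; have : `|g x - g y| <= 2 * B.
    by apply: le_trans (ler_normB _ _) _; have := gB x; have := gB y; lra.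
  move=> h; have : `|g x - g y| * p <= 2 * B * p by rewrite ler_wpM2r.
  have : 0 <= eta / 2 * p by rewrite mulr_ge0// ltW// divr_gt0.
  lra.
rewrite /U (RintD (intgZ (eta / 2) ip) (intgZ (2 * B) (intgB ip ii))).
rewrite (RintZ _ ip) (RintZ _ (intgB ip ii)) (RintB ip ii) Rint_poisson_sub// mulr1.
have -> : \int[mu]_y (ind (x - d / 2) (x + d / 2) y * poisson e (x - y)) =
    2 / pi * atan (n.+1%:R * (d / 2)).
  have := @Rint_poisson_itv R e (d / 2) e0 (ltW d2); rewrite invrK => <-.
  rewrite Rint_itvE.
  rewrite -(@Rint_shift _ (- x) (fun z => ind (- (d / 2)) (d / 2) z * poisson e z)); last first.
    apply: measurable_funM; first exact: measurable_ind.
    by apply: continuous_measurable; exact: continuous_poisson.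
  apply: eq_Rint => y; rewrite -(poissonN e (x - y)) opprB !indE; congr ((_ : bool)%:R * _).
  by rewrite [- _ <= y - x]lerBrDl [y - x <= _]lerBlDl.
have := ler_norm (2 * B * T n); rewrite -/(T n); move: Tn; lra.
Unshelve. all: by end_near. Qed.

(** A truncated continuous function is the bounded limit of its Poisson
    integrals off the two jumps, so the left-hand side of [abel_parseval] tends
    to its energy, while the right-hand side stays below the energy of the
    transform. *)
Lemma plancherel_ge_nice (c : R -> R) (N B : R) : continuous c -> (forall y, `|c y| <= B) ->
  (sqn (fun x => ind (- N) N x * c x)%R <=
    sqn (fourc (fun x => ind (- N) N x * c x)%R) +
    sqn (fours (fun x => ind (- N) N x * c x)%R))%E.
Proof.
move=> cc cB; set g := (fun x => ind (- N) N x * c x).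
have gi : intg g by exact: (locint_ind _ _ (continuous_locint cc)).
have gB y : `|g y| <= B.
  rewrite /g normrM; apply: le_trans (cB y).
  by rewrite -[leRHS]mul1r ler_wpM2r// ind_bound.
have B0 : 0 <= B by apply: le_trans (gB 0).
have gL : L2 g.
  rewrite (_ : g = fun x => c x * ind (- N) N x); last by apply/funext => x; rewrite /g mulrC.
  exact: (L2Mb (continuous_measurable cc) cB (L2_ind _ _)).
have mg := intg_meas gi.
have Lc := L2_fourc gi gL; have Ls := L2_fours gi gL.
rewrite (sqn_sum2 Lc Ls) (sqn_fin gL) lee_fin.
have gcvg x : x != - N -> x != N -> poisson_int n.+1%:R^-1 g x @[n --> \oo] --> g x.
  move=> xN xN'; apply: (poisson_int_cvg gi gB).
  have cprod (k : R) : (\forall y \near x, ind (- N) N y = k) -> {for x, continuous g}.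
    move=> h; have gk : \forall y \near x, k * c y = g y.
      by apply: filterS h => y hy; rewrite /g hy.
    have H : k * c y @[y --> x] --> k * c x by apply: cvgM; [exact: cvg_cst|exact: cc].
    rewrite /prop_for /continuous_at -(nbhs_singleton gk).
    apply: (@cvg_trans _ ((fun y => k * c y) @ x)); first exact: near_eq_cvg.
    exact: H.
  have [x1|x1|/eqP] := ltgtP x (- N); last by rewrite (negPf xN).
    apply: (cprod 0); have : \forall y \near x, y < - N by exact: lt_nbhsl.
    by apply: filterS => y yN; rewrite indE leNgt yN.
  have [x2|x2|/eqP] := ltgtP x N; last by rewrite (negPf xN').
    apply: (cprod 1); have xI : x \in `]- N, N[ by rewrite in_itv/= x1.
    apply: filterS (near_in_itvoo xI) => y; rewrite in_itv/= => /andP[/ltW h1 /ltW h2].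
    by rewrite indE h1 h2.
  apply: (cprod 0); have : \forall y \near x, N < y by exact: lt_nbhsr.
  by apply: filterS => y yN; rewrite indE [y <= N]leNgt yN andbF.
have Pbound (n : nat) x : `|poisson_int n.+1%:R^-1 g x| <= B.
  have e0 : 0 < n.+1%:R^-1 :> R by rewrite invr_gt0.
  have ip := intg_poisson_sub x e0; have ig := intg_mul_poisson x e0 gi.
  apply: le_trans; first exact: le_normr_Rintegral.
  have BE : \int[mu]_y (B * poisson n.+1%:R^-1 (x - y)) = B.
    by rewrite (RintZ B ip) Rint_poisson_sub// mulr1.
  rewrite -[leRHS]BE; apply: le_Rintegral => //; [exact: (integrable_norm ig)|exact: (intgZ B ip)|].
  by move=> y _; rewrite normrM (ger0_norm (poisson_ge0 _ e0)) ler_wpM2r// poisson_ge0.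
have le n : \int[mu]_x (g x * poisson_int n.+1%:R^-1 g x) <=
    \int[mu]_x (fourc g x ^+ 2 + fours g x ^+ 2).
  have e0 : 0 < n.+1%:R^-1 :> R by rewrite invr_gt0.
  have i2 := intgD (L2_sqr_intg Lc) (L2_sqr_intg Ls).
  rewrite abel_parseval//; apply: le_Rintegral => //.
    apply: (@intgMb _ _ _ 1) i2 => [|xi].
      by apply: continuous_measurable; exact: continuous_abel.
    by rewrite ger0_norm ?abel_ge0// abel_le1// ltW.
  move=> xi _; rewrite -[leRHS]mul1r ler_wpM2r ?addr_ge0 ?sqr_ge0//.
  by rewrite abel_le1// ltW.
have mP (n : nat) : measurable_fun [set: R] (fun x => g x * poisson_int n.+1%:R^-1 g x).
  have e0 : 0 < n.+1%:R^-1 :> R by rewrite invr_gt0.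
  have mk : measurable_fun [set: R * R] (fun z : R * R => poisson n.+1%:R^-1 (z.1 - z.2)).
    apply: (measurableT_comp (continuous_measurable (continuous_poisson e0))).
    exact: measurable_funB measurable_fst measurable_snd.
  have k1 (z : R * R) : `|poisson n.+1%:R^-1 (z.1 - z.2)| <= pi^-1 * n.+1%:R^-1^-1.
    by rewrite ger0_norm; [exact: poisson_le|exact: poisson_ge0].
  exact: (intg_meas (intg_kernel gi gi mk k1)).
have lim : \int[mu]_x (g x * poisson_int n.+1%:R^-1 g x) @[n --> \oo] --> \int[mu]_x (g x ^+ 2).
  rewrite /Rintegral; apply: fine_cvg; rewrite -/(Rintegral _ _ _) -Rint_fin; last exact: L2_sqr_intg.
  have := @dominated_convergence _ _ _ mu setT measurableT
    (fun n x => (g x * poisson_int n.+1%:R^-1 g x)%:E) (fun x => (g x ^+ 2)%:E)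
    (fun x => (B * `|g x|)%:E).
  case.
  - by move=> n; apply/measurable_EFinP; exact: mP.
  - exact: measurable_sqr.
  - apply: ae_imp2 (ae_neq (- N)) (ae_neq N) => x xa xb _; apply: cvg_EFin; first exact: nearW.
    by rewrite expr2; apply: cvgM; [exact: cvg_cst|exact: gcvg].
  - exact: (intgZ B (integrable_norm gi)).
  - apply: aeW => x n _; rewrite lee_fin normrM mulrC ler_wpM2r//.
  - by move=> _ _; exact.
rewrite -(cvg_lim _ lim)//; apply: limr_le; first by apply/cvg_ex; eexists; exact: lim.
exact: nearW.
Qed.

End Plancherel.

(** * The lower Plancherel bound *)

Section Density.
Context {R : realType}.
Notation mu := (@lebesgue_measure R).
Implicit Types (f g h c : R -> R).

(** Truncation of values to [-M, M], by a formula that is visibly continuous. *)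
Definition clip (M t : R) : R := (`|t + M| - `|t - M|) / 2.

Lemma continuous_clip M : continuous (clip M).
Proof.
move=> t; apply: cvgM; last exact: cvg_cst.
apply: cvgB; apply: cvg_norm.
  by apply: cvgD; [exact: cvg_id|exact: cvg_cst].
by apply: cvgB; [exact: cvg_id|exact: cvg_cst].
Qed.

Lemma clip_bound M t : 0 <= M -> `|clip M t| <= M.
Proof.
by move=> M0; rewrite /clip ler_norml; case: (ger0P (t + M)) => ?; case: (ger0P (t - M)) => ?; lra.
Qed.

Lemma clip_dist M s t : `|s| <= M -> `|s - clip M t| <= `|s - t|.
Proof.
rewrite ler_norml /clip => /andP[? ?].
rewrite ler_norml.
by case: (ger0P (t + M)) => ?; case: (ger0P (t - M)) => ?; case: (ger0P (s - t)) => ?; lra.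
Qed.

Definition cutoff f (n : nat) (x : R) : R :=
  ind (- n%:R) n%:R x * (\1_[set y | `|f y| <= n%:R] x * f x).

Lemma measurable_cutoff f n : measurable_fun [set: R] f -> measurable_fun [set: R] (cutoff f n).
Proof.
move=> mf; apply: measurable_funM; first exact: measurable_ind.
apply: measurable_funM => //; apply: measurable_indic.
rewrite -[X in measurable X]setTI; apply: (measurable_fun_ler _ _ measurableT) => //.
exact: measurableT_comp.
Qed.

Lemma cutoff_bound f n x : `|cutoff f n x| <= n%:R.
Proof.
rewrite /cutoff indicE; case: (boolP (x \in _)) => [|_]; last by rewrite mul0r mulr0 normr0.
rewrite inE/= mul1r normrM => h; apply: le_trans h.
by rewrite -[leRHS]mul1r ler_wpM2r// ind_bound.
Qed.

Lemma cutoff_cvg f : L2 f -> cvg2 (cutoff f) f.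
Proof.
move=> fL; have mf := L2_meas fL.
apply: (sqn_dominated (g := f)) => //.
- by move=> n; exact: measurable_cutoff.
- apply: aeW => x; have [N _ NP] := nbhs_infty_ger (`|x| + `|f x|).
  apply: (@cvg_trans _ ((fun=> f x) @ \oo)); last exact: cvg_cst.
  apply: near_eq_cvg; exists N => // n /NP /= xn.
  have := normr_ge0 x; have := normr_ge0 (f x) => ? ?.
  rewrite /cutoff indE -ler_norml indicE mem_set/=; last by lra.
  by rewrite (_ : `|x| <= n%:R) ?mul1r//; lra.
- move=> n x; rewrite /cutoff indicE indE.
  by case: (x \in _); case: (_ <= _ <= _); rewrite ?mul1r ?mul0r ?mulr0 ?subrr ?sub0r ?normrN ?normr0.
Qed.

(** Cut f off in space and in size, and approximate the result h in L^1 by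
    continuous functions.  Once these are clipped to c with |c| <= N, the
    distance in L^1 controls the one in L^2, as |h - c|^2 <= 2 N |h - c|. *)
Lemma L2_dense f (e : R) : L2 f -> 0 < e -> exists c (N B : R),
  [/\ continuous c, forall y, `|c y| <= B &
      (sqn (fun x => f x - ind (- N) N x * c x)%R <= e%:E)%E].
Proof.
move=> fL e0; have mf := L2_meas fL.
have e4 : 0 < e / 4 by rewrite divr_gt0.
have [n nP] := cvge0_lt (cutoff_cvg fL) e4.
have {nP}hn := ltW (nP n (leqnn _)); set h := cutoff f n in hn.
have mh : measurable_fun [set: R] h by exact: measurable_cutoff.
pose N : R := n%:R; have N0 : 0 <= N by [].
have hi : mu.-integrable `[- N, N] (EFin \o h).
  apply/intg_itvE; rewrite (_ : (fun x => _) = fun x => h x * ind (- N) N x); last by apply/funext => x; rewrite mulrC.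
  by apply: (@intgMb _ _ _ N) => //; [exact: cutoff_bound|exact: intg_ind].
have Efin : (mu `[(- N)%R, N]%classic < +oo)%E.
  by apply: compact_finite_measure; exact: segment_compact.
have [gs [cg ig gcvg]] := approximation_continuous_integrable (measurable_itv _) Efin hi.
have e5 : 0 < e / 4 / (2 * N + 1) by rewrite divr_gt0// ltr_wpDl// mulr_ge0.
have [k kP] := cvge0_lt gcvg e5.
have {kP}gk := ltW (kP k (leqnn _)).
pose c x := clip N (gs k x).
have cc : continuous c.
  by move=> x; exact: (cvg_comp _ _ (cg k x) (@continuous_clip N _)).
exists c, N, N; split => //; first by move=> y; exact: clip_bound.
have mc : measurable_fun [set: R] (fun x => ind (- N) N x * c x).
  by apply: measurable_funM; [exact: measurable_ind|exact: continuous_measurable].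
apply: le_trans (sqn_dist mf mh mc) _.
have h2 : (sqn (fun x => h x - ind (- N) N x * c x)%R <= (e / 4)%:E)%E.
  have mgk := continuous_measurable (cg k).
  have md : measurable_fun [set: R] (fun x => `|h x - gs k x|).
    by apply: measurableT_comp => //; exact: measurable_funB.
  apply: (@le_trans _ _ (\int[mu]_x ((2 * N + 1) * (ind (- N) N x * `|h x - gs k x|))%:E)%E).
    apply: ge0_le_integral => //=.
    - by move=> x _; rewrite lee_fin sqr_ge0.
    - by apply: measurable_sqr; exact: measurable_funB.
    - apply/measurable_EFinP; apply: measurable_funM => //.
      by apply: measurable_funM => //; exact: measurable_ind.
    - move=> x _; rewrite lee_fin.
      have hh : h x = ind (- N) N x * h x.
        by rewrite /h /cutoff mulrA indE; case: (_ <= _ <= _); rewrite ?mul1r ?mul0r.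
      rewrite hh indE; case: (boolP (- N <= x <= N)) => xN /=; last by rewrite !mul0r subrr expr0n mulr0.
      rewrite !mul1r.
      have h1 := clip_dist (gs k x) (cutoff_bound f n x); rewrite -/h -/N -/(c x) in h1.
      have h3 : `|h x - c x| <= 2 * N.
        apply: le_trans (ler_normB _ _) _; have := cutoff_bound f n x; have := clip_bound (gs k x) N0.
        by rewrite -/h -/N -/(c x); lra.
      rewrite -(real_normK (num_real (h x - c x))) expr2.
      by apply: ler_pM => //; lra.
  under eq_integral do rewrite EFinM.
  rewrite ge0_integralZl//; last 3 first.
  - by apply/measurable_EFinP; apply: measurable_funM => //; exact: measurable_ind.
  - by move=> x _; rewrite lee_fin mulr_ge0// ind_ge0.
  - by rewrite lee_fin addr_ge0// mulr_ge0.
  rewrite (_ : (\int[mu]_x _)%E = (\int[mu]_(z in `[(- N)%R, N]) `|(h z - gs k z)%:E|)%E); last first.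
    rewrite [RHS]integral_mkcond; apply: eq_integral => x _.
    by rewrite patchE /ind indicE; case: (x \in _); rewrite ?mul1r ?mul0r.
  rewrite muleC -lee_pdivlMr ?ltr_wpDl ?mulr_ge0//.
rewrite sqnC in hn.
apply: (@le_trans _ _ (2%:E * (e / 4)%:E + 2%:E * (e / 4)%:E)%E).
  by apply: leeD; apply: lee_wpmul2l => //; rewrite lee_fin.
by rewrite -!EFinM -EFinD lee_fin; lra.
Qed.

Lemma L2_fin f : L2 f -> sqn f \is a fin_num.
Proof. by move=> fL; rewrite ge0_fin_numE ?sqn_ge0 ?L2_lty. Qed.

Local Lemma plancherel_arith (c s c' s' cg sg r F G : \bar R) (e : R) :
  c \is a fin_num -> s \is a fin_num -> c' \is a fin_num -> s' \is a fin_num ->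
  cg \is a fin_num -> sg \is a fin_num -> r \is a fin_num -> F \is a fin_num ->
  G \is a fin_num ->
  (cg <= 2%:E * c + 2%:E * c' -> sg <= 2%:E * s + 2%:E * s' ->
   F <= 2%:E * G + 2%:E * r -> G <= cg + sg -> c' <= r -> s' <= r ->
   r <= (e / 10)%:E -> F <= 4%:E * (c + s) + e%:E)%E.
Proof.
move=> /fineK <- /fineK <- /fineK <- /fineK <- /fineK <- /fineK <- /fineK <- /fineK <- /fineK <-.
by rewrite -!EFinM -!EFinD -?EFinM -?EFinD !lee_fin; lra.
Qed.

(** The bound passes from truncated continuous functions to f by density,
    because [plancherel_le] controls the transform of the error.  The constant
    is 2 for splitting f times 2 for splitting its transform. *)
Lemma plancherel_ge f : intg f -> L2 f ->
  (sqn f <= 4%:E * (sqn (fourc f) + sqn (fours f)))%E.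
Proof.
move=> fi fL; apply/lee_addgt0Pr => e e0.
(* 10 = 4 + 4 + 2: the weights of the transforms of the error and of the error. *)
have e10 : 0 < e / 10 by rewrite divr_gt0.
have [c [N [B [cc cB fc]]]] := L2_dense fL e10.
set g := (fun x => ind (- N) N x * c x) in fc.
have gi : intg g by exact: (locint_ind _ _ (continuous_locint cc)).
have gL : L2 g.
  rewrite (_ : g = fun x => c x * ind (- N) N x); last by apply/funext => x; rewrite /g mulrC.
  exact: (L2Mb (continuous_measurable cc) cB (L2_ind _ _)).
have ri : intg (fun x => g x - f x) by exact: intgB.
have rL : L2 (fun x => g x - f x) by exact: L2B.
have [pc ps] := plancherel_le ri rL.
have r6 : (sqn (fun x => g x - f x)%R <= (e / 10)%:E)%E by rewrite sqnC.
have ge := plancherel_ge_nice N cc cB; rewrite -/g in ge.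
have gE : g = fun x => f x + (g x - f x) by apply/funext => x; rewrite addrC subrK.
have hc : (sqn (fourc g) <= 2%:E * sqn (fourc f) + 2%:E * sqn (fourc (fun x => g x - f x)%R))%E.
  rewrite {1}gE (_ : fourc _ = fun xi => fourc f xi + fourc (fun x => g x - f x) xi).
    by apply: sqnD; exact: measurable_fourc.
  by apply/funext => xi; exact: fourcD.
have hs : (sqn (fours g) <= 2%:E * sqn (fours f) + 2%:E * sqn (fours (fun x => g x - f x)%R))%E.
  rewrite {1}gE (_ : fours _ = fun xi => fours f xi + fours (fun x => g x - f x) xi).
    by apply: sqnD; exact: measurable_fours.
  by apply/funext => xi; exact: foursD.
have hf : (sqn f <= 2%:E * sqn g + 2%:E * sqn (fun x => g x - f x)%R)%E.
  rewrite {1}(_ : f = fun x => g x - (g x - f x)); last by apply/funext => x; rewrite opprB addrC subrK.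
  by apply: sqnB; exact: L2_meas.
have Lc := L2_fourc fi fL; have Ls := L2_fours fi fL.
have Lc' := L2_fourc ri rL; have Ls' := L2_fours ri rL.
have Lc2 := L2_fourc gi gL; have Ls2 := L2_fours gi gL.
exact: (plancherel_arith (L2_fin Lc) (L2_fin Ls) (L2_fin Lc') (L2_fin Ls') (L2_fin Lc2)
  (L2_fin Ls2) (L2_fin rL) (L2_fin fL) (L2_fin gL) hc hs hf ge pc ps r6).
Qed.

End Density.

(** * The Fourier-Plancherel transform *)

Section FourierPlancherel.
Context {R : realType}.
Notation mu := (@lebesgue_measure R).
Implicit Types (f g h u v w a b : R -> R) (x xi : R).

Lemma sqrt_cvge0 (s : nat -> \bar R) : (forall n, 0 <= s n)%E ->
  (s n `^ 2^-1)%E @[n --> \oo] --> 0%E <-> s n @[n --> \oo] --> 0%E.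
Proof.
move=> s0; have sE n (r : R) : s n = r%:E -> (s n `^ 2^-1 = (Num.sqrt r)%:E)%E.
  by move=> sr; rewrite sr poweR_EFin powR12_sqrt// -lee_fin -sr.
split=> sc; apply: cvge0P => [n|e e0]; do ?exact: poweR_ge0; do ?exact: s0.
- have e1 : 0 < Num.sqrt e by rewrite sqrtr_gt0.
  have [N NP] := cvge0_lt sc e1; exists N => n /NP h.
  have := s0 n; case E : (s n) => [r| |] // _.
    move: h; rewrite (sE _ _ E) lte_fin lee_fin => /ltW.
    by rewrite ler_sqrt ?(ltW e0).
  by move: h; rewrite E poweRyr ?invr_eq0 ?pnatr_eq0.
- have e2 : 0 < e ^+ 2 by rewrite exprn_gt0.
  have [N NP] := cvge0_lt sc e2; exists N => n /NP h.
  have := s0 n; case E : (s n) => [r| |] // _; last by rewrite E in h.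
  rewrite -E (sE _ _ E) lee_fin; move: h; rewrite E lte_fin => /ltW re.
  by rewrite -(ger0_norm (ltW e0)) -sqrtr_sqr; exact: ler_wsqrtr.
Qed.

Definition trunc u (N : nat) (x : R) : R := ind (- N%:R) N%:R x * u x.

Lemma L2_trunc u N : L2 u -> L2 (trunc u N).
Proof. by move=> Lu; apply: (L2Mb (M := 1)) => //; [exact: measurable_ind|exact: ind_bound]. Qed.

Lemma intg_trunc u N : L2 u -> intg (trunc u N).
Proof. by move=> Lu; apply: locint_ind; exact: L2_locint. Qed.

Lemma sqn_trunc u N : measurable_fun [set: R] u -> (sqn (trunc u N) <= sqn u)%E.
Proof.
move=> mu'; apply: sqn_le => //.
  by apply: measurable_funM => //; exact: measurable_ind.
by move=> x; rewrite normrM -[leRHS]mul1r ler_wpM2r// ind_bound.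
Qed.

Lemma trunc_cvg u : L2 u -> cvg2 (trunc u) u.
Proof.
move=> Lu; apply: (sqn_dominated (g := u)) => //.
- by move=> n; exact: L2_meas (L2_trunc n Lu).
- exact: L2_meas.
- apply: aeW => x; rewrite -[X in _ --> X]mul1r; apply: cvgM; last exact: cvg_cst.
  exact: ind_cvg1.
- move=> n x; rewrite /trunc indE.
  by case: (_ <= _ <= _); rewrite ?mul1r ?mul0r ?subrr ?sub0r ?normrN ?normr0.
Qed.

Lemma trunc_fourier_reE u N : trunc_fourier_re u N = fourc (trunc u N).
Proof.
apply/funext => xi; rewrite /trunc_fourier_re /fourc Rint_itvE; congr (_ * _).
by apply: eq_Rint => x; rewrite mulrA.
Qed.

Lemma trunc_fourier_imE u N : trunc_fourier_im u N = fours (trunc u N).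
Proof.
apply/funext => xi; rewrite /trunc_fourier_im /fours Rint_itvE; congr (- (_ * _)).
by apply: eq_Rint => x; rewrite mulrA.
Qed.

(** Squaring the norm turns the limits in the definition into limits in the
    sense of [cvg2]. *)
Lemma is_fourierP u a b : is_fourier u a b <->
  [/\ L2 u, L2 a, L2 b, cvg2 (fun N => fourc (trunc u N)) a &
      cvg2 (fun N => fours (trunc u N)) b].
Proof.
have E (s : nat -> R -> R) (c : R -> R) :
    Lnorm mu 2%:E (fun xi => (s N xi - c xi)%:E) @[N --> \oo] --> 0%E <-> cvg2 s c.
  have := @sqrt_cvge0 (fun n => sqn (fun xi => s n xi - c xi)) (fun n => sqn_ge0 _).
  by under eq_fun do rewrite -Lnorm2E.
split=> -[Lu La Lb ca cb]; split => //.
- by apply/E; under eq_fun do rewrite -trunc_fourier_reE.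
- by apply/E; under eq_fun do rewrite -trunc_fourier_imE.
- by under eq_fun do rewrite trunc_fourier_reE; apply/E.
- by under eq_fun do rewrite trunc_fourier_imE; apply/E.
Qed.

Lemma fourier_L2 u a b : is_fourier u a b -> [/\ L2 u, L2 a & L2 b].
Proof. by case. Qed.

Lemma fourcB f g xi : intg f -> intg g ->
  fourc (fun x => f x - g x) xi = fourc f xi - fourc g xi.
Proof.
move=> fi gi; rewrite (fourcD xi fi (intgN gi)); congr (_ + _).
by have := fourcZ (-1) xi gi; rewrite mulN1r => <-; congr fourc; apply/funext => x; rewrite mulN1r.
Qed.

Lemma foursB f g xi : intg f -> intg g ->
  fours (fun x => f x - g x) xi = fours f xi - fours g xi.
Proof.
move=> fi gi; rewrite (foursD xi fi (intgN gi)); congr (_ + _).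
by have := foursZ (-1) xi gi; rewrite mulN1r => <-; congr fours; apply/funext => x; rewrite mulN1r.
Qed.

Lemma sqn_fourcB f g : intg f -> L2 f -> intg g -> L2 g ->
  (sqn (fun xi => fourc f xi - fourc g xi)%R <= sqn (fun x => f x - g x)%R)%E.
Proof.
move=> fi fL gi gL; apply: le_trans (plancherel_le (intgB fi gi) (L2B fL gL)).1.
by apply: eq_le_of; congr sqn; apply/funext => xi; rewrite fourcB.
Qed.

Lemma sqn_foursB f g : intg f -> L2 f -> intg g -> L2 g ->
  (sqn (fun xi => fours f xi - fours g xi)%R <= sqn (fun x => f x - g x)%R)%E.
Proof.
move=> fi fL gi gL; apply: le_trans (plancherel_le (intgB fi gi) (L2B fL gL)).2.
by apply: eq_le_of; congr sqn; apply/funext => xi; rewrite foursB.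
Qed.

Lemma sqn_le2 f g : measurable_fun [set: R] f -> measurable_fun [set: R] g ->
  (sqn f <= 2%:E * sqn g + 2%:E * sqn (fun x => g x - f x)%R)%E.
Proof.
move=> mf mg; rewrite {1}(_ : f = fun x => g x - (g x - f x)); last by apply/funext => x; rewrite opprB addrC subrK.
by apply: sqnB => //; exact: measurable_funB.
Qed.

Lemma sqn_le_lim (fs : nat -> R -> R) f (C : \bar R) : (forall n, measurable_fun [set: R] (fs n)) ->
  measurable_fun [set: R] f -> cvg2 fs f -> (forall n, sqn (fs n) <= C)%E ->
  (sqn f <= 2%:E * C)%E.
Proof.
move=> mfs mf ff fC; apply/lee_addgt0Pr => e e0.
have e2 : 0 < e / 2 by rewrite divr_gt0.
have [N NP] := cvge0_lt ff e2; have /ltW h := NP N (leqnn _).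
apply: le_trans (sqn_le2 mf (mfs N)) _; apply: leeD.
  by apply: lee_wpmul2l; [rewrite lee_fin|exact: fC].
have -> : (e%:E = 2%:E * (e / 2)%:E)%E by rewrite -EFinM; congr EFin; field.
by apply: lee_wpmul2l; [rewrite lee_fin|exact: h].
Qed.

(** Plancherel's theorem up to constants; this form survives limits with
    nothing but (x + y)^2 <= 2 x^2 + 2 y^2. *)
Lemma fourier_le u a b : is_fourier u a b ->
  (sqn a <= 2%:E * sqn u)%E /\ (sqn b <= 2%:E * sqn u)%E.
Proof.
move=> /is_fourierP[Lu La Lb ca cb]; have mu' := L2_meas Lu.
have it n := intg_trunc n Lu; have Lt n := L2_trunc n Lu.
split; [apply: (sqn_le_lim _ _ ca) => [n||n]|apply: (sqn_le_lim _ _ cb) => [n||n]].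
- exact: measurable_fourc.
- exact: L2_meas.
- by apply: le_trans (plancherel_le (it n) (Lt n)).1 _; exact: sqn_trunc.
- exact: measurable_fours.
- exact: L2_meas.
- by apply: le_trans (plancherel_le (it n) (Lt n)).2 _; exact: sqn_trunc.
Qed.

Local Lemma fourier_ge_arith (A B U T C S dc ds dt : \bar R) (e : R) :
  A \is a fin_num -> B \is a fin_num -> U \is a fin_num -> T \is a fin_num ->
  C \is a fin_num -> S \is a fin_num -> dc \is a fin_num -> ds \is a fin_num ->
  dt \is a fin_num ->
  (U <= 2%:E * T + 2%:E * dt -> T <= 4%:E * (C + S) -> C <= 2%:E * A + 2%:E * dc ->
   S <= 2%:E * B + 2%:E * ds -> dc <= (e / 34)%:E -> ds <= (e / 34)%:E ->
   dt <= (e / 34)%:E -> U <= 16%:E * (A + B) + e%:E)%E.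
Proof.
move=> /fineK <- /fineK <- /fineK <- /fineK <- /fineK <- /fineK <- /fineK <- /fineK <- /fineK <-.
by rewrite -!EFinM -!EFinD -?EFinM -?EFinD !lee_fin; lra.
Qed.

Local Lemma fourier_closed_arith (X Y Z V W : \bar R) (e : R) :
  X \is a fin_num -> Y \is a fin_num -> Z \is a fin_num -> V \is a fin_num ->
  W \is a fin_num ->
  (X <= 2%:E * Y + 2%:E * Z -> Z <= 2%:E * V + 2%:E * W -> Y <= (e / 10)%:E ->
   V <= (e / 10)%:E -> W <= (e / 10)%:E -> X <= e%:E)%E.
Proof.
move=> /fineK <- /fineK <- /fineK <- /fineK <- /fineK <-.
by rewrite -!EFinM -!EFinD -?EFinM -?EFinD !lee_fin; lra.
Qed.

Lemma fourier_ge u a b : is_fourier u a b ->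
  (sqn u <= 16%:E * (sqn a + sqn b))%E.
Proof.
move=> /is_fourierP[Lu La Lb ca cb]; have mu' := L2_meas Lu.
apply/lee_addgt0Pr => e e0.
(* 34 = 16 + 16 + 2: the weights of the errors in both components and in u. *)
have e18 : 0 < e / 34 by rewrite divr_gt0.
have [N1 N1P] := cvge0_lt ca e18; have [N2 N2P] := cvge0_lt cb e18.
have [N3 N3P] := cvge0_lt (trunc_cvg Lu) e18.
pose N := (N1 + N2 + N3)%N.
have /ltW h1 := N1P N (leq_trans (leq_addr N2 N1) (leq_addr N3 _)).
have /ltW h2 := N2P N (leq_trans (leq_addl N1 N2) (leq_addr N3 _)).
have /ltW h3 := N3P N (leq_addl _ _).
have it := intg_trunc N Lu; have Lt := L2_trunc N Lu.
have Lc := L2_fourc it Lt; have Ls := L2_fours it Lt.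
have k0 := sqn_le2 mu' (L2_meas Lt).
have k1 := plancherel_ge it Lt.
have k2 := sqn_le2 (L2_meas Lc) (L2_meas La); rewrite (sqnC a) in k2.
have k3 := sqn_le2 (L2_meas Ls) (L2_meas Lb); rewrite (sqnC b) in k3.
exact: (fourier_ge_arith (L2_fin La) (L2_fin Lb) (L2_fin Lu) (L2_fin Lt) (L2_fin Lc)
  (L2_fin Ls) (L2_fin (L2B Lc La)) (L2_fin (L2B Ls Lb)) (L2_fin (L2B Lt Lu)) k0 k1 k2 k3 h1 h2 h3).
Qed.

(** The transforms of the truncations to [-N, N] depend on u continuously in L2,
    uniformly in N, which allows the two limits to be exchanged.  The operator
    [F] is [fourc] or [fours]. *)
Lemma truncated_transform_closed (F : (R -> R) -> R -> R) (us as' : nat -> R -> R) u a :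
  (forall f, intg f -> L2 f -> L2 (F f)) ->
  (forall f g, intg f -> L2 f -> intg g -> L2 g ->
    (sqn (fun xi => F f xi - F g xi)%R <= sqn (fun x => f x - g x)%R)%E) ->
  (forall n, L2 (us n)) -> (forall n, L2 (as' n)) ->
  (forall n, cvg2 (fun N => F (trunc (us n) N)) (as' n)) ->
  L2 u -> L2 a -> cvg2 us u -> cvg2 as' a -> cvg2 (fun N => F (trunc u N)) a.
Proof.
move=> LF FB Lus Las cs Lu La cu ca; apply: cvge0P => [n|e e0]; first exact: sqn_ge0.
have e10 : 0 < e / 10 by rewrite divr_gt0.
have [N1 N1P] := cvge0_lt cu e10; have [N2 N2P] := cvge0_lt ca e10.
have /ltW h1 := N1P (N1 + N2)%N (leq_addr _ _).
have /ltW h2 := N2P (N1 + N2)%N (leq_addl _ _).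
set n := (N1 + N2)%N in h1 h2; have Lun := Lus n.
have [N NP] := cvge0_lt (cs n) e10; exists N => k /NP /ltW h3.
have it := intg_trunc k Lu; have Lt := L2_trunc k Lu.
have itn := intg_trunc k Lun; have Ltn := L2_trunc k Lun.
have Lc := LF _ it Lt; have Lcn := LF _ itn Ltn.
have g1 := sqn_dist (L2_meas Lc) (L2_meas Lcn) (L2_meas La).
have g2 := sqn_dist (L2_meas Lcn) (L2_meas (Las n)) (L2_meas La).
have g3 : (sqn (fun xi => F (trunc u k) xi - F (trunc (us n) k) xi)%R <=
    sqn (fun x => us n x - u x)%R)%E.
  apply: le_trans (FB _ _ it Lt itn Ltn) _; rewrite sqnC.
  rewrite (_ : (fun x => _) = trunc (fun x => us n x - u x) k).
    by apply: sqn_trunc; exact: L2_meas (L2B Lun Lu).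
  by apply/funext => x; rewrite /trunc mulrBr.
exact: (fourier_closed_arith (L2_fin (L2B Lc La)) (L2_fin (L2B Lc Lcn)) (L2_fin (L2B Lcn La))
  (L2_fin (L2B Lcn (Las n))) (L2_fin (L2B (Las n) La)) g1 g2 (le_trans g3 h1) h3 h2).
Qed.

(** The transform is a closed operator on L2; this is how limits of difference
    quotients become derivatives. *)
Lemma fourier_closed (us as' bs : nat -> R -> R) u a b :
  (forall n, is_fourier (us n) (as' n) (bs n)) -> L2 u -> L2 a -> L2 b ->
  cvg2 us u -> cvg2 as' a -> cvg2 bs b -> is_fourier u a b.
Proof.
move=> F Lu La Lb cu ca cb.
have Lus n : L2 (us n) by have [] := fourier_L2 (F n).
have Las n : L2 (as' n) by have [] := fourier_L2 (F n).
have Lbs n : L2 (bs n) by have [] := fourier_L2 (F n).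
apply/is_fourierP; split; [exact: Lu|exact: La|exact: Lb| |].
- apply: (truncated_transform_closed L2_fourc sqn_fourcB Lus Las _ Lu La cu ca) => n.
  by have /is_fourierP[] := F n.
- apply: (truncated_transform_closed L2_fours sqn_foursB Lus Lbs _ Lu Lb cu cb) => n.
  by have /is_fourierP[] := F n.
Qed.

Lemma fourierZ c u a b : is_fourier u a b ->
  is_fourier (fun x => c * u x) (fun xi => c * a xi) (fun xi => c * b xi).
Proof.
move=> /is_fourierP[Lu La Lb ca cb]; apply/is_fourierP; split; do ?exact: L2Z.
- have -> : (fun N => fourc (trunc (fun x => c * u x) N)) = (fun N xi => c * fourc (trunc u N) xi).
    apply/funext => N; apply/funext => xi; rewrite -(fourcZ c xi (intg_trunc N Lu)).
    by congr fourc; apply/funext => x; rewrite /trunc mulrCA.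
  by apply: cvg2Z => // [n|]; [apply: measurable_fourc; exact: intg_trunc|exact: L2_meas].
- have -> : (fun N => fours (trunc (fun x => c * u x) N)) = (fun N xi => c * fours (trunc u N) xi).
    apply/funext => N; apply/funext => xi; rewrite -(foursZ c xi (intg_trunc N Lu)).
    by congr fours; apply/funext => x; rewrite /trunc mulrCA.
  by apply: cvg2Z => // [n|]; [apply: measurable_fours; exact: intg_trunc|exact: L2_meas].
Qed.

Lemma fourierB u a b v c d : is_fourier u a b -> is_fourier v c d ->
  is_fourier (fun x => u x - v x) (fun xi => a xi - c xi) (fun xi => b xi - d xi).
Proof.
move=> /is_fourierP[Lu La Lb ca cb] /is_fourierP[Lv Lc Ld cc cd]; apply/is_fourierP.
split; do ?exact: L2B.
- have -> : (fun N => fourc (trunc (fun x => u x - v x) N)) =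
      (fun N xi => fourc (trunc u N) xi - fourc (trunc v N) xi).
    apply/funext => N; apply/funext => xi; rewrite -(fourcB xi (intg_trunc N Lu) (intg_trunc N Lv)).
    by congr fourc; apply/funext => x; rewrite /trunc mulrBr.
  by apply: cvg2B => // [n|n||]; do ?exact: L2_meas; apply: measurable_fourc; exact: intg_trunc.
- have -> : (fun N => fours (trunc (fun x => u x - v x) N)) =
      (fun N xi => fours (trunc u N) xi - fours (trunc v N) xi).
    apply/funext => N; apply/funext => xi; rewrite -(foursB xi (intg_trunc N Lu) (intg_trunc N Lv)).
    by congr fours; apply/funext => x; rewrite /trunc mulrBr.
  by apply: cvg2B => // [n|n||]; do ?exact: L2_meas; apply: measurable_fours; exact: intg_trunc.
Qed.

Lemma sqn_ae_eq u v : measurable_fun [set: R] u -> measurable_fun [set: R] v ->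
  {ae mu, forall x, u x = v x} -> sqn u = sqn v.
Proof.
move=> mu' mv uv; apply: ae_eq_integral => //; [exact: measurable_sqr|exact: measurable_sqr|].
by apply: ae_imp uv => x -> _.
Qed.

Lemma L2_ae_eq u v : measurable_fun [set: R] v -> {ae mu, forall x, u x = v x} -> L2 u -> L2 v.
Proof.
move=> mv uv /L2P[mu' uy]; apply/L2P; split => //.
by rewrite -(sqn_ae_eq mu' mv uv).
Qed.

Lemma fourier_ae_eq u v a b : measurable_fun [set: R] v ->
  {ae mu, forall x, u x = v x} -> is_fourier u a b -> is_fourier v a b.
Proof.
move=> mv uv /is_fourierP[Lu La Lb ca cb]; apply/is_fourierP.
have mt w N : measurable_fun [set: R] w -> measurable_fun [set: R] (trunc w N).
  by move=> mw; apply: measurable_funM => //; exact: measurable_ind.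
have mc xi : measurable_fun [set: R] (fun x : R => cos (x * xi)).
  rewrite (_ : (fun x => _) = fun x => cos (xi * x)); last by apply/funext => x; rewrite mulrC.
  by apply: continuous_measurable; exact: continuous_cosM.
have ms xi : measurable_fun [set: R] (fun x : R => sin (x * xi)).
  rewrite (_ : (fun x => _) = fun x => sin (xi * x)); last by apply/funext => x; rewrite mulrC.
  by apply: continuous_measurable; exact: continuous_sinM.
have mu' := L2_meas Lu.
split; [exact: L2_ae_eq mv uv Lu|exact: La|exact: Lb| |].
- rewrite (_ : (fun N => _) = (fun N => fourc (trunc u N))); first exact: ca.
  apply/funext => N; apply/funext => xi; congr (_ * _); apply: Rint_ae_eq.
  + exact: measurable_funM (mt _ _ mv) (mc xi).
  + exact: measurable_funM (mt _ _ mu') (mc xi).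
  + by apply: ae_imp uv => x; rewrite /trunc => ->.
- rewrite (_ : (fun N => _) = (fun N => fours (trunc u N))); first exact: cb.
  apply/funext => N; apply/funext => xi; congr (- (_ * _)); apply: Rint_ae_eq.
  + exact: measurable_funM (mt _ _ mv) (ms xi).
  + exact: measurable_funM (mt _ _ mu') (ms xi).
  + by apply: ae_imp uv => x; rewrite /trunc => ->.
Qed.

Lemma fourc_shift (h : R) f xi : intg f ->
  fourc (fun x => f (x + h)) xi = cos (h * xi) * fourc f xi - sin (h * xi) * fours f xi.
Proof.
move=> fi; have ic := intg_cosM xi fi; have is' := intg_sinM xi fi.
rewrite /fourc /fours.
have -> : \int[mu]_x (f (x + h) * cos (x * xi)) = \int[mu]_x (f x * cos ((x - h) * xi)).
  rewrite -(@Rint_shift _ h (fun x => f x * cos ((x - h) * xi))).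
    by apply: eq_Rint => x; rewrite addrK.
  apply: measurable_funM; first exact: intg_meas.
  apply: (measurableT_comp (continuous_measurable (@continuous_cos R))).
  by apply: measurable_funM => //; exact: measurable_shift.
have -> : \int[mu]_x (f x * cos ((x - h) * xi)) =
    \int[mu]_x (cos (h * xi) * (f x * cos (x * xi)) + sin (h * xi) * (f x * sin (x * xi))).
  by apply: eq_Rint => x; rewrite mulrBl cosB; ring.
by rewrite (RintD (intgZ _ ic) (intgZ _ is')) (RintZ _ ic) (RintZ _ is'); ring.
Qed.

Lemma fours_shift (h : R) f xi : intg f ->
  fours (fun x => f (x + h)) xi = sin (h * xi) * fourc f xi + cos (h * xi) * fours f xi.
Proof.
move=> fi; have ic := intg_cosM xi fi; have is' := intg_sinM xi fi.
rewrite /fourc /fours.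
have -> : \int[mu]_x (f (x + h) * sin (x * xi)) = \int[mu]_x (f x * sin ((x - h) * xi)).
  rewrite -(@Rint_shift _ h (fun x => f x * sin ((x - h) * xi))).
    by apply: eq_Rint => x; rewrite addrK.
  apply: measurable_funM; first exact: intg_meas.
  apply: (measurableT_comp (continuous_measurable (@continuous_sin R))).
  by apply: measurable_funM => //; exact: measurable_shift.
have -> : \int[mu]_x (f x * sin ((x - h) * xi)) =
    \int[mu]_x (cos (h * xi) * (f x * sin (x * xi)) - sin (h * xi) * (f x * cos (x * xi))).
  by apply: eq_Rint => x; rewrite mulrBl sinB; ring.
by rewrite (RintB (intgZ _ is') (intgZ _ ic)) (RintZ _ ic) (RintZ _ is'); ring.
Qed.

Lemma cvg2_Mb (k : R -> R) (fs : nat -> R -> R) f : measurable_fun [set: R] k ->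
  (forall x, `|k x| <= 1) -> (forall n, measurable_fun [set: R] (fs n)) ->
  measurable_fun [set: R] f -> cvg2 fs f ->
  cvg2 (fun n x => k x * fs n x) (fun x => k x * f x).
Proof.
move=> mk k1 mfs mf; apply: squeeze0 => n; first exact: sqn_ge0.
apply: sqn_le.
- by apply: measurable_funB; exact: measurable_funM.
- exact: measurable_funB.
- by move=> x; rewrite -mulrBr normrM -[leRHS]mul1r ler_wpM2r.
Qed.

Lemma cvg2_trans_dist (fs gs : nat -> R -> R) f : (forall n, measurable_fun [set: R] (fs n)) ->
  (forall n, measurable_fun [set: R] (gs n)) -> measurable_fun [set: R] f ->
  sqn (fun x => gs n x - fs n x) @[n --> \oo] --> 0%E -> cvg2 fs f -> cvg2 gs f.
Proof.
move=> mfs mgs mf d ff; apply: squeeze0 (cvge0D 2 d ff) => n; first exact: sqn_ge0.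
exact: sqn_dist.
Qed.

(** Translation by h acts as the phase exp(i h xi).  It does not commute with
    truncation to [-N, N], but the error vanishes in L2 as N grows. *)
Lemma fourier_shift (h : R) u a b : is_fourier u a b ->
  is_fourier (fun x => u (x + h))
    (fun xi => cos (h * xi) * a xi - sin (h * xi) * b xi)
    (fun xi => sin (h * xi) * a xi + cos (h * xi) * b xi).
Proof.
move=> /is_fourierP[Lu La Lb ca cb]; apply/is_fourierP.
have mu' := L2_meas Lu; have ma := L2_meas La; have mb := L2_meas Lb.
have mc := continuous_measurable (@continuous_cosM R h).
have ms := continuous_measurable (@continuous_sinM R h).
have cbd x : `|cos (h * x)| <= 1 :> R by exact: cos_bound.
have sbd x : `|sin (h * x)| <= 1 :> R by exact: sin_bound.
have it N := intg_trunc N Lu; have Lt N := L2_trunc N Lu.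
have mfc N := measurable_fourc (it N); have mfs N := measurable_fours (it N).
have Luh := L2_shift h Lu.
have ish N := intg_shift h (it N); have Lsh N := L2_shift h (Lt N).
have its N := intg_trunc N Luh; have Lts N := L2_trunc N Luh.
have d0 : sqn (fun x => trunc (fun y => u (y + h)) n x - trunc u n (x + h)) @[n --> \oo] --> 0%E.
  have c1 := trunc_cvg Luh.
  have c2 : sqn (fun x => u (x + h) - trunc u n (x + h)) @[n --> \oo] --> 0%E.
    apply: squeeze0 (trunc_cvg Lu) => n; first exact: sqn_ge0.
    rewrite sqnC; apply: eq_le_of.
    rewrite -[RHS](@sqn_shift _ h (fun x => trunc u n x - u x))//.
    exact: measurable_funB (L2_meas (Lt n)) mu'.
  apply: squeeze0 (cvge0D 2 c1 c2) => n; first exact: sqn_ge0.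
  apply: (@sqn_dist _ _ (fun x => u (x + h))); [exact: L2_meas (Lts n)|exact: L2_meas|exact: L2_meas (Lsh n)].
split => //.
- by apply: L2B; [exact: L2Mb mc cbd La|exact: L2Mb ms sbd Lb].
- by apply: L2D; [exact: L2Mb ms sbd La|exact: L2Mb mc cbd Lb].
- apply: (@cvg2_trans_dist (fun N => fourc (fun x => trunc u N (x + h)))).
  + by move=> N; exact: measurable_fourc.
  + by move=> N; exact: measurable_fourc.
  + by apply: measurable_funB; exact: measurable_funM.
  + by apply: squeeze0 d0 => n; [exact: sqn_ge0|exact: sqn_fourcB].
  + rewrite (_ : (fun N => _) = (fun N xi => cos (h * xi) * fourc (trunc u N) xi - sin (h * xi) * fours (trunc u N) xi)); last first.
      by apply/funext => N; apply/funext => xi; exact: fourc_shift.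
    apply: cvg2B; do ?by move=> *; exact: measurable_funM.
      exact: cvg2_Mb.
    exact: cvg2_Mb.
- apply: (@cvg2_trans_dist (fun N => fours (fun x => trunc u N (x + h)))).
  + by move=> N; exact: measurable_fours.
  + by move=> N; exact: measurable_fours.
  + by apply: measurable_funD; exact: measurable_funM.
  + by apply: squeeze0 d0 => n; [exact: sqn_ge0|exact: sqn_foursB].
  + rewrite (_ : (fun N => _) = (fun N xi => sin (h * xi) * fourc (trunc u N) xi + cos (h * xi) * fours (trunc u N) xi)); last first.
      by apply/funext => N; apply/funext => xi; exact: fours_shift.
    apply: cvg2D; do ?by move=> *; exact: measurable_funM.
      exact: cvg2_Mb.
    exact: cvg2_Mb.
Qed.

End FourierPlancherel.

(** * Regularity of the half Laplacian *)

Section HalfLaplacianRegularity.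
Context {R : realType}.
Notation mu := (@lebesgue_measure R).
Implicit Types (f g h u v w a b phi : R -> R) (x xi : R).

(** The multiplier of the symmetric quotient, i sin(h xi) / h, is purely
    imaginary, so it only exchanges the two real components of a transform;
    that of the one-sided quotient would mix them. *)
Definition sym_quot (h : R) u x : R := (2 * h)^-1 * (u (x + h) - u (x - h)).

Definition step (n : nat) : R := n.+1%:R^-1.

Lemma step_gt0 n : 0 < step n.
Proof. by rewrite invr_gt0. Qed.

Lemma step_le1 n : step n <= 1.
Proof. by rewrite invf_le1// ler1n. Qed.

Lemma step_cvg : step n @[n --> \oo] --> (0 : R).
Proof. exact: cvg_harmonic. Qed.

Lemma Rint_ind (p q : R) : p <= q -> \int[mu]_x ind p q x = q - p.
Proof.
move=> pq; have := (AC_C1 (f := fun x => x) (g := cst 1) (fun x => is_derive_id x (1:R)) (fun x => @cvg_cst _ _ _ _ _)).2 p q pq.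
by rewrite Rint_itvE => ->; apply: eq_Rint => x; rewrite mulr1.
Qed.

Lemma intg_norm f : intg f -> intg (fun x => `|f x|).
Proof.
by move=> fi; apply: (intg_le _ fi) => [|x]; [apply: measurableT_comp => //; exact: intg_meas|rewrite normr_id].
Qed.

Lemma AC_lipschitz f g (C : R) : AC f g -> (forall x, `|g x| <= C) ->
  forall p q, p <= q -> `|f q - f p| <= C * (q - p).
Proof.
move=> [lg fg] gC p q pq; rewrite fg// Rint_itvE -(Rint_ind pq).
have Ig := locint_ind p q lg.
apply: le_trans (le_normr_Rintegral measurableT Ig) _.
rewrite -(RintZ _ (intg_ind p q)); apply: le_Rintegral => //.
- exact: intg_norm Ig.
- exact: intgZ (intg_ind p q).
- by move=> x _; rewrite normrM ger0_norm ?ind_ge0// mulrC ler_wpM2r ?ind_ge0.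
Qed.

Lemma sym_quot_bound f g (C h : R) x : AC f g -> (forall x, `|g x| <= C) -> 0 < h ->
  `|sym_quot h f x| <= C.
Proof.
move=> fg gC h0; have h2 : 0 < 2 * h by rewrite mulr_gt0.
have xx : x - h <= x + h by lra.
rewrite /sym_quot normrM gtr0_norm ?invr_gt0// ler_pdivrMl//.
apply: le_trans (AC_lipschitz fg gC xx) _.
by apply: eq_le_of; ring.
Qed.

Lemma sym_quot_cvg f x (l : R) : is_derive x (1 : R) f l ->
  sym_quot (step n) f x @[n --> \oo] --> l.
Proof.
move=> [df dl].
have D0 : (k^-1 * (f (k + x) - f x)) @[k --> 0^'] --> l.
  have h : (k^-1 *: (f (k *: (1 : R) + x) - f x)) @[k --> 0^'] --> l.
    by rewrite -dl; exact: df.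
  apply: cvg_trans h; apply: near_eq_cvg; apply: nearW => k.
  by rewrite [k *: _]mulr1.
have c1 : (step n)^-1 * (f (step n + x) - f x) @[n --> \oo] --> l.
  have := (cvgr_dnbhsP _ _ _).1 D0 step.
  apply.
  by split => [n|]; [rewrite gt_eqF ?step_gt0|exact: step_cvg].
have c2 : (- step n)^-1 * (f (- step n + x) - f x) @[n --> \oo] --> l.
  have := (cvgr_dnbhsP _ _ _).1 D0 (fun n => - step n).
  apply.
  split => [n|]; first by rewrite oppr_eq0 gt_eqF ?step_gt0.
  by rewrite -[X in _ --> X]oppr0; apply: cvgN; exact: step_cvg.
have -> : l = 2^-1 * (l + l) by field.
apply: cvg_trans (cvgM (cvg_cst (2^-1 : R)) (cvgD c1 c2)); apply: near_eq_cvg; apply: nearW => n.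
rewrite /sym_quot /= (addrC x) (addrC x).
change (2^-1 * ((step n)^-1 * (f (step n + x) - f x) + (- step n)^-1 * (f (- step n + x) - f x)) =
  (2 * step n)^-1 * (f (step n + x) - f (- step n + x))).
by field; rewrite gt_eqF ?step_gt0.
Qed.

(** The multiplier of [sym_quot h], divided by i. *)
Definition sinc_mult (h xi : R) : R := h^-1 * sin (h * xi).

Lemma sinc_multE (h xi : R) : h != 0 -> sinc_mult h xi = sym_quot h (fun t => sin (xi * t)) 0.
Proof.
move=> h0; rewrite /sym_quot /sinc_mult add0r sub0r mulrN sinN opprK (mulrC xi).
by field.
Qed.

Lemma derive_sinM xi (t : R) : is_derive t (1 : R) (fun t => sin (xi * t)) (cos (xi * t) * xi).
Proof. exact: derive_comp (derive_lin xi t). Qed.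

Lemma sinc_mult_bound n xi : `|sinc_mult (step n) xi| <= `|xi|.
Proof.
rewrite sinc_multE ?gt_eqF ?step_gt0//.
apply: (@sym_quot_bound _ (fun t => cos (xi * t) * xi)); last exact: step_gt0.
- apply: AC_C1 => [t|]; first exact: derive_sinM.
  by move=> t; apply: cvgM; [exact: continuous_cosM|exact: cvg_cst].
- by move=> t; rewrite normrM -[leRHS]mul1r ler_wpM2r// cos_bound.
Qed.

Lemma sinc_mult_cvg xi : sinc_mult (step n) xi @[n --> \oo] --> xi.
Proof.
have := sym_quot_cvg (derive_sinM xi 0).
rewrite mulr0 cos0 mul1r; under eq_fun do rewrite -sinc_multE ?gt_eqF ?step_gt0//.
exact.
Qed.

Lemma measurable_sinc_mult (h : R) : measurable_fun [set: R] (sinc_mult h).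
Proof.
apply: measurable_funM => //; apply: continuous_measurable; exact: continuous_sinM.
Qed.

(** The difference of [fourier_shift] at h and at - h, in which the cosines
    cancel. *)
Lemma fourier_sym_quot (h : R) u a b : 0 < h -> is_fourier u a b ->
  is_fourier (sym_quot h u) (fun xi => - (sinc_mult h xi * b xi))
    (fun xi => sinc_mult h xi * a xi).
Proof.
move=> h0 F; have hn : h != 0 by rewrite gt_eqF.
have := fourierZ (2 * h)^-1 (fourierB (fourier_shift h F) (fourier_shift (- h) F)).
congr is_fourier; apply/funext => xi; rewrite /sinc_mult ?mulNr ?cosN ?sinN; field; exact: hn.
Qed.

(** The quotient is the mean of u' over [x - h, x + h], and the square of a mean
    is at most the mean of the squares, since the variance is nonnegative. *)
Lemma sym_quot_sqr u u1 (h : R) x : AC u u1 -> L2 u1 -> 0 < h ->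
  (sym_quot h u x) ^+ 2 <= \int[mu]_y (u1 y ^+ 2 * ((2 * h)^-1 * ind (- h) h (x - y))).
Proof.
move=> [lu1 uu1] Lu1 h0; have xx : x - h <= x + h by lra.
have h2 : 0 < 2 * h by rewrite mulr_gt0.
have I1 := locint_ind (x - h) (x + h) lu1.
have I2 : intg (fun y => ind (x - h) (x + h) y * u1 y ^+ 2).
  exact: intgMb (measurable_ind _ _) (ind_bound _ _) (L2_sqr_intg Lu1).
have I0 := intg_ind (x - h) (x + h).
rewrite /sym_quot uu1// Rint_itvE.
have E : \int[mu]_y (u1 y ^+ 2 * ((2 * h)^-1 * ind (- h) h (x - y))) =
    (2 * h)^-1 * \int[mu]_y (ind (x - h) (x + h) y * u1 y ^+ 2).
  rewrite -(RintZ _ I2); apply: eq_Rint => y; rewrite mulrCA; congr (_ * _).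
  rewrite mulrC !indE; congr (_%:R * _); congr (nat_of_bool _).
  by apply/andP/andP => -[? ?]; split; lra.
rewrite E; set J := \int[mu]_y (_ * u1 y); set Q := \int[mu]_y (_ * u1 y ^+ 2).
pose m := (2 * h)^-1 * J.
have : 0 <= \int[mu]_y (ind (x - h) (x + h) y * (u1 y - m) ^+ 2).
  by apply: Rintegral_ge0 => y _; rewrite mulr_ge0 ?ind_ge0 ?sqr_ge0.
have -> : \int[mu]_y (ind (x - h) (x + h) y * (u1 y - m) ^+ 2) = Q - 2 * m * J + m ^+ 2 * (2 * h).
  transitivity (\int[mu]_y ((ind (x - h) (x + h) y * u1 y ^+ 2 -
      2 * m * (ind (x - h) (x + h) y * u1 y)) + m ^+ 2 * ind (x - h) (x + h) y)).
    by apply: eq_Rint => y; ring.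
  rewrite (RintD (intgB I2 (intgZ _ I1)) (intgZ _ I0)) (RintB I2 (intgZ _ I1)).
  by rewrite (RintZ _ I1) (RintZ _ I0) (Rint_ind xx); congr (_ + _ * _); ring.
have -> : J = 2 * h * m by rewrite /m mulrA divff ?mul1r// gt_eqF.
rewrite mulKf ?gt_eqF// => q0; rewrite ler_pdivlMl//.
by move: q0; rewrite !expr2; lra.
Qed.

(** Averaging over [x - h, x + h] is convolution with a kernel of mass 1, which
    by [conv_mass] preserves the integral of the square of u'. *)
Lemma sqn_sym_quot u u1 (h : R) : AC u u1 -> L2 u1 -> L2 u -> 0 < h ->
  (sqn (sym_quot h u) <= sqn u1)%E.
Proof.
move=> uu1 Lu1 Lu h0; have h2 : 0 < 2 * h by rewrite mulr_gt0.
have LD : L2 (sym_quot h u) by apply: L2Z; apply: L2B; exact: L2_shift.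
have I0 := intg_ind (- h) h.
have [|||||I E] := @conv_mass _ (fun z => (2 * h)^-1 * ind (- h) h z) (2 * h)^-1 (fun y => u1 y ^+ 2).
- exact: intgZ.
- by move=> z; rewrite mulr_ge0 ?invr_ge0 ?(ltW h2) ?ind_ge0.
- move=> z; rewrite ler_piMr ?invr_ge0 ?(ltW h2)//.
  by have := ind_bound (- h) h z; rewrite ger0_norm ?ind_ge0.
- exact: L2_sqr_intg.
- by move=> x; exact: sqr_ge0.
have hh : - h <= h by lra.
move: E; rewrite (RintZ _ I0) (Rint_ind hh) => E.
rewrite (sqn_fin LD) (sqn_fin Lu1) lee_fin.
have -> : \int[mu]_x u1 x ^+ 2 = \int[mu]_x \int[mu]_y (u1 y ^+ 2 * ((2 * h)^-1 * ind (- h) h (x - y))).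
  by rewrite E; have -> : (2 * h)^-1 * (h - - h) = 1; [field; rewrite gt_eqF|rewrite mulr1].
apply: le_Rintegral => //; [exact: L2_sqr_intg LD|].
by move=> x _; exact: sym_quot_sqr.
Qed.

Lemma measurable_identity : measurable_fun [set: R] (fun x : R => x).
Proof. exact: measurable_id. Qed.

Lemma sinc_mult_aecvg (a : R -> R) :
  {ae mu, forall x, sinc_mult (step n) x * a x @[n --> \oo] --> x * a x}.
Proof. by apply: aeW => x; apply: cvgM; [exact: sinc_mult_cvg|exact: cvg_cst]. Qed.

Lemma sqn_multiplier_le (a : R -> R) (C : \bar R) : measurable_fun [set: R] a ->
  (forall n, sqn (fun xi => sinc_mult (step n) xi * a xi)%R <= C)%E ->
  (C < +oo)%E -> L2 (fun xi => xi * a xi).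
Proof.
move=> ma aC Cy; have mxa : measurable_fun [set: R] (fun xi => xi * a xi) by exact: measurable_funM measurable_identity ma.
apply/L2P; split => //; apply: le_lt_trans Cy.
apply: (sqn_fatou (hs := fun n xi => sinc_mult (step n) xi * a xi)) => //.
- by move=> n; exact: measurable_funM (measurable_sinc_mult _) ma.
- exact: sinc_mult_aecvg.
Qed.

(** The symmetric quotients are bounded in L2 uniformly in the step, hence so
    are their transforms, and Fatou's lemma passes to the limit xi of the
    multipliers. *)
Lemma fourier_derivative_L2 u u1 a b : AC u u1 -> L2 u1 -> is_fourier u a b ->
  L2 (fun xi => xi * a xi) /\ L2 (fun xi => xi * b xi).
Proof.
move=> uu1 Lu1 F; have [Lu La Lb] := fourier_L2 F.
have Cy : (2%:E * sqn u1 < +oo)%E by rewrite lte_mul_pinfty// L2_lty.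
have B n : (sqn (fun xi => sinc_mult (step n) xi * a xi)%R <= 2%:E * sqn u1 /\
    sqn (fun xi => sinc_mult (step n) xi * b xi)%R <= 2%:E * sqn u1)%E.
  have s0 := step_gt0 n; have [h1 h2] := fourier_le (fourier_sym_quot s0 F).
  have le : (2%:E * sqn (sym_quot (step n) u) <= 2%:E * sqn u1)%E.
    by apply: lee_wpmul2l => //; exact: sqn_sym_quot.
  by split; [exact: le_trans h2 le|rewrite -sqnN; exact: le_trans h1 le].
split; (apply: sqn_multiplier_le Cy; [exact: L2_meas|by move=> n; case: (B n)]).
Qed.

Lemma cvg2_cauchy (fs : nat -> R -> R) f : (forall n, measurable_fun [set: R] (fs n)) ->
  measurable_fun [set: R] f -> cvg2 fs f ->
  forall e : R, 0 < e -> exists N : nat, forall n m, (N <= n)%N -> (N <= m)%N ->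
    (sqn (fun x => fs n x - fs m x)%R <= e%:E)%E.
Proof.
move=> mfs mf ff e e0; have e4 : 0 < e / 4 by rewrite divr_gt0.
have [N NP] := cvge0_lt ff e4; exists N => n m /NP/ltW hn /NP/ltW hm.
apply: le_trans (sqn_dist (mfs n) mf (mfs m)) _.
rewrite (sqnC f); apply: (@le_trans _ _ (2%:E * (e / 4)%:E + 2%:E * (e / 4)%:E)%E).
  by apply: leeD; apply: lee_wpmul2l.
by rewrite -!EFinM -EFinD lee_fin; lra.
Qed.

Lemma cvg2N (fs : nat -> R -> R) f : cvg2 fs f -> cvg2 (fun n x => - fs n x) (fun x => - f x).
Proof.
rewrite /cvg2 => h; apply: squeeze0 h => n; first exact: sqn_ge0.
rewrite -sqnN; apply: eq_le_of; congr sqn.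
by apply/funext => x; rewrite opprB opprK addrC.
Qed.

Lemma sinc_mult_cvg2 (a : R -> R) : measurable_fun [set: R] a -> L2 (fun xi => xi * a xi) ->
  cvg2 (fun n xi => sinc_mult (step n) xi * a xi) (fun xi => xi * a xi).
Proof.
move=> ma La; apply: (sqn_dominated (g := fun xi => 2 * (xi * a xi))).
- by move=> n; exact: measurable_funM (measurable_sinc_mult _) ma.
- exact: L2_meas.
- exact: sinc_mult_aecvg.
- exact: L2Z.
- move=> n x; rewrite -mulrBl mulrA !normrM ler_wpM2r// (ger0_norm (_ : 0 <= 2))//.
  apply: le_trans (ler_normB _ _) _; have := sinc_mult_bound n x; lra.
Qed.

Lemma Rint_cvg2 (fs : nat -> R -> R) f g : (forall n, L2 (fs n)) -> L2 f -> L2 g ->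
  cvg2 fs f -> \int[mu]_x (fs n x * g x) @[n --> \oo] --> \int[mu]_x (f x * g x).
Proof.
move=> Lfs Lf Lg ff; apply/cvgrPdist_le => /= e e0.
pose G : R := \int[mu]_x (g x ^+ 2).
have G0 : 0 <= G by apply: Rintegral_ge0 => x _; exact: sqr_ge0.
(* |int d g| <= int (d^2 / s + s g^2) / 2 for every s > 0 *)
pose s := e / (G + 1).
have s0 : 0 < s by rewrite divr_gt0// ltr_wpDl.
have es0 : 0 < e * s by rewrite mulr_gt0.
have [N NP] := cvge0_lt ff es0; near=> n.
have /NP : (N <= n)%N by near: n; exact: nbhs_infty_ge.
have Ld := L2B (Lfs n) Lf; have Id := L2_sqr_intg Ld; have Ig := L2_sqr_intg Lg.
rewrite (sqn_fin Ld) lte_fin => /ltW h.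
rewrite distrC -(RintB (L2M_intg (Lfs n) Lg) (L2M_intg Lf Lg)).
have Idg : intg (fun x => fs n x * g x - f x * g x).
  exact: intgB (L2M_intg (Lfs n) Lg) (L2M_intg Lf Lg).
apply: le_trans (le_normr_Rintegral measurableT Idg) _.
apply: (@le_trans _ _ (\int[mu]_x ((2 * s)^-1 * (fs n x - f x) ^+ 2 + (s / 2) * g x ^+ 2))).
  apply: le_Rintegral => //.
  - exact: intg_norm Idg.
  - exact: intgD (intgZ _ Id) (intgZ _ Ig).
  - move=> x _; rewrite -mulrBl normrM; set d := fs n x - f x.
    have k : 0 <= (2 * s)^-1 * (`|d| - s * `|g x|) ^+ 2.
      by rewrite mulr_ge0 ?sqr_ge0// invr_ge0 mulr_ge0 ?(ltW s0).
    rewrite -subr_ge0; apply: le_trans k _; apply: eq_le_of.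
    rewrite -(real_normK (num_real d)) -(real_normK (num_real (g x))).
    by field; rewrite gt_eqF.
rewrite (RintD (intgZ _ Id) (intgZ _ Ig)) (RintZ _ Id) (RintZ _ Ig) -/G.
have h1 : (2 * s)^-1 * \int[mu]_x (fs n x - f x) ^+ 2 <= e / 2.
  have -> : e / 2 = (2 * s)^-1 * (e * s) by field; rewrite gt_eqF.
  by apply: ler_wpM2l => //; rewrite invr_ge0 mulr_ge0 ?(ltW s0).
have h2 : s / 2 * G <= e / 2.
  rewrite mulrAC ler_pM2r ?invr_gt0// /s mulrAC ler_pdivrMr ?ltr_wpDl//.
  by apply: ler_wpM2l; [exact: ltW|rewrite lerDl].
by rewrite (splitr e) lerD.
Unshelve. all: by end_near.
Qed.

Lemma L2_sym_quot (h : R) u : L2 u -> L2 (sym_quot h u).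
Proof. by move=> Lu; apply: L2Z; apply: L2B; exact: L2_shift. Qed.

Lemma Rint_sym_quot (h : R) u v : L2 u -> L2 v ->
  \int[mu]_x (sym_quot h u x * v x) = - \int[mu]_x (u x * sym_quot h v x).
Proof.
move=> Lu Lv; have I (k : R) (f g : R -> R) : L2 f -> L2 g -> intg (fun x => f (x + k) * g x).
  by move=> Lf Lg; apply: L2M_intg => //; exact: L2_shift.
have T (k : R) : \int[mu]_x (u (x + k) * v x) = \int[mu]_x (v (x - k) * u x).
  have := @Rint_shift _ k (fun x => v (x - k) * u x) (intg_meas (I (- k) _ _ Lv Lu)).
  by move=> <-; apply: eq_Rint => x; rewrite addrK mulrC.
have T' (k : R) : \int[mu]_x (u (x - k) * v x) = \int[mu]_x (v (x + k) * u x).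
  by rewrite T opprK.
rewrite /sym_quot.
transitivity (\int[mu]_x ((2 * h)^-1 * (u (x + h) * v x - u (x - h) * v x))).
  by apply: eq_Rint => x; ring.
rewrite (RintZ _ (intgB (I h _ _ Lu Lv) (I (- h) _ _ Lu Lv))) (RintB (I h _ _ Lu Lv) (I (- h) _ _ Lu Lv)).
rewrite T T'.
transitivity (- \int[mu]_x ((2 * h)^-1 * (v (x + h) * u x - v (x - h) * u x))); last first.
  by congr (- _); apply: eq_Rint => x; ring.
rewrite (RintZ _ (intgB (I h _ _ Lv Lu) (I (- h) _ _ Lv Lu))) (RintB (I h _ _ Lv Lu) (I (- h) _ _ Lv Lu)).
by ring.
Qed.

Lemma test_function_L2 phi : test_function phi -> L2 phi.
Proof.
move=> tphi; have [M M0 phi0] := test_function_support tphi.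
have cphi := test_function_continuous tphi.
have [C C0 phiC] := continuous_bounded_itv (- M) M cphi.
apply: (L2_le (g := fun x => C * ind (- M) M x)); first exact: continuous_measurable.
  by apply: L2Z; exact: L2_ind.
move=> x; rewrite normrM (ger0_norm (ltW C0)) indE.
have [xM|xM] := boolP (- M <= x <= M); first by rewrite normr1 mulr1 phiC.
rewrite phi0 ?normr0 ?mulr0//; move: xM; apply: contraNT; rewrite -ltNge => xM.
by have := ltW xM; rewrite ler_norml.
Qed.

Lemma test_function_bounded phi : test_function phi ->
  exists2 C : R, 0 < C & forall x, `|phi x| <= C.
Proof.
move=> tphi; have [M M0 phi0] := test_function_support tphi.
have [C C0 phiC] := continuous_bounded_itv (- M) M (test_function_continuous tphi).
exists C => // x; have [xM|xM] := leP M `|x|; first by rewrite phi0 // normr0 ltW.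
by apply: phiC; rewrite -ler_norml ltW.
Qed.

Lemma sym_quot_test_cvg2 phi : test_function phi ->
  cvg2 (fun n => sym_quot (step n) phi) (derive1 phi).
Proof.
move=> tphi; have tphi' := test_function_derive1 tphi.
have [M1 M10 phi01] := test_function_support tphi.
have [M2 M20 phi02] := test_function_support tphi'.
pose M := M1 + M2.
have phi0 x : M <= `|x| -> phi x = 0 by move=> Mx; apply: phi01; rewrite /M in Mx; lra.
have d0 x : M <= `|x| -> derive1 phi x = 0 by move=> Mx; apply: phi02; rewrite /M in Mx; lra.
have [C C0 dC] := test_function_bounded tphi'.
have Lphi := test_function_L2 tphi; have Ldphi := test_function_L2 tphi'.
have dphi x := smooth_is_derive x tphi.1.
have A : AC phi (derive1 phi) by apply: AC_C1 => //; exact: test_function_continuous tphi'.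
apply: (sqn_dominated (g := fun x => 2 * C * ind (- (M + 1)) (M + 1) x)).
- by move=> n; exact: L2_meas (L2_sym_quot _ Lphi).
- exact: L2_meas.
- by apply: aeW => x; exact: sym_quot_cvg.
- by apply: L2Z; exact: L2_ind.
move=> n x; rewrite normrM (ger0_norm (_ : 0 <= 2 * C)) ?mulr_ge0 ?(ltW C0)// indE.
have [xM|xM] := boolP (- (M + 1) <= x <= M + 1).
  rewrite normr1 mulr1; apply: le_trans (ler_normB _ _) _.
  by have := sym_quot_bound x A dC (step_gt0 n); have := dC x; lra.
have Mx : M + 1 < `|x|.
  by rewrite ltNge; move: xM; apply: contraNN; rewrite ler_norml.
have s1 := step_le1 n; have s0 := step_gt0 n.
rewrite normr0 mulr0 d0 ?subr0; last by lra.
rewrite /sym_quot !phi0 ?subrr ?mulr0 ?normr0//.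
- by move: Mx; case: (ger0P x); case: (ger0P (x - step n)); lra.
- by move: Mx; case: (ger0P x); case: (ger0P (x + step n)); lra.
Qed.

(** Converse of [fourier_derivative_L2]: the symmetric quotients of u are Cauchy
    in L2 because their transforms are, and testing against smooth functions
    identifies their limit with the weak derivative. *)
Lemma fourier_weak_derivative u a b : is_fourier u a b ->
  L2 (fun xi => xi * a xi) -> L2 (fun xi => xi * b xi) ->
  exists2 u1, weak_derivative 1 u u1 &
    is_fourier u1 (fun xi => - (xi * b xi)) (fun xi => xi * a xi).
Proof.
move=> F Lxa Lxb; have [Lu La Lb] := fourier_L2 F.
have FD n := fourier_sym_quot (step_gt0 n) F.
have ca := sinc_mult_cvg2 (L2_meas La) Lxa.
have cb := cvg2N (sinc_mult_cvg2 (L2_meas Lb) Lxb).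
have LD n : L2 (sym_quot (step n) u) := L2_sym_quot (step n) Lu.
have ma n : measurable_fun [set: R] (fun xi => sinc_mult (step n) xi * a xi).
  by have [_ _ /L2_meas] := fourier_L2 (FD n).
have mb n : measurable_fun [set: R] (fun xi => - (sinc_mult (step n) xi * b xi)).
  by have [_ /L2_meas] := fourier_L2 (FD n).
have [u1 Lu1 cu] : exists2 u1, L2 u1 & cvg2 (fun n => sym_quot (step n) u) u1.
  apply: L2_complete => // e e0; have e32 : 0 < e / 32 by rewrite divr_gt0.
  have [N1 N1P] := cvg2_cauchy ma (L2_meas Lxa) ca e32.
  have [N2 N2P] := cvg2_cauchy mb (L2_meas (L2N Lxb)) cb e32.
  exists (N1 + N2)%N => n m hn hm.
  apply: le_trans (fourier_ge (fourierB (FD n) (FD m))) _.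
  apply: (@le_trans _ _ (16%:E * ((e / 32)%:E + (e / 32)%:E))%E).
    apply: lee_wpmul2l => //; apply: leeD.
      by apply: N2P; exact: leq_trans (leq_addl N1 N2) _.
    by apply: N1P; exact: leq_trans (leq_addr N2 N1) _.
  by rewrite -EFinD -EFinM lee_fin; lra.
exists u1; last exact: fourier_closed FD Lu1 (L2N Lxb) Lxa cu cb ca.
split; [exact: L2_locint|exact: L2_locint|] => phi tphi.
rewrite expr1 mulN1r.
have tphi' := test_function_derive1 tphi.
have c1 := Rint_cvg2 LD Lu1 (test_function_L2 tphi) cu.
have c2 : \int[mu]_x (sym_quot (step n) phi x * u x) @[n --> \oo] --> \int[mu]_x (derive1 phi x * u x).
  apply: Rint_cvg2 => //; [|exact: test_function_L2|exact: sym_quot_test_cvg2].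
  by move=> n; apply: L2_sym_quot; exact: test_function_L2.
have c3 : \int[mu]_x (sym_quot (step n) u x * phi x) @[n --> \oo] --> - \int[mu]_x (derive1 phi x * u x).
  apply: cvg_trans (cvgN c2); apply: near_eq_cvg; apply: nearW => n.
  rewrite (Rint_sym_quot _ Lu (test_function_L2 tphi)); congr (- _).
  by apply: eq_Rint => x; rewrite mulrC.
rewrite (cvg_unique (@norm_hausdorff _ R) c1 c3) opprK.
by apply: eq_Rint => x; rewrite mulrC derive1n1.
Qed.

(** The Sobolev class H^k, for functions that are absolutely continuous
    themselves, and not merely almost everywhere equal to such a function, and
    whose derivatives below order k are so as well. *)
Fixpoint Sob (k : nat) f : Prop :=
  if k is k'.+1 then L2 f /\ exists2 g, AC f g & Sob k' g else L2 f.

Lemma SobS k f : Sob k.+1 f <-> L2 f /\ exists2 g, AC f g & Sob k g.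
Proof. by []. Qed.

Lemma Sob_L2 k f : Sob k f -> L2 f.
Proof. by case: k => [|k] // []. Qed.

(** The half Laplacian loses one derivative.  As xi and |xi| have the same
    modulus, w has a derivative in L2 as soon as u has two; and this derivative
    is the half Laplacian of u', because multipliers commute.  So induction
    applies to u'. *)
Lemma half_laplacian_Sob k u a b w : Sob k.+1 u -> is_fourier u a b ->
  is_fourier w (fun xi => `|xi| * a xi) (fun xi => `|xi| * b xi) ->
  exists2 w', {ae mu, forall x, w x = w' x} & Sob k w'.
Proof.
elim: k u a b w => [|k IH] u a b w Su Fu Fw.
  by exists w; [exact: aeW|have [] := fourier_L2 Fw].
have [Lu [u1 uu1 Su1]] := (SobS k.+1 u).1 Su; have Lu1 := Sob_L2 Su1.
have [Lxa Lxb] := fourier_derivative_L2 uu1 Lu1 Fu.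
have [u1' wu1' Fu1'] := fourier_weak_derivative Fu Lxa Lxb.
have Fu1 := fourier_ae_eq (L2_meas Lu1) (weak_derivative_uniq wu1' (AC_weak uu1)) Fu1'.
have [_ [u2 u12 Su2]] := (SobS k u1).1 Su1.
have [Lxxb Lxxa] := fourier_derivative_L2 u12 (Sob_L2 Su2) Fu1.
have [Lw Law Lbw] := fourier_L2 Fw.
have M (c : R -> R) : L2 (fun xi => `|xi| * c xi) -> L2 (fun xi => xi * (xi * c xi)) ->
    L2 (fun xi => xi * (`|xi| * c xi)).
  move=> L1 L3; apply: (L2_le _ L3).
    exact: measurable_funM measurable_identity (L2_meas L1).
  by move=> x; rewrite !normrM normr_id.
have Lxwa := M a Law Lxxa.
have Lxwb : L2 (fun xi => xi * (`|xi| * b xi)).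
  apply: (M b Lbw); have := L2N Lxxb; congr L2.
  by apply/funext => x; rewrite mulrN opprK.
have [w1 ww1 Fw1] := fourier_weak_derivative Fw Lxwa Lxwb.
have [w1' w1w1' Sw1'] : exists2 w', {ae mu, forall x, w1 x = w' x} & Sob k w'.
  apply: (IH u1 _ _ w1 Su1 Fu1); move: Fw1; congr is_fourier; apply/funext => x.
    by rewrite mulrN mulrCA.
  by rewrite mulrCA.
have [f fw1 wf] := weak_derivative_AC ww1.
have fw1' := AC_ae fw1 (L2_locint (Sob_L2 Sw1')) w1w1'.
exists f => //; split; last by exists w1'.
apply: (L2_ae_eq _ wf Lw); exact: continuous_measurable (AC_continuous fw1).
Qed.

End HalfLaplacianRegularity.

(** * Sobolev classes and their multipliers *)

Section SobolevAlgebra.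
Context {R : realType}.
Notation mu := (@lebesgue_measure R).
Implicit Types (f g u v w p psi : R -> R) (x : R).

Lemma Sob_cat k f : Sob k.+1 f -> Sob k f.
Proof.
elim: k f => [|k IH] f Sf; first exact: Sob_L2 Sf.
have [Lf [g fg Sg]] := (SobS k.+1 f).1 Sf.
by apply/SobS; split => //; exists g => //; exact: IH.
Qed.

Lemma SobD k f g : Sob k f -> Sob k g -> Sob k (fun x => f x + g x).
Proof.
elim: k f g => [|k IH] f g Sf Sg; first exact: L2D.
have [Lf [f' ff Sf']] := (SobS k f).1 Sf; have [Lg [g' gg Sg']] := (SobS k g).1 Sg.
apply/SobS; split; first exact: L2D.
by exists (fun x => f' x + g' x); [exact: ACD|exact: IH].
Qed.

Lemma SobZ k c f : Sob k f -> Sob k (fun x => c * f x).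
Proof.
elim: k f => [|k IH] f Sf; first exact: L2Z.
have [Lf [f' ff Sf']] := (SobS k f).1 Sf.
apply/SobS; split; first exact: L2Z.
by exists (fun x => c * f' x); [exact: ACZ|exact: IH].
Qed.

Lemma Sob_continuous k f : Sob k.+1 f -> continuous f.
Proof. by move=> /SobS[_ [g fg _]]; exact: AC_continuous fg. Qed.

Lemma AC_dist f g (p q : R) : AC f g -> intg g -> p <= q ->
  `|f q - f p| <= \int[mu]_x `|g x|.
Proof.
move=> [lg fg] ig pq; rewrite fg// Rint_itvE; have Ig := locint_ind p q lg.
apply: le_trans (le_normr_Rintegral measurableT Ig) _.
apply: le_Rintegral => //; [exact: intg_norm Ig|exact: intg_norm ig|].
by move=> x _; rewrite normrM ler_piMl// ind_bound.
Qed.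

(** The square of f has the integrable derivative 2 f f', so its total variation
    on the line is finite. *)
Lemma Sob_bounded k f : Sob k.+1 f -> exists2 M : R, 0 <= M & forall x, `|f x| <= M.
Proof.
move=> /SobS[Lf [g fg /Sob_L2 Lg]].
have A := ACM fg fg; have I : intg (fun x => g x * f x + f x * g x).
  by apply: intgD; exact: L2M_intg.
set B := \int[mu]_x `|g x * f x + f x * g x|.
have B0 : 0 <= B by apply: Rintegral_ge0 => x _.
exists (f 0 * f 0 + B + 1) => [|x]; first by rewrite !addr_ge0// -expr2 sqr_ge0.
have : f x * f x <= f 0 * f 0 + B.
  have [x0|x0] := leP 0 x.
    by have := AC_dist A I x0; rewrite -/B ler_norml; lra.
  by have := AC_dist A I (ltW x0); rewrite -/B ler_norml; lra.
have : `|f x| * `|f x| = f x * f x by rewrite -normrM ger0_norm// -expr2 sqr_ge0.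
by have := normr_ge0 (f x); set t := `|f x|; nra.
Qed.

(** Multipliers of the Sobolev classes: bounded functions whose derivative, but
    not necessarily the function itself, is square integrable.  This makes room
    for sin psi, which tends to 1 and -1 at the two ends. *)
Definition Mult (k : nat) f : Prop :=
  [/\ measurable_fun [set: R] f, exists2 M : R, 0 <= M & forall x, `|f x| <= M &
      if k is k'.+1 then exists2 g, AC f g & Sob k' g else True].

Lemma Sob_Mult k f : Sob k.+1 f -> Mult k.+1 f.
Proof.
move=> Sf; split; [exact: L2_meas (Sob_L2 Sf)|exact: Sob_bounded Sf|].
by have [_] := (SobS k f).1 Sf.
Qed.

Lemma Mult_cat k f : Mult k.+1 f -> Mult k f.
Proof.
move=> [mf bf [g fg Sg]]; split => //; case: k Sg => // k Sg.
by exists g => //; exact: Sob_cat.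
Qed.

(** In the derivative f' g + f g' both terms are again products of a multiplier
    and a Sobolev function one order below, since g is also a multiplier. *)
Lemma Mult_Sob k f g : Mult k f -> Sob k g -> Sob k (fun x => f x * g x).
Proof.
elim: k f g => [|k IH] f g Mf Sg.
  by have [mf [M _ fM] _] := Mf; exact: L2Mb mf fM Sg.
have [mf [M _ fM] [f' ff Sf']] := Mf; have [Lg [g' gg Sg']] := (SobS k g).1 Sg.
apply/SobS; split; first exact: L2Mb mf fM Lg.
exists (fun x => f' x * g x + f x * g' x); first exact: ACM.
apply: SobD; last by apply: IH => //; exact: Mult_cat.
have := IH g f' (Mult_cat (Sob_Mult Sg)) Sf'.
by congr Sob; apply/funext => x; rewrite mulrC.
Qed.

Lemma AC_comp (F F' : R -> R) psi p : (forall x, is_derive x (1 : R) F (F' x)) ->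
  continuous F' -> AC psi p -> continuous p ->
  AC (fun x => F (psi x)) (fun x => F' (psi x) * p x).
Proof.
move=> dF cF' psip cp; apply: AC_C1 => [x|x].
  exact: derive_comp (dF (psi x)) (AC_derive psip cp x).
have cpsi := AC_continuous psip.
have H : F' (psi y) @[y --> x] --> F' (psi x) by apply: continuous_comp; [exact: cpsi|exact: cF'].
by apply: cvgM; [exact: H|exact: cp].
Qed.

Lemma AC_sin psi p : AC psi p -> continuous p ->
  AC (fun x => sin (psi x)) (fun x => cos (psi x) * p x).
Proof. exact: (AC_comp (fun x => is_derive_sin x) (@continuous_cos R)). Qed.

Lemma AC_cos psi p : AC psi p -> continuous p ->
  AC (fun x => cos (psi x)) (fun x => - sin (psi x) * p x).
Proof.
apply: (AC_comp (F' := fun x => - sin x) (fun x => is_derive_cos x)) => x.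
by apply: cvgN; exact: continuous_sin.
Qed.

Lemma MultN k f : Mult k f -> Mult k (fun x => - f x).
Proof.
move=> [mf [M M0 fM] fk]; split; first exact: measurableT_comp.
  by exists M => // x; rewrite normrN.
case: k fk => // k [g fg Sg]; exists (fun x => -1 * g x); last exact: SobZ.
by have := ACZ (-1) fg; congr AC; apply/funext => x; rewrite mulN1r.
Qed.

(** Each of sin psi and cos psi has the other one times psi' as its derivative,
    up to sign, so the two gain regularity together. *)
Lemma Mult_trig k psi p : AC psi p -> continuous p -> Sob k p ->
  Mult k.+1 (fun x => sin (psi x)) /\ Mult k.+1 (fun x => cos (psi x)).
Proof.
move=> psip cp; have cs := AC_sin psip cp; have cc := AC_cos psip cp.
have bs : exists2 M : R, 0 <= M & forall x, `|sin (psi x)| <= M.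
  by exists 1 => // x; exact: sin_bound.
have bc : exists2 M : R, 0 <= M & forall x, `|cos (psi x)| <= M.
  by exists 1 => // x; exact: cos_bound.
have ms := continuous_measurable (AC_continuous cs).
have mc := continuous_measurable (AC_continuous cc).
have step k' : Mult k' (fun x => sin (psi x)) -> Mult k' (fun x => cos (psi x)) ->
    Sob k' p -> Mult k'.+1 (fun x => sin (psi x)) /\ Mult k'.+1 (fun x => cos (psi x)).
  move=> Ms Mc Sp; split; split => //.
    by exists (fun x => cos (psi x) * p x) => //; exact: Mult_Sob.
  by exists (fun x => - sin (psi x) * p x) => //; apply: Mult_Sob => //; exact: MultN.
elim: k => [|k IH] Sp; first by apply: step => //; split.
by have [Ms Mc] := IH (Sob_cat Sp); exact: step.
Qed.

Lemma weak_derivative_pred n u g w : AC u g -> weak_derivative n.+1 u w ->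
  weak_derivative n g w.
Proof.
move=> ug [lu lw uw]; split => //; first exact: ug.1.
move=> phi tphi; have := uw phi tphi.
rewrite derive1nS (Rint_test_ibp ug (test_function_derive1n n tphi)) exprS mulN1r mulNr.
by move/oppr_inj.
Qed.

Lemma weak_derivative_ae n u v w : locint v -> {ae mu, forall x, u x = v x} ->
  weak_derivative n u w -> weak_derivative n v w.
Proof.
move=> lv uv [lu lw uw]; split => // phi tphi; rewrite -uw//.
have tn := test_function_derive1n n tphi.
apply: Rint_ae_eq; [exact: intg_meas (intg_test lv tn)|exact: intg_meas (intg_test lu tn)|].
by apply: ae_imp uv => x ->.
Qed.

(** Order by order, each weak derivative is exchanged for the absolutely
    continuous representative that [weak_derivative_AC] provides. *)
Lemma sobolev_ae k u : sobolev k u ->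
  exists2 v, {ae mu, forall x, u x = v x} & Sob k v.
Proof.
elim: k u => [|k IH] u su.
  have [v uv Lv] := su 0%N (leqnn _); exists v => //.
  by apply: (weak_derivative_uniq _ uv); apply: weak_derivative0; case: uv.
have [v0 uv0 Lv0] := su 0%N isT; have [u1 uu1 Lu1] := su 1%N isT.
have uv0E : {ae mu, forall x, v0 x = u x}.
  by apply: (weak_derivative_uniq uv0); apply: weak_derivative0; case: uv0.
have [f fu1 uf] := weak_derivative_AC uu1.
have [g u1g Sg] : exists2 v, {ae mu, forall x, u1 x = v x} & Sob k v.
  apply: IH => j jk; have [v uv Lv] := su j.+1 jk; exists v => //.
  exact: weak_derivative_pred fu1 (weak_derivative_ae (AC_locint fu1) uf uv).
exists f => //; apply/SobS; split.
  apply: (L2_ae_eq (u := v0)) => //; first exact: continuous_measurable (AC_continuous fu1).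
  by apply: ae_imp2 uv0E uf => x -> ->.
by exists g => //; exact: AC_ae fu1 (L2_locint (Sob_L2 Sg)) u1g.
Qed.

Lemma sobolev_Sob k u : continuous u -> sobolev k u -> Sob k u.
Proof.
move=> cu su; have [v uv Sv] := sobolev_ae su.
case: k su Sv => [|k] su Sv.
  apply: (L2_ae_eq (u := v)) => //; first exact: continuous_measurable.
  by apply: ae_imp uv.
by rewrite (continuous_ae_eq cu (Sob_continuous Sv) uv).
Qed.

Lemma Sob_sobolev k u : Sob k u -> sobolev k u.
Proof.
elim: k u => [|k IH] u Su [|j] jk //.
- by exists u => //; apply: weak_derivative0; exact: L2_locint.
- by exists u; [apply: weak_derivative0; apply: L2_locint|]; exact: Sob_L2 Su.
- have [_ [g ug Sg]] := (SobS k u).1 Su; have [v gv Lv] := IH g Sg j jk.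
  by exists v => //; exact: weak_derivativeS ug gv.
Qed.

Lemma Sob_derivative k f g : AC f g -> continuous g -> Sob k.+2 f -> Sob k.+1 g.
Proof.
move=> fg cg /SobS[_ [h fh Sh]].
by rewrite (continuous_ae_eq cg (Sob_continuous Sh) (AC_uniq fg fh)).
Qed.

Lemma Sob_smooth f : (forall k, Sob k f) -> smooth f.
Proof.
apply: (smooth_coind (P := fun f => forall k, Sob k f)) => {}f Sf.
have [_ [g fg Sg]] := (SobS 1 f).1 (Sf 2%N); have cg := Sob_continuous Sg.
exists g => [k|x]; last exact: AC_derive.
by apply: Sob_cat; exact: Sob_derivative fg cg (Sf k.+2).
Qed.

End SobolevAlgebra.

(** * Travelling waves *)

Section TravellingWave.
Context {R : realType}.
Notation mu := (@lebesgue_measure R).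
Implicit Types (f g u v w p psi thetab : R -> R) (x : R).

(** By uniqueness of weak derivatives, the infimum that defines the norm is over
    a single number. *)
Lemma sobolev_norm1E u u1 : AC u u1 -> measurable_fun [set: R] u1 ->
  sobolev_norm 1 u = sqrte (sqn u + sqn u1)%E.
Proof.
move=> uu1 mu1; have mu' := continuous_measurable (AC_continuous uu1).
rewrite /sobolev_norm.
have -> : [set N | exists2 D : nat -> R -> R,
    forall j : nat, (j <= 1)%N -> weak_derivative j u (D j) &
    N = sqrte (\sum_(j < 2) \int[mu]_x ((D j x) ^+ 2)%:E)%E] =
    [set sqrte (sqn u + sqn u1)%E]; last exact: ereal_inf1.
apply/seteqP; split => N /=.
- move=> [D Dw ->]; congr sqrte; rewrite big_ord_recl big_ord1; congr (_ + _)%E.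
    have w0 := Dw 0%N isT; apply: sqn_ae_eq => //; first by case: w0 => _ /locint_meas.
    apply: weak_derivative_uniq w0 _; apply: weak_derivative0; exact: AC_locint uu1.
  have w1 := Dw 1%N isT; apply: sqn_ae_eq => //; first by case: w1 => _ /locint_meas.
  exact: weak_derivative_uniq w1 (AC_weak uu1).
- move=> ->; exists (fun j => if j is 0 then u else u1).
    move=> [|[|]]// _; last exact: AC_weak.
    by apply: weak_derivative0; exact: AC_locint uu1.
  by rewrite big_ord_recl big_ord1.
Qed.

Lemma sobolev_norm1_le (K : R) u u1 v v1 : 0 <= K -> AC u u1 -> AC v v1 ->
  L2 u -> L2 u1 -> L2 v -> L2 v1 ->
  (sqn u + sqn u1 <= K%:E * (sqn v + sqn v1))%E ->
  (sobolev_norm 1 u <= (Num.sqrt K)%:E * sobolev_norm 1 v)%E.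
Proof.
move=> K0 uu1 vv1 Lu Lu1 Lv Lv1.
rewrite (sobolev_norm1E uu1 (L2_meas Lu1)) (sobolev_norm1E vv1 (L2_meas Lv1)).
have := sqn_ge0 v; have := sqn_ge0 v1.
rewrite (sqn_fin Lu) (sqn_fin Lu1) (sqn_fin Lv) (sqn_fin Lv1).
rewrite -!EFinD -EFinM !lee_fin /= => v10 v0 h.
by rewrite -sqrtrM// ler_wsqrtr.
Qed.

Local Lemma comp_arith (U U1 V V1 : \bar R) (M : R) :
  U \is a fin_num -> U1 \is a fin_num -> V \is a fin_num -> V1 \is a fin_num ->
  (0 <= V -> 0 <= V1 -> U <= V -> U1 <= 2%:E * V1 + 2%:E * ((M ^+ 2)%:E * V) ->
   U + U1 <= (2 + 2 * M ^+ 2)%:E * (V + V1))%E.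
Proof.
move=> /fineK <- /fineK <- /fineK <- /fineK <-.
rewrite -!EFinM -!EFinD -?EFinM -?EFinD !lee_fin => V0 V10 h1 h2.
have := mulr_ge0 (sqr_ge0 M) V10; lra.
Qed.

(** The chain rule estimate for both sin and cos: writing v = psi - thetab,
    (F(psi) - F(thetab))' = F'(psi) v' + (F'(psi) - F'(thetab)) thetab', where
    F and F' are 1-Lipschitz.  The constant 2 + 2 M^2 dominates the weights
    1 + 2 M^2 of v^2 and 2 of v'^2 in the sum of the two squares. *)
Lemma sobolev_norm1_comp (F F' : R -> R) psi p thetab q (M : R) :
  (forall x, is_derive x (1 : R) F (F' x)) -> continuous F' ->
  (forall x, `|F' x| <= 1) -> (forall x y, `|F x - F y| <= `|x - y|) ->
  (forall x y, `|F' x - F' y| <= `|x - y|) ->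
  AC psi p -> continuous p -> AC thetab q -> continuous q ->
  (forall x, `|q x| <= M) ->
  L2 (fun x => psi x - thetab x) -> L2 (fun x => p x - q x) ->
  (sobolev_norm 1 (fun x => F (psi x) - F (thetab x))%R <=
    (Num.sqrt (2 + 2 * M ^+ 2))%:E * sobolev_norm 1 (fun x => psi x - thetab x)%R)%E.
Proof.
move=> dF cF' F'1 FL F'L psip cp tq cq qM Lv Lv1.
have M0 : 0 <= M := le_trans (normr_ge0 _) (qM 0).
have B f f' g g' : AC f f' -> AC g g' -> AC (fun x => f x - g x) (fun x => f' x - g' x).
  move=> fA gA; have := ACD fA (ACZ (-1) gA).
  by congr AC; apply/funext => x; rewrite mulN1r.
have A := B _ _ _ _ (AC_comp dF cF' psip cp) (AC_comp dF cF' tq cq).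
have mA := continuous_measurable (AC_continuous A).
have A1 := B _ _ _ _ psip tq.
have mpsi := continuous_measurable (AC_continuous psip).
have mt := continuous_measurable (AC_continuous tq).
have mF' := continuous_measurable cF'.
have mF'psi : measurable_fun [set: R] (fun x => F' (psi x)) := measurableT_comp mF' mpsi.
have mF't : measurable_fun [set: R] (fun x => F' (thetab x)) := measurableT_comp mF' mt.
have Lu : L2 (fun x => F (psi x) - F (thetab x)) by exact: L2_le mA Lv _.
have s1 : (sqn (fun x => F (psi x) - F (thetab x))%R <= sqn (fun x => psi x - thetab x)%R)%E.
  by apply: sqn_le => //; exact: L2_meas.
have Lr : L2 (fun x => (F' (psi x) - F' (thetab x)) * q x).
  apply: (L2_le (g := fun x => M * (psi x - thetab x))); last 1 first.
  - by move=> x; rewrite !normrM mulrC ler_pM// (ger0_norm M0).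
  - by apply: measurable_funM; [exact: measurable_funB|exact: continuous_measurable].
  - exact: L2Z.
have Ll : L2 (fun x => F' (psi x) * (p x - q x)) := L2Mb mF'psi (fun x => F'1 (psi x)) Lv1.
have E : (fun x => F' (psi x) * p x - F' (thetab x) * q x) =
    (fun x => F' (psi x) * (p x - q x) + (F' (psi x) - F' (thetab x)) * q x).
  by apply/funext => x; ring.
have Lu1 : L2 (fun x => F' (psi x) * p x - F' (thetab x) * q x) by rewrite E; exact: L2D.
have s2 : (sqn (fun x => F' (psi x) * p x - F' (thetab x) * q x)%R <=
    2%:E * sqn (fun x => p x - q x)%R + 2%:E * ((M ^+ 2)%:E * sqn (fun x => psi x - thetab x)%R))%E.
  rewrite E; apply: le_trans (sqnD (L2_meas Ll) (L2_meas Lr)) _; apply: leeD.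
    apply: lee_wpmul2l => //; apply: sqn_le; [exact: L2_meas|exact: L2_meas|].
    by move=> x; rewrite normrM ler_piMl.
  apply: lee_wpmul2l => //; rewrite -(sqnZ M (L2_meas Lv)).
  apply: sqn_le; [exact: L2_meas|exact: L2_meas (L2Z M Lv)|].
  by move=> x; rewrite !normrM mulrC ler_pM// (ger0_norm M0).
apply: (sobolev_norm1_le _ A A1 Lu Lu1 Lv Lv1); first by rewrite addr_ge0// mulr_ge0// sqr_ge0.
exact: (comp_arith (L2_fin Lu) (L2_fin Lu1) (L2_fin Lv) (L2_fin Lv1)
  (sqn_ge0 _) (sqn_ge0 _) s1 s2).
Qed.

Lemma trig_lipschitz (F F' : R -> R) : (forall x, is_derive x (1 : R) F (F' x)) ->
  continuous F' -> (forall x, `|F' x| <= 1) -> forall x y, `|F x - F y| <= `|x - y|.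
Proof.
move=> dF cF' F'1; have A := AC_C1 dF cF'.
have W x y : y <= x -> `|F x - F y| <= `|x - y|.
  by move=> yx; have := AC_lipschitz A F'1 yx; rewrite mul1r (ger0_norm (_ : 0 <= x - y)) ?subr_ge0.
move=> x y; have [yx|/ltW xy] := leP y x; first exact: W.
by rewrite distrC (distrC x); exact: W.
Qed.

Section WithWall.
Context (thetab : R -> R) (hthetab : static_neel_wall thetab).

Lemma neel_continuous : continuous thetab.
Proof. exact: smooth_continuous (neel_smooth hthetab). Qed.

Lemma neel_derivative_continuous : continuous (derive1 thetab).
Proof. exact: smooth_continuous (smooth_derive1 (neel_smooth hthetab)). Qed.

Lemma neel_AC : AC thetab (derive1 thetab).
Proof.
apply: AC_C1; last exact: neel_derivative_continuous.
by move=> x; exact: smooth_is_derive (neel_smooth hthetab).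
Qed.

Lemma neel_Sob k : Sob k (derive1 thetab).
Proof. exact: (sobolev_Sob neel_derivative_continuous (neel_derivative hthetab (k := k))). Qed.

(** The difference psi - thetab is continuous and in H^2, so it lies in [Sob 2];
    adding thetab', which lies in every class, to its derivative gives psi'. *)
Lemma wave_profile nu H c psi : travelling_wave nu H c thetab psi ->
  exists p, [/\ AC psi p, Sob 1 p,
    L2 (fun x => psi x - thetab x) & L2 (fun x => p x - derive1 thetab x)].
Proof.
move=> tw; have cpsi := wave_continuous tw.
have Sv : Sob 2 (fun x => psi x - thetab x).
  apply: sobolev_Sob; last exact: wave_H2 tw.
  by move=> x; apply: cvgB; [exact: cpsi|exact: neel_continuous].
have [Lv [v1 vv1 Sv1]] := (SobS 1 _).1 Sv.
exists (fun x => v1 x + derive1 thetab x); split => //.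
- by have := ACD vv1 neel_AC; congr AC; apply/funext => x; rewrite subrK.
- exact: SobD Sv1 (neel_Sob 1).
- by have := Sob_L2 Sv1; congr L2; apply/funext => x; rewrite addrK.
Qed.

(** Since c^2 <> 1, the wave equation determines psi'' from psi' and T(cos psi),
    and T costs one derivative of cos psi, that is, none of psi'.  So psi'' has
    the regularity of psi', and psi' gains one order. *)
Lemma wave_bootstrap nu H c psi p k : `|c| < 1 -> travelling_wave nu H c thetab psi ->
  AC psi p -> Sob k.+1 p -> Sob k.+2 p.
Proof.
move=> c1 tw psip Sp; have cp := Sob_continuous Sp.
have [psi1 [psi2 [g [w1 w2 [theta2 [t [w2' [w [a [b [Fu Fw]]] tE] gE]]] eqn]]]] := wave_equation tw.
have [Ms Mc] := Mult_trig psip cp (Sob_cat Sp).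
have Su : Sob k.+2 (cos \o psi).
  apply/SobS; split; first by have [] := fourier_L2 Fu.
  exists (fun x => - sin (psi x) * p x); first exact: AC_cos.
  exact: Mult_Sob (MultN Ms) Sp.
have [w' ww' Sw'] := half_laplacian_Sob Su Fu Fw.
have c2 : c ^+ 2 - 1 != 0.
  rewrite subr_eq0 sqrf_eq1; apply/negP => /orP[]/eqP cE; move: c1; rewrite cE ?normrN normr1 ltxx//.
pose F x := (c ^+ 2 - 1)^-1 * ((nu * c) * p x + (sin (psi x) * (cos (psi x) + w' x) + H * cos (psi x))).
have SF : Sob k.+1 F.
  have Su' := Sob_cat Su; apply: SobZ; apply: SobD; first exact: SobZ.
  apply: SobD; last exact: SobZ.
  by apply: Mult_Sob Ms _; exact: SobD.
have pF : {ae mu, forall x, psi2 x = F x}.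
  have e1 := weak_derivative_uniq w1 (AC_weak psip).
  have e2 := weak_derivative_uniq w2' w2.
  apply: ae_imp2 (ae_imp2 (fun x => @conj _ _) e1 e2) (ae_imp2 (fun x => @conj _ _) ww' (ae_imp2 (fun x => @conj _ _) gE eqn)).
  move=> x [psi1E theta2E] [wE [gxE]]; rewrite gxE psi1E theta2E tE /= wE => eqx.
  rewrite /F; apply: (mulfI c2); rewrite mulVKf//; move: eqx; lra.
have [f fpsi2 pf] := weak_derivative_AC (weak_derivative_pred psip w2).
have pE : p = f := continuous_ae_eq cp (AC_continuous fpsi2) pf.
apply/SobS; split; first exact: Sob_L2 Sp.
by exists F => //; rewrite pE; exact: AC_ae fpsi2 (L2_locint (Sob_L2 SF)) pF.
Qed.

Lemma wave_smooth nu H c psi : `|c| < 1 -> travelling_wave nu H c thetab psi ->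
  smooth psi /\ forall k, sobolev k (derive1 psi).
Proof.
move=> c1 tw; have [p [psip S1 _ _]] := wave_profile tw.
have Sp k : Sob k p.
  by apply: Sob_cat; elim: k => [//|k IH]; exact: wave_bootstrap c1 tw psip IH.
have dpsi := AC_derive psip (Sob_continuous S1).
have -> : derive1 psi = p by apply/funext => x; exact: derive1_is_derive.
split; first exact: smooth_from_derive dpsi (Sob_smooth Sp).
by move=> k; exact: Sob_sobolev.
Qed.

End WithWall.

End TravellingWave.

Theorem lemma3p9 (R : realType) (thetab : R -> R)
    (hthetab : static_neel_wall thetab) :
  exists C1 C2 : R, [/\ 0 < C1, 0 < C2 &
    forall (nu H c : R) (psi : R -> R),
      0 < nu -> `|c| < 1 -> travelling_wave nu H c thetab psi ->
      ((sobolev_norm 1 ((sin \o psi) \- (sin \o thetab))%R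
          <= C1%:E * sobolev_norm 1 (psi \- thetab)%R)%E /\
       (sobolev_norm 1 ((cos \o psi) \- (cos \o thetab))%R
          <= C2%:E * sobolev_norm 1 (psi \- thetab)%R)%E) /\
      (smooth psi /\ forall k : nat, (0 < k)%N -> sobolev k (derive1 psi))].
Proof.
(* M bounds thetab'; the constants depend on thetab through M alone. *)
have [M M0 tM] := Sob_bounded (neel_Sob hthetab 1).
have C0 : 0 < Num.sqrt (2 + 2 * M ^+ 2) :> R.
  by rewrite sqrtr_gt0 ltr_wpDr// mulr_ge0// sqr_ge0.
exists (Num.sqrt (2 + 2 * M ^+ 2)), (Num.sqrt (2 + 2 * M ^+ 2)); split => //.
move=> nu H c psi _ c1 tw.
have [p [psip Sp Lv Lv1]] := wave_profile hthetab tw.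
have cp := Sob_continuous Sp; have tq := neel_AC hthetab.
have cq := neel_derivative_continuous hthetab.
have cNs : continuous (fun x : R => - sin x) by move=> x; apply: cvgN; exact: continuous_sin.
have ds x : is_derive x (1 : R) sin (cos x) := is_derive_sin x.
have dc x : is_derive x (1 : R) cos (- sin x) := is_derive_cos x.
have bNs (x : R) : `|- sin x| <= 1 by rewrite normrN sin_bound.
have ls := trig_lipschitz ds (@continuous_cos R) (@cos_bound R).
have lc := trig_lipschitz dc cNs bNs.
have lNs (x y : R) : `|- sin x - - sin y| <= `|x - y| by rewrite -opprD normrN ls.
have [sm sob] := wave_smooth hthetab c1 tw.
split; last by split => // k _; exact: sob.
split; first exact: sobolev_norm1_comp ds (@continuous_cos R) (@cos_bound R) ls lc psip cp tq cq tM Lv Lv1.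
exact: sobolev_norm1_comp dc cNs bNs lc lNs psip cp tq cq tM Lv Lv1.
Qed.
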